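(* Let $\mathcal{J}$ be a homogeneous Hopf ideal of $\mathcal{L}$, and let $S$ denote the corresponding semigroup. Then $\mathcal{L}_{\mathcal{J}}$ and $\mathcal{L}[S]$ are unitarily equivalent.
   Context: Let $d$ be a fixed positive integer, $\mathbb{F}_d^*$ the unital free semigroup on $\{1,\dots,d\}$ with identity $\varnothing$, $|w|$ the length of a word, and $\mathbb{F}_d^{*0}$ the semigroup obtained by adjoining a zero $0$. Let $\ell^2(\mathbb{F}_d^* )$ have orthonormal basis $\{\xi_w\}$ and put $L_u\xi_w=\xi_{uw}$, with $L_0:=0$. $\mathcal{L}=\mathcal{L}_d$ is the unital weak-operator-closed (WOT-closed) algebra generated by $\{L_u:u\in\mathbb{F}_d^*\}$, with comultiplication $\Delta:\mathcal{L}\to\mathcal{L}\overline\otimes\mathcal{L}$, the unital weak*-continuous completely contractive homomorphism with $\Delta(L_w)=L_w\otimes L_w$. A Hopf ideal is a WOT-closed two-sided ideal $\mathcal{J}$ with $\Delta(\mathcal{J})\subseteq\overline{\mathcal{J}\otimes\mathcal{L}+\mathcal{L}\otimes\mathcal{J}}^{w^*}$; it is homogeneous if it is generated by homogeneous polynomials in $L_1,\dots,L_d$. Put $\mathcal{N}_{\mathcal{J}}=(\mathcal{J}\xi_\varnothing)^\perp$ and $\mathcal{L}_{\mathcal{J}}=P_{\mathcal{N}_{\mathcal{J}}}\mathcal{L}|_{\mathcal{N}_{\mathcal{J}}}$. The corresponding semigroup: define $u\sim v$ iff $L_u-L_v\in\mathcal{J}$ for $u,v\in\mathbb{F}_d^{*0}$.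 This is a semigroup congruence with the property that $u\sim v\not\sim 0$ implies $|u|=|v|$, and $\mathcal{J}=\overline{\mathrm{span}}^{w^*}\{L_u-L_v:u\sim v\}$. Let $S=\mathbb{F}_d^{*0}/{\sim}$ with quotient map $q$, zero element $\dot0=q(0)$, $S_0=S\setminus\{\dot0\}$, and for $s\in S$ let $[s]=q^{-1}(s)$ (finite for $s\in S_0$). $\mathcal{H}[S]$ is the Hilbert space with orthogonal basis $\{x_s:s\in S_0\}$ and inner product $(x_s,x_t)_S=\delta_{s,t}\frac1{|[s]|}$; set $x_{\dot0}=0$. For $s\in S$ define the (contractive) operator $L_s$ on $\mathcal{H}[S]$ by $L_sx_t=x_{st}$. $\mathcal{L}[S]$ is the WOT-closed algebra generated by $\{L_s:s\in S\}$. *)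

(* Defs.v *)
From HB Require Import structures.
From mathcomp Require Import all_boot all_order all_algebra sesquilinear finmap.
From mathcomp Require Import complex.
From mathcomp Require Import boolp classical_sets functions cardinality fsbigop.
From mathcomp Require Import reals ereal interval_inference esum numfun.
From mathcomp Require Import ring lra.
Set Implicit Arguments.
Unset Strict Implicit.
Unset Printing Implicit Defensive.
Import Order.TTheory GRing.Theory Num.Theory.
Local Open Scope classical_set_scope.
Local Open Scope ring_scope.

Section Sums.
Context {R : realType} {I : choiceType}.
Implicit Types f g a b : I -> R.

Definition rsummable f := summable [set: I] (EFin \o f).

(* Unordered sum of an absolutely summable family (positive part minus
   negative part); the value is meaningless for other families. *)
Definition rsum f : R :=
  fine (\esum_(i in [set: I]) ((EFin \o f)^\+ i)
        - \esum_(i in [set: I]) ((EFin \o f)^\- i))%E.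

Definition csum (f : I -> R[i]) : R[i] :=
  Complex (rsum (fun i => complex.Re (f i))) (rsum (fun i => complex.Im (f i))).

Lemma rsummable_le f g : (forall i, `|f i| <= `|g i|) ->
  rsummable g -> rsummable f.
Proof.
move=> fg; apply: le_lt_trans; apply: le_esum => i _ /=.
by rewrite lee_fin.
Qed.

Lemma rsummableD f g : rsummable f -> rsummable g ->
  rsummable (fun i => f i + g i).
Proof. exact: summableD. Qed.

Lemma esum_scale f (c : R) : 0 <= c -> (forall i, 0 <= f i) ->
  (\esum_(i in [set: I]) (c * f i)%:E
   = c%:E * \esum_(i in [set: I]) (f i)%:E)%E.
Proof.
move=> c0 f0; rewrite /esum -ereal_supZl//; last first.
  by apply/set0P; exists 0%E, set0; [exact: fsets_set0|rewrite fsbig_set0].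
congr ereal_sup; apply/seteqP; split => [_ [A fA <-]|_ [_ [A fA <-] <-]].
  exists (\sum_(i \in A) (f i)%:E)%E; first by exists A.
  by rewrite ge0_mule_fsumr// => i; rewrite lee_fin.
by exists A => //; rewrite ge0_mule_fsumr// => i; rewrite lee_fin.
Qed.

Lemma rsummableZ f c : rsummable f -> rsummable (fun i => c * f i).
Proof.
rewrite /rsummable /summable => sf.
rewrite (eq_esum (b := fun i => (`|c| * `|f i|)%:E)); last first.
  by move=> i _; rewrite /= normrM.
rewrite esum_scale//.
have := sf; rewrite -ge0_fin_numE; last exact: esum_ge0.
by move=> fin; rewrite -(fineK fin) ltry.
Qed.

Lemma rsum_diff a b : rsummable a -> rsummable b ->
  (forall i, 0 <= a i) -> (forall i, 0 <= b i) ->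
  rsum (fun i => a i - b i) =
  fine (\esum_(i in [set: I]) (a i)%:E) - fine (\esum_(i in [set: I]) (b i)%:E).
Proof.
move=> sa sb a0 b0; rewrite /rsum.
have finite h : rsummable h -> (forall i, 0 <= h i) ->
    (\esum_(i in [set: I]) (h i)%:E)%E \is a fin_num.
  move=> sh h0; rewrite ge0_fin_numE; last first.
    by apply: esum_ge0 => i _; rewrite lee_fin.
  apply: le_lt_trans sh; apply: le_esum => i _ /=.
  by rewrite lee_fin ler_norm.
rewrite -(fineB (finite _ sa a0) (finite _ sb b0)); congr fine.
have := @esumB R I setT (EFin \o a) (EFin \o b) sa sb.
by apply => i _; rewrite lee_fin.
Qed.

Let pos f i := (`|f i| + f i) / 2.
Let neg f i := (`|f i| - f i) / 2.

Let pos_ge0 f i : 0 <= pos f i.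
Proof. by rewrite divr_ge0// -lerBlDr sub0r -normrN ler_norm. Qed.

Let neg_ge0 f i : 0 <= neg f i.
Proof. by rewrite divr_ge0// subr_ge0 ler_norm. Qed.

Let posneg f i : f i = pos f i - neg f i.
Proof. by rewrite /pos /neg; lra. Qed.

Let pos_summable f : rsummable f -> rsummable (pos f).
Proof.
apply: rsummable_le => i; rewrite ger0_norm//.
by rewrite ler_pdivrMr// mulr_natr mulr2n lerD2l ler_norm.
Qed.

Let neg_summable f : rsummable f -> rsummable (neg f).
Proof.
apply: rsummable_le => i; rewrite ger0_norm//.
by rewrite ler_pdivrMr// mulr_natr mulr2n lerD2l -normrN ler_norm.
Qed.

Let S f := fine (\esum_(i in [set: I]) (f i)%:E)%E.

Let fin_esum f : rsummable f -> (forall i, 0 <= f i) ->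
  (\esum_(i in [set: I]) (f i)%:E)%E \is a fin_num.
Proof.
move=> sf f0; rewrite ge0_fin_numE; last first.
  by apply: esum_ge0 => i _; rewrite lee_fin.
apply: le_lt_trans sf; apply: le_esum => i _ /=.
by rewrite lee_fin ler_norm.
Qed.

Let S_D f g : rsummable f -> rsummable g -> (forall i, 0 <= f i) ->
  (forall i, 0 <= g i) -> S (fun i => f i + g i) = S f + S g.
Proof.
move=> sf sg f0 g0; rewrite /S -fineD ?fin_esum//; congr fine.
under eq_esum do rewrite EFinD.
by rewrite esumD// => i _; rewrite lee_fin.
Qed.

Let rsumE f : rsummable f -> rsum f = S (pos f) - S (neg f).
Proof.
move=> sf; rewrite -rsum_diff//; [|exact: pos_summable|exact: neg_summable].
by congr rsum; apply/funext => i; rewrite -posneg.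
Qed.

Lemma rsumD f g : rsummable f -> rsummable g ->
  rsum (fun i => f i + g i) = rsum f + rsum g.
Proof.
move=> sf sg; rewrite (rsumE sf) (rsumE sg) addrACA -opprD.
have [pf nf pg ng] := And4 (pos_summable sf) (neg_summable sf)
  (pos_summable sg) (neg_summable sg).
rewrite -!S_D// -rsum_diff//; [|exact: rsummableD|exact: rsummableD| |].
- by congr rsum; apply/funext => i; rewrite opprD addrACA -!posneg.
- by move=> i; rewrite addr_ge0.
- by move=> i; rewrite addr_ge0.
Qed.

Lemma rsumN f : rsummable f -> rsum (fun i => - f i) = - rsum f.
Proof.
move=> sf; rewrite (rsumE sf) opprB -rsum_diff//.
- by congr rsum; apply/funext => i; rewrite -opprB -posneg.
- exact: neg_summable.
- exact: pos_summable.
Qed.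

Let rsumZ_ge0 f c : 0 <= c -> rsummable f ->
  rsum (fun i => c * f i) = c * rsum f.
Proof.
move=> c0 sf; rewrite (rsumE sf) mulrBr.
have SZ h : (forall i, 0 <= h i) -> c * S h = S (fun i => c * h i).
  move=> h0; rewrite /S esum_scale//.
  have : (0 <= \esum_(i in [set: I]) (h i)%:E)%E.
    by apply: esum_ge0 => i _; rewrite lee_fin.
  case: (\esum_(i in _) _)%E => [r _ //| _ |//].
  move: c0; rewrite le_eqVlt => /orP[/eqP<-|c0].
    by rewrite !mul0r mul0e.
  by rewrite gt0_muley ?lte_fin//= mulr0.
rewrite !SZ// -rsum_diff.
- by congr rsum; apply/funext => i; rewrite -mulrBr -posneg.
- exact/rsummableZ/pos_summable.
- exact/rsummableZ/neg_summable.
- by move=> i; rewrite mulr_ge0.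
- by move=> i; rewrite mulr_ge0.
Qed.

Lemma rsumZ f c : rsummable f -> rsum (fun i => c * f i) = c * rsum f.
Proof.
move=> sf; have [c0|/ltW c0] := leP 0 c; first exact: rsumZ_ge0.
rewrite -[c]opprK [RHS]mulNr -rsumZ_ge0 ?oppr_ge0// -rsumN.
  by congr rsum; apply/funext => i; rewrite mulNr.
exact: rsummableZ.
Qed.

Lemma rsum_ge0E f : rsummable f -> (forall i, 0 <= f i) ->
  rsum f = fine (\esum_(i in [set: I]) (f i)%:E)%E.
Proof.
move=> sf f0; have s0 : rsummable (fun=> 0 : R).
  by rewrite /rsummable /summable esum1// => i _ /=; rewrite normr0.
rewrite -[LHS]/(rsum (fun i => f i)).
under [in LHS]eq_fun do rewrite -[f _]subr0.
by rewrite rsum_diff// [X in _ - fine X]esum1// subr0.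
Qed.

End Sums.

Section ComplexSums.
Context {R : realType} {I : choiceType}.
Implicit Types f g : I -> R[i].

Definition csummable f :=
  rsummable (fun i => complex.Re (f i)) /\ rsummable (fun i => complex.Im (f i)).

Lemma csumD f g : csummable f -> csummable g ->
  csum (fun i => f i + g i) = csum f + csum g.
Proof.
move=> [rf jf] [rg jg].
transitivity (Complex (rsum (fun i => complex.Re (f i) + complex.Re (g i)))
    (rsum (fun i => complex.Im (f i) + complex.Im (g i)))); last by rewrite !rsumD.
by rewrite /csum; congr Complex; congr rsum; apply/funext => i;
  case: (f i) (g i) => [? ?] [? ?].
Qed.

Lemma csumZ f c : csummable f -> csum (fun i => c * f i) = c * csum f.
Proof.
case: c => a b [rf jf].
have sn : rsummable (fun i => - (b * complex.Im (f i))).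
  by apply: rsummable_le (rsummableZ b jf) => i; rewrite normrN.
transitivity (Complex
    (rsum (fun i => a * complex.Re (f i) + - (b * complex.Im (f i))))
    (rsum (fun i => a * complex.Im (f i) + b * complex.Re (f i)))).
  by rewrite /csum; congr Complex; congr rsum; apply/funext => i;
    case: (f i).
by rewrite !rsumD ?rsumN ?rsumZ//; exact: rsummableZ.
Qed.

Lemma csum_conj f : csummable f -> csum (fun i => (f i)^*) = (csum f)^*.
Proof.
move=> [rf jf].
transitivity (Complex (rsum (fun i => complex.Re (f i)))
    (rsum (fun i => - complex.Im (f i)))); last by rewrite rsumN.
by rewrite /csum; congr Complex; congr rsum; apply/funext => i;
  case: (f i).
Qed.

End ComplexSums.

Section Ell2.
Context {R : realType} {I : choiceType} (mu : I -> {posnum R}).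
Implicit Types x y : I -> R[i].

Definition sqmod (z : R[i]) : R := complex.Re z ^+ 2 + complex.Im z ^+ 2.

Definition sqsummable : {pred I -> R[i]} :=
  fun x => `[< rsummable (fun i => (mu i)%:num * sqmod (x i)) >].

Let amgm (a b c e : R) :
  `|a * c + b * e| <= (a ^+ 2 + b ^+ 2) + (c ^+ 2 + e ^+ 2).
Proof.
have := sqr_ge0 (a + c); have := sqr_ge0 (b + e); have := sqr_ge0 (a - c).
have := sqr_ge0 (b - e); have := sqr_ge0 a; have := sqr_ge0 b.
have := sqr_ge0 c; have := sqr_ge0 e; rewrite ler_norml !expr2.
by move=> *; apply/andP; split; lra.
Qed.

Lemma sqsummable_dot x y : x \in sqsummable -> y \in sqsummable ->
  csummable (fun i => ((mu i)%:num%:C)%C * (x i * (y i)^*)).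
Proof.
move=> /asboolP sx /asboolP sy.
have s := rsummableD sx sy.
split; apply: rsummable_le s => i; rewrite [leRHS]ger0_norm -?mulrDr;
  rewrite ?mulr_ge0 ?addr_ge0 ?sqr_ge0//;
  case: (x i) (y i) => [a b] [c e]; rewrite /= !(mul0r, subr0, addr0) normrM gtr0_norm// ler_pM2l//;
  rewrite /sqmod/=.
  by rewrite mulrN opprK; exact: amgm.
by have := amgm a b (- e) c; rewrite sqrrN [e ^+ 2 + _]addrC.
Qed.

Lemma sqsummable_submod : submod_closed sqsummable.
Proof.
split=> [|c x y /asboolP sx /asboolP sy]; apply/asboolP.
  rewrite /rsummable /summable esum1// => i _ /=.
  by rewrite /sqmod/= expr0n/= addr0 mulr0 normr0.
have s := rsummableD (rsummableZ (2 * sqmod c) sx) (rsummableZ 2 sy).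
apply: rsummable_le s => i.
have sq0 z : 0 <= sqmod z by rewrite addr_ge0 ?sqr_ge0.
rewrite [leRHS]ger0_norm ?addr_ge0 ?mulr_ge0//.
rewrite ger0_norm ?mulr_ge0//.
rewrite [2 * sqmod c * _]mulrCA [2 * (_ * _)]mulrCA -mulrDr ler_pM2l//.
rewrite -[(c *: x + y) i]/(c * x i + y i).
case: c (x i) (y i) => [c1 c2] [x1 x2] [y1 y2]; rewrite /sqmod/=.
have := sqr_ge0 (c1 * x1 - c2 * x2 - y1).
by have := sqr_ge0 (c1 * x2 + c2 * x1 - y2); rewrite !expr2; lra.
Qed.

HB.instance Definition _ :=
  GRing.isSubmodClosed.Build R[i] (I -> R[i]) sqsummable sqsummable_submod.

(* The weighted space with inner product sum_i mu_i x_i (y_i)^*. *)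
Record ell2 := Ell2 { ell2_fun :> I -> R[i]; ell2P : ell2_fun \in sqsummable }.

HB.instance Definition _ := [isSub for ell2_fun].
HB.instance Definition _ := [Choice of ell2 by <:].
HB.instance Definition _ := [SubChoice_isSubLmodule of ell2 by <:].

Definition ell2_dot (x y : ell2) : R[i] :=
  csum (fun i => ((mu i)%:num%:C)%C * (x i * (y i)^*)).

Lemma ell2_dot_additivel (z : ell2) : zmod_morphism (ell2_dot ^~ z).
Proof.
move=> x y; have sx := sqsummable_dot (ell2P x) (ell2P z).
have sy := sqsummable_dot (ell2P y) (ell2P z).
rewrite /ell2_dot -[- csum _]mulN1r -csumZ// -csumD//; last first.
  suff -> : (fun i => -1 * (((mu i)%:num%:C)%C * (y i * (z i)^*))) =
      (fun i => ((mu i)%:num%:C)%C * ((- y) i * (z i)^*)).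
    exact: sqsummable_dot (ell2P (- y)) (ell2P z).
  by apply/funext => i; rewrite mulN1r -mulrN -mulNr.
by congr (csum _); apply/funext => i; rewrite mulN1r -mulrN -mulNr -mulrDr -mulrDl.
Qed.

Lemma ell2_dot_scalel (z : ell2) : scalable_for *%R (ell2_dot ^~ z).
Proof.
move=> c x; have sx := sqsummable_dot (ell2P x) (ell2P z).
rewrite /ell2_dot -csumZ//; congr (csum _); apply/funext => i.
by rewrite [RHS]mulrCA [c * (_ * _)]mulrA.
Qed.

Lemma ell2_dot_herm (x y : ell2) :
  ell2_dot x y = (-1) ^+ false * (ell2_dot y x)^*.
Proof.
have syx := sqsummable_dot (ell2P y) (ell2P x).
rewrite expr0 mul1r /ell2_dot -csum_conj//; congr (csum _); apply/funext => i.
rewrite !rmorphM/= conjCK [(y i)^* * _]mulrC; congr (_ * _); exact/esym/conjc_real.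
Qed.

Lemma ell2_dot_additiver (z : ell2) : zmod_morphism (ell2_dot z).
Proof.
move=> x y; rewrite [LHS]ell2_dot_herm ell2_dot_additivel.
by rewrite rmorphB mulrBr -!ell2_dot_herm.
Qed.

Lemma ell2_dot_scaler (z : ell2) :
  scalable_for (Num.conj \; *%R) (ell2_dot z).
Proof.
move=> c x; rewrite [LHS]ell2_dot_herm ell2_dot_scalel/= rmorphM.
by rewrite mulrCA -ell2_dot_herm.
Qed.

Lemma ell2_dot_gt0 (x : ell2) : x != 0 -> 0 < ell2_dot x x.
Proof.
move=> x0; have [i xi0] : exists i, x i != 0.
  apply/not_existsP => h; move/eqP: x0; apply; apply/val_inj/funext => i /=.
  by apply/eqP/negPn/negP/h.
have sx : rsummable (fun i => (mu i)%:num * sqmod (x i)) by exact/asboolP/(ell2P x).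
have ge0 j : 0 <= (mu j)%:num * sqmod (x j).
  by rewrite mulr_ge0// addr_ge0 ?sqr_ge0.
have -> : ell2_dot x x = ((rsum (fun i => (mu i)%:num * sqmod (x i)))%:C)%C.
  rewrite /ell2_dot /csum; congr Complex; last first.
    rewrite -[RHS](mul0r (rsum (fun i => (mu i)%:num * sqmod (x i)))) -rsumZ//.
    congr rsum; apply/funext => j; case: (x j) => a b /=; ring.
  congr rsum; apply/funext => j; rewrite /sqmod; case: (x j) => a b /=; ring.
rewrite ltcR rsum_ge0E// fine_gt0//; apply/andP; split; last first.
  by apply: le_lt_trans sx; apply: le_esum => j _ /=; rewrite lee_fin ler_norm.
apply: lt_le_trans (esum_ge (x := ((mu i)%:num * sqmod (x i))%:E) _).
  rewrite lte_fin mulr_gt0// lt_neqAle addr_ge0 ?sqr_ge0// andbT eq_sym.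
  rewrite paddr_eq0 ?sqr_ge0// !sqrf_eq0; apply: contra xi0.
  by case: (x i) => a b /= /andP[/eqP-> /eqP->].
by exists [set i]; [split=> //|rewrite fsbig_set1].
Qed.

HB.instance Definition _ := isBilinear.Build R[i] ell2 ell2 R[i] *%R
  (Num.conj \; *%R) ell2_dot ell2_dot_additivel ell2_dot_additiver
  ell2_dot_scalel ell2_dot_scaler.
HB.instance Definition _ := isHermitianSesquilinear.Build R[i] ell2 false
  Num.conj ell2_dot ell2_dot_herm.
HB.instance Definition _ := isDotProduct.Build R[i] ell2 ell2_dot ell2_dot_gt0.

End Ell2.

(* Completeness is not a field: it holds for the instances below (weighted
   ell2 spaces and orthogonal complements in them), and no definition uses it. *)
Record ipSpace (R : realType) := IPSpace {
  ip_sort :> lmodType R[i];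
  ip_form : {dot ip_sort for Num.conj} }.

Notation "''[' u , v ]" := (ip_form _ u v) : ring_scope.

Canonical ell2_ip (R : realType) (I : choiceType) (mu : I -> {posnum R}) :=
  IPSpace (ell2_dot (mu := mu) : {dot ell2 mu for Num.conj}).

Section Perp.
Context {R : realType} {H : ipSpace R} (G : set H).

Definition perp_pred : {pred H} := fun x => `[< forall g, G g -> '[x, g] = 0 >].

Lemma perp_submod : submod_closed perp_pred.
Proof.
split=> [|c x y /asboolP px /asboolP py]; apply/asboolP => g Gg.
  exact: linear0l.
by rewrite linearPl/= px// py// mulr0 addr0.
Qed.

HB.instance Definition _ :=
  GRing.isSubmodClosed.Build R[i] H perp_pred perp_submod.

Record perp := Perp { perp_val :> H; perpP : perp_val \in perp_pred }.

HB.instance Definition _ := [isSub for perp_val].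
HB.instance Definition _ := [Choice of perp by <:].
HB.instance Definition _ := [SubChoice_isSubLmodule of perp by <:].

Definition perp_dot (x y : perp) : R[i] := '[val x, val y].

Lemma perp_dot_additivel (z : perp) : zmod_morphism (perp_dot ^~ z).
Proof. by move=> x y; rewrite /perp_dot raddfB/= linearBl. Qed.

Lemma perp_dot_scalel (z : perp) : scalable_for *%R (perp_dot ^~ z).
Proof. by move=> c x; rewrite /perp_dot linearZ/= linearZl_LR. Qed.

Lemma perp_dot_additiver (z : perp) : zmod_morphism (perp_dot z).
Proof. by move=> x y; rewrite /perp_dot !raddfB. Qed.

Lemma perp_dot_scaler (z : perp) :
  scalable_for (Num.conj \; *%R) (perp_dot z).
Proof. by move=> c x; rewrite /perp_dot linearZ. Qed.

Lemma perp_dot_herm (x y : perp) :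
  perp_dot x y = (-1) ^+ false * (perp_dot y x)^*.
Proof. exact: hermitian_subproof. Qed.

Lemma perp_dot_gt0 (x : perp) : x != 0 -> 0 < perp_dot x x.
Proof.
move=> x0; apply: neq0_dnorm_gt0; apply: contra x0 => /eqP x0.
exact/eqP/val_inj.
Qed.

HB.instance Definition _ := isBilinear.Build R[i] perp perp R[i] *%R
  (Num.conj \; *%R) perp_dot perp_dot_additivel perp_dot_additiver
  perp_dot_scalel perp_dot_scaler.
HB.instance Definition _ := isHermitianSesquilinear.Build R[i] perp false
  Num.conj perp_dot perp_dot_herm.
HB.instance Definition _ := isDotProduct.Build R[i] perp perp_dot perp_dot_gt0.

End Perp.

Canonical perp_ip (R : realType) (H : ipSpace R) (G : set H) :=
  IPSpace (perp_dot (G := G) : {dot perp G for Num.conj}).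

Section Operators.
Context {R : realType} {H : ipSpace R}.

Definition hnorm (x : H) : R := Num.sqrt (complex.Re '[x, x]).

Definition bounded_op (T : H -> H) :=
  linear T /\ exists c : R, forall x, hnorm (T x) <= c * hnorm x.

(* Functionals defining the weak operator topology; those of wstar_functional
   are the normal ones T |-> tr (T K), K trace class, so that they define the
   weak* topology of B(H). *)
Definition wot_functional : set ((H -> H) -> R[i]) :=
  [set phi | exists x y : H, phi = fun T => '[T x, y]].

Definition wstar_functional : set ((H -> H) -> R[i]) :=
  [set phi | exists x y : nat -> H,
    [/\ rsummable (fun n => hnorm (x n) ^+ 2),
        rsummable (fun n => hnorm (y n) ^+ 2) &
        phi = fun T => csum (fun n => '[T (x n), y n])]].

(* Closure in B(H) for the weakest topology making Phi continuous. *)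
Definition weak_closure (Phi : set ((H -> H) -> R[i])) (A : set (H -> H)) :
    set (H -> H) :=
  [set T | bounded_op T /\
    forall (n : nat) (phi : 'I_n -> (H -> H) -> R[i]),
      (forall k, Phi (phi k)) -> forall e : R[i], 0 < e ->
      exists2 X, A X & forall k, `|phi k T - phi k X| < e].

Definition wot_closed (A : set (H -> H)) := weak_closure wot_functional A `<=` A.

Definition wstar_closure (A : set (H -> H)) := weak_closure wstar_functional A.

Definition op_span (G : set (H -> H)) : set (H -> H) :=
  [set T | exists (n : nat) (c : 'I_n -> R[i]) (X : 'I_n -> H -> H),
    (forall k, G (X k)) /\ T = \sum_(k < n) c k *: X k].

Definition op_subalgebra (A : set (H -> H)) :=
  [/\ A `<=` bounded_op, A 0,
      forall c X Y, A X -> A Y -> A (c *: X + Y) &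
      forall X Y, A X -> A Y -> A (X \o Y)].

Definition wot_algebra (G : set (H -> H)) : set (H -> H) :=
  [set T | forall A, op_subalgebra A -> wot_closed A -> G `<=` A -> A T].

Definition op_ideal (A J : set (H -> H)) :=
  [/\ J `<=` A, J 0,
      forall c X Y, J X -> J Y -> J (c *: X + Y) &
      forall X Y, A X -> J Y -> J (X \o Y) /\ J (Y \o X)].

Definition wot_ideal (A G : set (H -> H)) : set (H -> H) :=
  [set T | forall J, op_ideal A J -> wot_closed J -> G `<=` J -> J T].

(* The n x n operator matrix X has norm at most c on the n-fold sum of H. *)
Definition opmx_bounded (n : nat) (X : 'I_n -> 'I_n -> H -> H) (c : R) :=
  forall x : 'I_n -> H,
    \sum_(i < n) hnorm (\sum_(j < n) X i j (x j)) ^+ 2 <=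
    c ^+ 2 * \sum_(j < n) hnorm (x j) ^+ 2.

End Operators.

Section OperatorMaps.
Context {R : realType} {H K : ipSpace R}.

Definition wstar_continuous (A : set (H -> H)) (D : (H -> H) -> (K -> K)) :=
  forall psi, wstar_functional psi -> forall T, A T ->
  forall e : R[i], 0 < e ->
  exists (n : nat) (phi : 'I_n -> (H -> H) -> R[i]) (dl : R[i]),
    [/\ forall k, wstar_functional (phi k), 0 < dl &
        forall X, A X -> (forall k, `|phi k T - phi k X| < dl) ->
          `|psi (D T) - psi (D X)| < e].

Definition completely_contractive (A : set (H -> H))
    (D : (H -> H) -> (K -> K)) :=
  forall (n : nat) (X : 'I_n -> 'I_n -> H -> H) (c : R), 0 <= c ->
    (forall i j, A (X i j)) -> opmx_bounded X c ->
    opmx_bounded (fun i j => D (X i j)) c.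

Definition unitarily_equivalent (A : set (H -> H)) (B : set (K -> K)) :=
  exists U : H -> K,
    [/\ linear U, bijective U, forall x y, '[U x, U y] = '[x, y] &
        forall T, B T <-> exists2 X, A X & forall x, T (U x) = U (X x)].

End OperatorMaps.

(* P_N A|_N for N the orthogonal complement of G: the condition says that B x
   is the orthogonal projection of X x on N. *)
Definition compression (R : realType) (H : ipSpace R) (G : set H)
    (A : set (H -> H)) : set (perp G -> perp G) :=
  [set B | exists2 X, A X &
    forall x y : perp G, '[X (val x) - val (B x), val y : H] = 0].

Section Basis.
Context {R : realType} {I : choiceType} (mu : I -> {posnum R}).

Lemma basis_proof (i : I) :
  (fun j : I => (j == i)%:R : R[i]) \in sqsummable mu.
Proof.
apply/asboolP; rewrite /rsummable /summable (esumID [set i])//.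
rewrite setTI esum_set1// [X in (_ + X)%E]esum1 ?adde0 ?ltry// => j [_ /=].
by move/eqP/negPf => ->; rewrite /sqmod/= expr0n addr0 mulr0 normr0.
Qed.

Definition basis (i : I) : ell2 mu := Ell2 (basis_proof i).

End Basis.

Definition l2 (R : realType) (I : choiceType) : ipSpace R :=
  ell2_ip (fun _ : I => 1%:pos).

Section Tensor.
Context {R : realType} {I J : choiceType}.

Lemma tensor_proof (x : l2 R I) (y : l2 R J) :
  (fun k : I * J => x k.1 * y k.2) \in sqsummable (R := R) (fun=> 1%:pos).
Proof.
have /asboolP sx := ell2P x; have /asboolP sy := ell2P y; apply/asboolP.
have sq0 (z : R[i]) : 0 <= sqmod z by rewrite addr_ge0 ?sqr_ge0.
have fin (K : choiceType) (z : K -> R[i]) :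
    rsummable (fun i => (1%:pos : {posnum R})%:num * sqmod (z i)) ->
    (\esum_(k in [set: K]) (sqmod (z k))%:E < +oo)%E.
  apply: le_lt_trans; apply: le_esum => k _.
  by rewrite lee_fin mul1r ler_norm.
have {}sx := fin _ _ sx; have {}sy := fin _ _ sy.
pose a i j := (sqmod (x i) * sqmod (y j))%:E.
rewrite /rsummable /summable (eq_esum (b := fun k => a k.1 k.2)); last first.
  move=> [i j] _ /=; rewrite mul1r ger0_norm// /a; congr EFin.
  by rewrite /sqmod; case: (x i) (y j) => [? ?] [? ?] /=; ring.
have -> : [set: I * J] = [set: I] `*`` (fun=> [set: J]).
  by apply/seteqP; split.
rewrite -(@esum_esum R I J setT (fun=> setT) a)//; last first.
  by move=> i j _ _; rewrite lee_fin mulr_ge0.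
rewrite /a; under eq_esum do rewrite esum_scale//.
move: sy; have : (0 <= \esum_(j in [set: J]) (sqmod (y j))%:E)%E.
  by apply: esum_ge0 => j _; rewrite lee_fin.
case: (\esum_(j in _) _)%E => // r r0 _.
under eq_esum do rewrite -EFinM mulrC; rewrite esum_scale//.
by rewrite lte_mul_pinfty.
Qed.

Definition tensor (x : l2 R I) (y : l2 R J) : l2 R (I * J)%type :=
  Ell2 (tensor_proof x y).

(* T = A (x) B as an operator on l2 (I * J) = l2 I (x) l2 J. *)
Definition is_tensor (A : l2 R I -> l2 R I) (B : l2 R J -> l2 R J)
    (T : l2 R (I * J)%type -> l2 R (I * J)%type) :=
  bounded_op T /\ forall x y, T (tensor x y) = tensor (A x) (B y).

Definition alg_tensor (A : set (l2 R I -> l2 R I)) (B : set (l2 R J -> l2 R J)) :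
    set (l2 R (I * J)%type -> l2 R (I * J)%type) :=
  op_span [set T | exists X Y, [/\ A X, B Y & is_tensor X Y T]].

End Tensor.

Definition word (d : nat) := seq 'I_d.

(* None is the adjoined zero. *)
Definition word0 (d : nat) := option (word d).

Definition mulw (d : nat) (u v : word0 d) : word0 d :=
  if u is Some a then if v is Some b then Some (a ++ b) else None else None.

(* The Hilbert space of the free semigroup, and its tensor square. *)
Notation fock R d := (l2 R (word d)).
Notation fock2 R d := (l2 R (word d * word d)%type).

Section FreeSemigroup.
Context {R : realType} {d : nat}.

Notation word := (word d).
Notation word0 := (word0 d).
Notation HF := (fock R d).
Notation HFF := (fock2 R d).

Lemma Lword_proof (u : word) (f : HF) :
  (fun w : word => if prefix u w then f (drop (size u) w) else 0)
    \in sqsummable (R := R) (fun=> 1%:pos).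
Proof.
have /asboolP sf := ell2P f; apply/asboolP; move: sf.
rewrite /rsummable /summable; set a := (EFin \o _) => sf.
rewrite (eq_esum (b := fun w => if w \in (cat u @` [set: word])
    then `|a (drop (size u) w)|%E else 0%E)).
  rewrite -esum_mkcond esum_image; last first.
    by move=> v w _ _ /eqP; rewrite eqseq_cat// eqxx => /eqP.
  by under eq_esum do rewrite drop_size_cat//.
move=> w _ /=; case: ifPn => [/prefixP[v ->]|uw].
  by rewrite mem_set//; exists v.
rewrite memNset; first by rewrite /= /sqmod/= expr0n addr0 mulr0 normr0.
by move=> [v _ wE]; move/negP: uw; apply; rewrite -wE prefix_prefix.
Qed.

Definition Lword (u : word) (f : HF) : HF := Ell2 (Lword_proof u f).

Definition Lop (u : word0) : HF -> HF := if u is Some a then Lword a else 0.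

Lemma Lword_basis (u w : word) : Lword u (basis _ w) = basis _ (u ++ w).
Proof.
apply/val_inj/funext => v /=; case: ifPn => [/prefixP[v' ->]|uv].
  by rewrite drop_size_cat// eqseq_cat// eqxx.
suff /negPf-> : v != u ++ w by [].
by apply: contra uv => /eqP->; exact: prefix_prefix.
Qed.

Lemma Lop_mulw u v : Lop (mulw u v) = Lop u \o Lop v.
Proof.
apply/funext => f; apply/val_inj/funext => w.
case: u v => [u|] [v|] //=; last first.
  by case: ifP.
rewrite size_cat; case: (boolP (prefix u w)) => [/prefixP[w' ->]|uw].
  by rewrite prefix_catr// eqxx addnC -drop_drop drop_size_cat.
suff -> : prefix (u ++ v) w = false by [].
by apply: contraNF uw => /prefixP[w' ->]; rewrite -catA prefix_prefix.
Qed.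

Lemma Lop_sub u (f g : HF) : Lop u (f - g) = Lop u f - Lop u g.
Proof.
apply/val_inj/funext => w; case: u => [u|] /=.
  rewrite -[RHS]/((if prefix u w then f (drop (size u) w) else 0) -
    (if prefix u w then g (drop (size u) w) else 0)).
  by case: ifP => _; rewrite ?subr0.
by rewrite -[RHS]/(0 - 0) subr0.
Qed.

(* Unital: Lword [::] is the identity. *)
Definition calL : set (HF -> HF) := wot_algebra (range Lword).

Lemma calL_Lop u : calL (Lop u).
Proof.
by case: u => [u|] A [? A0 ? ?] _ GA //; apply: GA; exists u.
Qed.

Definition comultiplication (Delta : (HF -> HF) -> (HFF -> HFF)) :=
  [/\ forall X, calL X -> wstar_closure (alg_tensor calL calL) (Delta X),
      [/\ forall c X Y, calL X -> calL Y ->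
            Delta (c *: X + Y) = c *: Delta X + Delta Y,
          forall X Y, calL X -> calL Y -> Delta (X \o Y) = Delta X \o Delta Y &
          Delta id = id],
      wstar_continuous calL Delta,
      completely_contractive calL Delta &
      forall w, is_tensor (Lword w) (Lword w) (Delta (Lword w))].

Definition hopf_ideal (Delta : (HF -> HF) -> (HFF -> HFF))
    (J : set (HF -> HF)) :=
  [/\ op_ideal calL J, wot_closed J &
      forall X, J X -> wstar_closure
        [set Y + Z | Y in alg_tensor J calL & Z in alg_tensor calL J] (Delta X)].

Definition homogeneous_poly (p : HF -> HF) :=
  exists (n : nat) (c : n.-tuple 'I_d -> R[i]),
    p = \sum_(w : n.-tuple 'I_d) c w *: Lword w.

Definition homogeneous (J : set (HF -> HF)) :=
  exists2 P : set (HF -> HF), P `<=` homogeneous_poly & J = wot_ideal calL P.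

Section Quotient.
Variable J : set (HF -> HF).

Definition N_ : ipSpace R := perp_ip [set X (basis _ [::]) | X in J].

Definition calLJ : set (N_ -> N_) := compression calL.

Definition sim (u v : word0) := J (Lop u - Lop v).

(* The quotient, as the type of classes; smul is the induced product whenever
   sim is a congruence, cf. smulE. *)
Definition Sgp := set_type (range (fun u => [set v | sim u v])).

Definition q (u : word0) : Sgp := SigSub (mem_set (imageT _ u)).

Definition cls (s : Sgp) : set word0 := q @^-1` [set s].

Definition smul (s t : Sgp) : Sgp := q (mulw (xget None (cls s)) (xget None (cls t))).

Context (J_ideal : op_ideal calL J).

Let simxx u : sim u u.
Proof. by case: J_ideal => _ J0 _ _; rewrite /sim subrr. Qed.

Let sim_sym u v : sim u v -> sim v u.
Proof.
case: J_ideal => _ J0 JD _ uv.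
by rewrite /sim -opprB -[- _]addr0 -scaleN1r; exact: JD.
Qed.

Let sim_trans v u w : sim u v -> sim v w -> sim u w.
Proof.
case: J_ideal => _ J0 JD _ uv vw.
have := JD 1 _ _ uv vw.
by rewrite scale1r addrA subrK.
Qed.

Lemma qP u v : q u = q v <-> sim u v.
Proof.
split=> [/(congr1 val)/= e|uv].
  by have : [set w | sim u w] v by rewrite e; exact: simxx.
apply/val_inj/seteqP; split => w /= uw; last exact: sim_trans uw.
exact: sim_trans (sim_sym uv) uw.
Qed.

Lemma smulE u v : smul (q u) (q v) = q (mulw u v).
Proof.
have repr w : sim (xget None (cls (q w))) w.
  apply/qP; suff : cls (q w) (xget None (cls (q w))) by [].
  by apply: xgetPex; exists w.
have [_ J0 _ JM] := J_ideal; apply/qP.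
apply: (@sim_trans (mulw u (xget None (cls (q v))))).
  rewrite /sim !Lop_mulw.
  by have [_] := JM _ _ (calL_Lop (xget None (cls (q v)))) (repr u).
rewrite /sim !Lop_mulw.
have [+ _] := JM _ _ (calL_Lop u) (repr v).
congr J; apply/funext => f /=.
exact: Lop_sub.
Qed.

Definition Sgp0 := {s : Sgp | s != q None}.

(* The weight of s is 1 / |[s]|. Classes are nonempty, and those of nonzero
   elements are finite when J is a homogeneous Hopf ideal; n.-1.+1 is then n,
   and is there only to make the weight positive for every J. *)
Definition weight (s : Sgp0) : {posnum R} :=
  ((#|` fset_set (cls (val s))|%fset.-1).+1%:R^-1)%:pos.

Definition HS : ipSpace R := ell2_ip weight.

Definition x_ (s : Sgp) : HS := if insub s is Some s0 then basis weight s0 else 0.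

(* L_s, as a relation: existence of a bounded operator acting so on the basis
   is a property of the weights, and uniqueness follows by density. *)
Definition is_LS (s : Sgp) (T : HS -> HS) :=
  bounded_op T /\ forall t, T (x_ t) = x_ (smul s t).

Definition calLS : set (HS -> HS) := wot_algebra [set T | exists s, is_LS s T].

End Quotient.

End FreeSemigroup.

Arguments calLJ {R d} J _.
Arguments calLS {R d} J _.

(* Main.v *)
From mathcomp Require Import all_boot all_order all_algebra sesquilinear finmap.
From mathcomp Require Import complex.
From mathcomp Require Import boolp classical_sets functions cardinality fsbigop.
From mathcomp Require Import reals ereal interval_inference esum.
From mathcomp Require Import ring lra zify.
Require Import Defs.

(** The map that sends the basis vector of a word to the basis vector of its class
extends to a coisometry [qmap] of the Fock space onto the semigroup space, and it
implements the equivalence.  Two facts carry the proof.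

The first is that the initial space of [qmap] is the orthogonal complement of
J xi_0, where xi_0 is the vacuum, so that [qmap] restricts to a unitary there.
Vectors orthogonal to J xi_0 are clearly constant on classes and zero on the null
class.  For the converse, the coefficients of X xi_0 must sum to zero over each
nonzero class, for every X in J.  The ideal is graded ([hcomp_ideal]), because the
elements of J all of whose homogeneous components lie in J form a WOT-closed ideal
that contains the generators; hence one degree can be treated at a time, and there
the annihilator of J is a space of functions on a finite set of words.  The Hopf
condition says exactly that this space is closed under pointwise products
([ann_mul]): a product of functionals is their tensor product composed with the
comultiplication.  A space of functions on a finite set that is closed under
products contains the indicators of the sets that it does not separate
([class_indicator]), and these sets are the classes by a double annihilator
argument ([ann_sim]).  This gives [class_sum].

The second is that the algebra of the semigroup consists of all the compressions
[qmap \o X \o qmap_adj] with X in the free semigroup algebra ([calLS_compress]).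
Compression is multiplicative because the kernel of [qmap] is invariant, so the
compressions form an algebra that contains the generators and lies in the
WOT-closed algebra that they generate.  What remains is that the compressions form
a WOT-closed set.  A limit T of compressions commutes with the compressed right
shifts, and a commutant lifting theorem ([commutant_lifting]) makes it the
compression of a bounded operator X that commutes with the right shifts.  Such an X
is the WOT limit of its Cesaro means, which are polynomials in the shifts
([rcomm_calL]).

Commutant lifting is proved by extending the adjoint of T from the initial space
of [qmap] through the spaces obtained by freeing the coefficients of the words of
length less than k, for k = 0, 1, 2 and so on.  Commutation with the adjoints of
the right shifts fixes the extended operator up to the vacuum coefficient of its
values, and a norm bound on the operator says that this coefficient is a linear
functional dominated by a nonnegative quadratic form.  A Hahn-Banach extension
([complex_extension]), made one word at a time, provides it. *)

Set Implicit Arguments.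
Unset Strict Implicit.
Unset Printing Implicit Defensive.
Import Order.TTheory GRing.Theory Num.Theory.
Local Open Scope classical_set_scope.
Local Open Scope ring_scope.

(** * Complex scalars and sesquilinear forms *)

Section Scalars.
Context {R : realType}.
Implicit Types z w : R[i].

Lemma sqmodE z : ((sqmod z)%:C)%C = z * z^*.
Proof. by rewrite /sqmod add_Re2_Im2 normCK. Qed.

Lemma sqmod_ge0 z : 0 <= sqmod z.
Proof. by rewrite addr_ge0 ?sqr_ge0. Qed.

Lemma sqmod_eq0 z : sqmod z = 0 -> z = 0.
Proof.
case: z => a b; rewrite /sqmod /= => /eqP.
by rewrite paddr_eq0 ?sqr_ge0// !sqrf_eq0 => /andP[/eqP-> /eqP->].
Qed.

Lemma sqmod0 : sqmod (0 : R[i]) = 0.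
Proof. by rewrite /sqmod /= expr0n addr0. Qed.

Lemma sqmodM z w : sqmod (z * w) = sqmod z * sqmod w.
Proof. by case: z w => [a b] [c d]; rewrite /sqmod /=; ring. Qed.

Lemma sqmodJ z : sqmod z^* = sqmod z.
Proof. by case: z => a b; rewrite /sqmod /= sqrrN. Qed.

Lemma sqmodN z : sqmod (- z) = sqmod z.
Proof. by case: z => a b; rewrite /sqmod /= !sqrrN. Qed.

Lemma sqmodC (r : R) : sqmod (r%:C)%C = r ^+ 2.
Proof. by rewrite /sqmod /= expr0n addr0. Qed.

Lemma conjM z w : (z * w)^* = z^* * w^*.
Proof. exact: rmorphM. Qed.

Lemma real_complexD (a b : R) : ((a + b)%:C)%C = (a%:C)%C + (b%:C)%C :> R[i].
Proof. exact: rmorphD. Qed.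

Lemma real_complexM (a b : R) : ((a * b)%:C)%C = (a%:C)%C * (b%:C)%C :> R[i].
Proof. exact: rmorphM. Qed.

Lemma conj_real_complex (a : R) : ((a%:C)%C : R[i])^* = (a%:C)%C.
Proof. exact: conjc_real. Qed.

Lemma conj_nat n : (n%:R : R[i])^* = n%:R.
Proof. exact: rmorph_nat. Qed.

Lemma sqmodB_le z w : sqmod (z - w) <= 2 * sqmod z + 2 * sqmod w.
Proof.
case: z w => [a b] [c d]; rewrite /sqmod /=.
have := sqr_ge0 (a + c); have := sqr_ge0 (b + d); lra.
Qed.

Lemma ReD z w : complex.Re (z + w) = complex.Re z + complex.Re w.
Proof. by case: z w => [a b] [c d]. Qed.

Lemma ReN z : complex.Re (- z) = - complex.Re z.
Proof. by case: z. Qed.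

Lemma ReJ z : complex.Re z^* = complex.Re z.
Proof. by case: z. Qed.

Lemma ReCM (r : R) z : complex.Re ((r%:C)%C * z) = r * complex.Re z.
Proof. by case: z => a b /=; rewrite mul0r subr0. Qed.

Lemma Re_sum (I : Type) (s : seq I) (F : I -> R[i]) :
  complex.Re (\sum_(i <- s) F i) = \sum_(i <- s) complex.Re (F i).
Proof. by elim: s => [|i s IH]; rewrite ?big_nil// !big_cons ReD IH. Qed.

Lemma Re_sqmod z : complex.Re (z * z^*) = sqmod z.
Proof. by rewrite -sqmodE. Qed.

Lemma Re_le_sqmod z : complex.Re z ^+ 2 <= sqmod z.
Proof. by rewrite lerDl sqr_ge0. Qed.

Lemma normC_lt z (e : R) : 0 < e -> (`|z| < (e%:C)%C) = (sqmod z < e ^+ 2).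
Proof.
move=> e0; rewrite normc_def ltcR /sqmod.
by rewrite -[X in (_ < X) = _]gtr0_norm// -sqrtr_sqr ltr_sqrt// exprn_gt0.
Qed.

Lemma gt0_complex (e : R[i]) : 0 < e -> exists2 r : R, 0 < r & e = (r%:C)%C.
Proof.
case: e => a b; rewrite ltcE /= => /andP[/eqP-> a0].
by exists a.
Qed.

(** The shape in which an approximation argument proves an equality: the bound c is
the same for all e. *)
Lemma eq0_sqmod_small z (c : R) :
  (forall e : R, 0 < e -> sqmod z <= c * e) -> z = 0.
Proof.
move=> h; apply: sqmod_eq0; apply/eqP; rewrite eq_le sqmod_ge0 andbT.
rewrite leNgt; apply/negP => z0.
have [c0|c0] := leP c 0.
  by have := h _ ltr01; rewrite mulr1 => /le_trans /(_ c0); rewrite leNgt z0.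
have := h _ (divr_gt0 z0 (mulr_gt0 (ltr0Sn R 1) c0)).
rewrite [c * _]mulrC -mulrA -[(2 * c)^-1 * c]/(((2 * c)^-1) * c).
rewrite invfM -mulrA mulVf ?gt_eqF// mulr1; lra.
Qed.

End Scalars.

Section LinearMaps.
Context {A : pzRingType} {U V : lmodType A}.
Implicit Types f g : U -> V.

Lemma lin0 f : linear f -> f 0 = 0.
Proof. by move=> lf; have := lf (-1) 0 0; rewrite scaler0 addr0 scaleN1r addNr. Qed.

Lemma linD f : linear f -> {morph f : x y / x + y}.
Proof. by move=> lf x y; rewrite -[x]scale1r lf !scale1r. Qed.

Lemma linZ f : linear f -> forall a, {morph f : x / a *: x}.
Proof. by move=> lf a x; rewrite -[a *: x]addr0 lf lin0// addr0. Qed.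

Lemma linB f : linear f -> {morph f : x y / x - y}.
Proof. by move=> lf x y; rewrite linD// -scaleN1r linZ// scaleN1r. Qed.

Lemma lin_sum f : linear f -> forall (I : Type) (s : seq I) (P : pred I) (F : I -> U),
  f (\sum_(i <- s | P i) F i) = \sum_(i <- s | P i) f (F i).
Proof.
move=> lf I s P F; elim: s => [|i s IH]; first by rewrite !big_nil lin0.
by rewrite !big_cons; case: ifP => // _; rewrite linD// IH.
Qed.

End LinearMaps.

Section InnerProduct.
Context {R : realType} {H : ipSpace R}.
Implicit Types x y : H.

Definition sqn x : R := complex.Re '[x, x].

Lemma dotC x y : '[x, y] = ('[y, x])^*.
Proof. by rewrite hermC/= expr0 mul1r. Qed.

Lemma dotDl x y z : '[x + y, z] = '[x, z] + '[y, z].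
Proof. exact: linearDl. Qed.
Lemma dotDr x y z : '[x, y + z] = '[x, y] + '[x, z].
Proof. exact: linearDr. Qed.
Lemma dotBl x y z : '[x - y, z] = '[x, z] - '[y, z].
Proof. exact: linearBl. Qed.
Lemma dotBr x y z : '[x, y - z] = '[x, y] - '[x, z].
Proof. exact: linearBr. Qed.
Lemma dotZl a x y : '[a *: x, y] = a * '[x, y].
Proof. exact: linearZl_LR. Qed.
Lemma dotZr a x y : '[x, a *: y] = a^* * '[x, y].
Proof. exact: linearZr_LR. Qed.
Lemma dot0l x : '[0, x] = 0. Proof. exact: linear0l. Qed.
Lemma dot0r x : '[x, 0] = 0. Proof. exact: linear0r. Qed.
Lemma dot_suml (I : Type) (s : seq I) (P : pred I) F y :
  '[\sum_(i <- s | P i) F i, y] = \sum_(i <- s | P i) '[F i, y].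
Proof. exact: linear_sumlz. Qed.
Lemma dot_sumr (I : Type) (s : seq I) (P : pred I) F y :
  '[y, \sum_(i <- s | P i) F i] = \sum_(i <- s | P i) '[y, F i].
Proof. exact: linear_sumr. Qed.

Lemma dotxx x : '[x, x] = ((sqn x)%:C)%C.
Proof. by rewrite /sqn RRe_real// ger0_real// dnorm_ge0. Qed.

Lemma sqn_ge0 x : 0 <= sqn x.
Proof. by rewrite -lecR -dotxx dnorm_ge0. Qed.

Lemma sqn_eq0 x : sqn x = 0 -> x = 0.
Proof. by move=> x0; apply/eqP; rewrite -(dnorm_eq0 (@ip_form R H)) dotxx x0. Qed.

Lemma sqn0 : sqn (0 : H) = 0.
Proof. by rewrite /sqn dot0l. Qed.

Lemma sqnZ a x : sqn (a *: x) = sqmod a * sqn x.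
Proof.
by rewrite /sqn dotZl dotZr mulrA dotxx -sqmodE -rmorphM.
Qed.

Lemma sqnD x y : sqn (x + y) = sqn x + sqn y + 2 * complex.Re '[x, y].
Proof.
by rewrite /sqn dotDl !dotDr [ '[y, x] ]dotC !ReD ReJ; ring.
Qed.

Lemma sqnN x : sqn (- x) = sqn x.
Proof. by rewrite -scaleN1r sqnZ sqmodN -[1]/((1%:C)%C) sqmodC expr1n mul1r. Qed.

Lemma sqnB x y : sqn (x - y) = sqn x + sqn y - 2 * complex.Re '[x, y].
Proof. by rewrite sqnD sqnN -scaleN1r dotZr rmorphN1 mulN1r ReN mulrN. Qed.

Lemma sqnD_le x y : sqn (x + y) <= 2 * sqn x + 2 * sqn y.
Proof.
have := sqn_ge0 (x - y); rewrite sqnB sqnD; lra.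
Qed.

Lemma cauchy_schwarz x y : sqmod '[x, y] <= sqn x * sqn y.
Proof.
have [y0|] := eqVneq (sqn y) 0.
  by rewrite (sqn_eq0 y0) dot0r sqmod0 sqn0 mulr0.
rewrite neq_lt ltNge sqn_ge0 /= => y0.
have := sqn_ge0 (((sqn y)%:C)%C *: x - '[x, y] *: y).
rewrite sqnB !sqnZ sqmodC dotZl dotZr ReCM.
rewrite [_^* * _]mulrC Re_sqmod => h.
rewrite -(ler_pM2l y0); move: h; nra.
Qed.

Lemma dot_eq0 x : (forall y, '[x, y] = 0) -> x = 0.
Proof. by move=> h; apply: sqn_eq0; rewrite /sqn h. Qed.

Lemma dot_inj x y : (forall z, '[x, z] = '[y, z]) -> x = y.
Proof.
by move=> h; apply/eqP; rewrite -subr_eq0; apply/eqP/dot_eq0 => z; rewrite dotBl h subrr.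
Qed.

Lemma hnorm_sqr x : hnorm x ^+ 2 = sqn x.
Proof. by rewrite sqr_sqrtr// sqn_ge0. Qed.

End InnerProduct.

(** * Bounded operators between two spaces *)

Section Bounded.
Context {R : realType}.

(** The bound c is on squared norms; this keeps square roots out of the estimates. *)
Definition bdd_by (H K : ipSpace R) (A : H -> K) (c : R) :=
  forall x, sqn (A x) <= c * sqn x.

Definition bdd (H K : ipSpace R) (A : H -> K) :=
  linear A /\ exists2 c, 0 <= c & bdd_by A c.

Lemma bddP (H : ipSpace R) (A : H -> H) : bounded_op A <-> bdd A.
Proof.
split=> -[lA [c]].
  move=> Ac; split=> //; exists (c ^+ 2) => [|x]; first exact: sqr_ge0.
  rewrite -!hnorm_sqr -exprMn ler_sqr ?nnegrE ?sqrtr_ge0//.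
  exact: le_trans (sqrtr_ge0 _) (Ac x).
move=> c0 Ac; split=> //; exists (Num.sqrt c) => x.
rewrite -ler_sqr ?nnegrE ?mulr_ge0 ?sqrtr_ge0//.
by rewrite exprMn !hnorm_sqr sqr_sqrtr.
Qed.

Lemma bdd0 (H K : ipSpace R) : bdd (0 : H -> K).
Proof.
split=> [a x y|]; first by rewrite /= scaler0 addr0.
by exists 0 => // x; rewrite [X in sqn X]/(0 : K) sqn0 mul0r.
Qed.

Lemma bdd_id (H : ipSpace R) : bdd (id : H -> H).
Proof. by split=> //; exists 1 => // x; rewrite mul1r. Qed.

Lemma bdd_comp (H K L : ipSpace R) (A : K -> L) (B : H -> K) :
  bdd A -> bdd B -> bdd (A \o B).
Proof.
move=> [lA [a a0 Aa]] [lB [b b0 Bb]]; split=> [c x y|]; first by rewrite /= lB lA.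
exists (a * b) => [|x]; first exact: mulr_ge0.
by apply: le_trans (Aa _) _; rewrite -mulrA ler_wpM2l.
Qed.

Lemma bdd_lin (H K : ipSpace R) c (A B : H -> K) :
  bdd A -> bdd B -> bdd (c *: A + B).
Proof.
move=> [lA [a a0 Aa]] [lB [b b0 Bb]]; split=> [d x y|].
  rewrite -![(c *: A + B) _]/(c *: A _ + B _) lA lB !scalerDr !scalerA [d * c]mulrC.
  by rewrite addrACA.
exists (2 * (sqmod c * a) + 2 * b) => [|x].
  by rewrite addr_ge0// !mulr_ge0// sqmod_ge0.
rewrite -[(c *: A + B) x]/(c *: A x + B x).
apply: le_trans (sqnD_le _ _) _; rewrite sqnZ [leRHS]mulrDl lerD//.
  by rewrite -!mulrA !ler_wpM2l// sqmod_ge0.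
by rewrite -mulrA ler_wpM2l.
Qed.

Lemma bdd_sum (H K : ipSpace R) (I : Type) (s : seq I) (F : I -> H -> K) :
  (forall i, bdd (F i)) -> bdd (\sum_(i <- s) F i).
Proof.
move=> bF; elim: s => [|i s IH]; first by rewrite big_nil; exact: bdd0.
by rewrite big_cons -[F i]scale1r; exact: bdd_lin.
Qed.

End Bounded.

(** * Weighted square-summable families *)

Section PartialSums.
Context {R : realType} {I : choiceType}.
Implicit Types f : I -> R.

Lemma rsummable_bound f c : (forall i, 0 <= f i) ->
  (forall s, uniq s -> \sum_(i <- s) f i <= c) -> rsummable f.
Proof.
move=> f0 fc; rewrite /rsummable /summable; apply: (@le_lt_trans _ _ (c%:E)%E); last exact: ltry.
apply: ge_ereal_sup => _ [A [finA _] <-].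
rewrite fsbig_finite//= (eq_bigr (fun i => (f i)%:E)) => [|i _]; last by rewrite ger0_norm.
by rewrite sumEFin lee_fin; exact: fc.
Qed.

Lemma esum_fin f : rsummable f -> (forall i, 0 <= f i) ->
  (\esum_(i in [set: I]) (f i)%:E)%E = (rsum f)%:E.
Proof.
move=> sf f0; rewrite rsum_ge0E// fineK//.
rewrite ge0_fin_numE; last by apply: esum_ge0 => i _; rewrite lee_fin.
by apply: le_lt_trans sf; apply: le_esum => i _; rewrite lee_fin ler_norm.
Qed.

Lemma partial_le_rsum f (s : seq I) : rsummable f -> (forall i, 0 <= f i) -> uniq s ->
  \sum_(i <- s) f i <= rsum f.
Proof.
move=> sf f0 us; rewrite -lee_fin -esum_fin// -sumEFin.
apply: esum_ge; exists [set` s]; first by split.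
by rewrite -fsbig_seq.
Qed.

Lemma rsum_approx f (e : R) : rsummable f -> (forall i, 0 <= f i) -> 0 < e ->
  exists2 s : seq I, uniq s & rsum f - e < \sum_(i <- s) f i.
Proof.
move=> sf f0 e0; have := esum_fin sf f0; rewrite /esum => E.
have : ((rsum f - e)%:E < ereal_sup
    [set (\sum_(x \in A) (f x)%:E)%E | A in fsets [set: I]])%E.
  by rewrite E lte_fin ltrBlDr ltrDl.
move=> /ereal_sup_gt[_ [A [finA _] <-]].
rewrite fsbig_finite// sumEFin lte_fin => h.
by exists (fset_set A).
Qed.

Lemma rsum0 : rsum (fun _ : I => 0 : R) = 0.
Proof.
rewrite rsum_ge0E//; first by rewrite esum1.
by rewrite /rsummable /summable esum1// => i _; rewrite /= normr0.
Qed.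

Lemma rsum_single f i0 : (forall i, i != i0 -> f i = 0) -> rsum f = f i0.
Proof.
move=> fi; have abs_le s : uniq s -> \sum_(i <- s) `|f i| <= `|f i0|.
  move=> us; have [si|si] := boolP (i0 \in s).
    by rewrite (bigD1_seq i0)//= big1 ?addr0// => i /fi ->; rewrite normr0.
  rewrite big1_seq// => i /= si'.
  by rewrite fi ?normr0//; apply: contraNneq si => <-.
have sf : rsummable f.
  by apply: rsummable_le (rsummable_bound _ abs_le) => // i; rewrite normr_id.
wlog f0 : f fi sf {abs_le} / 0 <= f i0 => [ge0|].
  have [/ge0|/ltW fi0] := leP 0 (f i0); first exact.
  apply: oppr_inj; rewrite -rsumN// ge0 ?oppr_ge0//.
    by move=> i /fi ->; rewrite oppr0.
  by apply: rsummable_le sf => i; rewrite normrN.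
have ge0 i : 0 <= f i by have [->|/fi ->] := eqVneq i i0.
apply: EFin_inj; rewrite -esum_fin// (esumID [set i0])//.
rewrite setTI setTI esum_set1 ?lee_fin// [X in (_ + X)%E]esum1 ?adde0//.
  by move=> i /= ii0; rewrite fi//; exact/eqP.
by move=> i _; rewrite lee_fin.
Qed.

End PartialSums.

Section Weighted.
Context {R : realType} {I : choiceType} {mu : I -> {posnum R}}.
Notation H := (ell2_ip mu).
Implicit Types (f g : H) (s : seq I).

Lemma ell2_ext f g : (forall i, f i = g i) -> f = g.
Proof. by move=> fg; apply/val_inj/funext. Qed.

Lemma ell2D f g i : (f + g) i = f i + g i. Proof. by []. Qed.
Lemma ell2N f i : (- f) i = - f i. Proof. by []. Qed.
Lemma ell2Z c f i : (c *: f) i = c * f i. Proof. by []. Qed.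
Lemma ell2_sum (J : Type) (s : seq J) (P : pred J) (F : J -> H) i :
  (\sum_(j <- s | P j) F j) i = \sum_(j <- s | P j) F j i.
Proof.
elim: s => [|j s IH]; first by rewrite !big_nil.
by rewrite !big_cons; case: ifP => // _; rewrite ell2D IH.
Qed.

Lemma sqnE f : sqn f = rsum (fun i => (mu i)%:num * sqmod (f i)).
Proof.
rewrite /sqn /= /ell2_dot /csum /=; congr rsum; apply/funext => i.
rewrite /sqmod; case: (f i) => a b /=; ring.
Qed.

Lemma basisE i j : basis mu i j = (j == i)%:R.
Proof. by []. Qed.

Lemma weighted_ge0 f i : 0 <= (mu i)%:num * sqmod (f i).
Proof. by rewrite mulr_ge0// sqmod_ge0. Qed.

Lemma partial_le_sqn f s : uniq s ->
  \sum_(i <- s) (mu i)%:num * sqmod (f i) <= sqn f.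
Proof.
rewrite sqnE; apply: partial_le_rsum; last exact: weighted_ge0.
exact/asboolP/(ell2P f).
Qed.

Lemma sqn_approx f (e : R) : 0 < e -> exists2 s, uniq s &
  sqn f - e < \sum_(i <- s) (mu i)%:num * sqmod (f i).
Proof.
rewrite sqnE; apply: rsum_approx; last exact: weighted_ge0.
exact/asboolP/(ell2P f).
Qed.

Lemma sqn_le f c : 
  (forall s, uniq s -> \sum_(i <- s) (mu i)%:num * sqmod (f i) <= c) ->
  sqn f <= c.
Proof.
move=> fc; apply/ler_addgt0Pr => e e0; have [s us /ltW] := sqn_approx f e0.
by rewrite lerBlDr => /le_trans; apply; rewrite lerD2r fc.
Qed.

Lemma sqsummable_bound (x : I -> R[i]) c :
  (forall s, uniq s -> \sum_(i <- s) (mu i)%:num * sqmod (x i) <= c) ->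
  x \in sqsummable mu.
Proof.
move=> xc; apply/asboolP; apply: rsummable_bound xc => i.
by rewrite mulr_ge0// sqmod_ge0.
Qed.

Lemma dot_basis f i : '[f, basis mu i] = ((mu i)%:num%:C)%C * f i.
Proof.
have E j : j != i -> ((mu j)%:num%:C)%C * (f j * (basis mu i j)^*) = 0.
  by move=> /negPf ji; rewrite /= ji rmorph0 !mulr0.
rewrite /= /ell2_dot /csum !(@rsum_single _ _ _ i) => [|j /E ->//|j /E ->//].
rewrite /= eqxx rmorph1 mulr1; by case: (_ * _).
Qed.

Lemma dot_ell2_eq0 f g : (forall i, f i = 0 \/ g i = 0) ->
  '[f, g] = 0.
Proof.
move=> fg; rewrite /= /ell2_dot.
rewrite (_ : (fun i => _) = fun=> 0); first by rewrite /csum !rsum0.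
by apply/funext => i; have [->|->] := fg i; rewrite ?rmorph0 !(mulr0, mul0r).
Qed.

(** The error of a finite truncation is the missing part of the sum of squares, by
orthogonality of the basis; density of the finite combinations follows. *)
Lemma sqn_trunc f s : uniq s ->
  sqn (f - \sum_(i <- s) f i *: basis mu i : H) =
  sqn f - \sum_(i <- s) (mu i)%:num * sqmod (f i).
Proof.
move=> us; set h : H := \sum_(i <- s) _.
have fh (g : H) : (forall i, i \in s -> g i = f i) -> 
   '[g, h] = ((\sum_(i <- s) (mu i)%:num * sqmod (f i))%:C)%C.
  move=> gf; rewrite dot_sumr (rmorph_sum (@real_complex R)); apply: eq_big_seq => i si.
  rewrite dotZr dot_basis gf// mulrCA [_^* * _]mulrC -sqmodE.
  exact/esym/(rmorphM (@real_complex R)).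
have hs i : i \in s -> h i = f i.
  move=> si; rewrite ell2_sum (bigD1_seq i)// ell2Z basisE eqxx mulr1.
  rewrite big1 => [|j /negPf ji]; first exact: addr0.
  by rewrite ell2Z basisE eq_sym ji mulr0.
rewrite [LHS](@sqnB _ H) fh// /sqn fh//=; ring.
Qed.

Lemma ell2_dense f (e : R) : 0 < e -> exists2 s, uniq s &
  sqn (f - \sum_(i <- s) f i *: basis mu i : H) < e.
Proof.
move=> e0; have [s us h] := sqn_approx f e0.
by exists s => //; rewrite sqn_trunc//; lra.
Qed.

End Weighted.

(** * Adjoints *)

Section Density.
Context {R : realType} {I : choiceType} {mu : I -> {posnum R}}.
Notation H := (ell2_ip mu).

(** Density argument: a bounded functional is small on the tail that a finite
combination of basis vectors leaves. *)
Lemma functional_eq0 (phi : H -> R[i]) c : 0 <= c ->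
  (forall a x y, phi (a *: x + y) = a * phi x + phi y) ->
  (forall x, sqmod (phi x) <= c * sqn x) ->
  (forall i, phi (basis mu i) = 0) -> forall x, phi x = 0.
Proof.
move=> c0 lphi phic phi0 x.
have z : phi 0 = 0.
  by have := lphi (-1) 0 0; rewrite scaler0 addr0 mulN1r addNr.
have phi_sum (s : seq I) (g : I -> R[i]) : phi (\sum_(i <- s) g i *: basis mu i) = 0.
  by elim: s => [|i s IH]; rewrite ?big_nil// big_cons lphi phi0 mulr0 add0r.
apply: (@eq0_sqmod_small _ _ c) => e e0; have [s us /ltW h] := ell2_dense x e0.
set g := (X in sqn (_ - X)) in h.
have -> : phi x = phi (x - g).
  by rewrite -[x in LHS](subrK g) -[x - g]scale1r lphi phi_sum addr0 mul1r scale1r.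
exact: le_trans (phic _) (ler_wpM2l c0 h).
Qed.

Context {K : ipSpace R}.
Implicit Types A B : H -> K.

Lemma bdd_eq_basis A B : bdd A -> bdd B ->
  (forall i, A (basis mu i) = B (basis mu i)) -> A = B.
Proof.
move=> bA bB AB; have [lD [c c0 Dc]] := bdd_lin (-1) bB bA.
set D := -1 *: B + A in lD Dc.
have DE g : D g = A g - B g by rewrite /D -[LHS]/(-1 *: B g + A g) scaleN1r addrC.
apply/funext => x; apply/eqP; rewrite -subr_eq0 -DE; apply/eqP/dot_eq0 => k.
move: x; apply: (@functional_eq0 _ (c * sqn k)) => [|a x z|x|i].
- by rewrite mulr_ge0// sqn_ge0.
- by rewrite lD dotDl dotZl.
- by apply: le_trans (cauchy_schwarz _ _) _; rewrite mulrAC ler_wpM2r// sqn_ge0.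
- by rewrite DE AB subrr dot0l.
Qed.

Lemma sqn_basis i : sqn (basis mu i : H) = (mu i)%:num.
Proof. by rewrite /sqn dot_basis basisE eqxx mulr1. Qed.

Lemma sqn_finsum (s : seq I) (g : I -> R[i]) : uniq s ->
  sqn (\sum_(i <- s) g i *: basis mu i : H) = \sum_(i <- s) (mu i)%:num * sqmod (g i).
Proof.
elim: s => [|i s IH] /=; first by rewrite !big_nil sqn0.
case/andP=> si us; rewrite !big_cons sqnD sqnZ IH// [sqmod _ * _]mulrC.
rewrite sqn_basis.
rewrite dotZl dot_sumr [X in g i * X]big1_seq ?mulr0 ?addr0// => j /andP[_ js].
rewrite dotZr dot_basis basisE (_ : (j == i) = false) ?mulr0//.
by apply: contraNF si => /eqP <-.
Qed.

End Density.

Section Adjoint.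
Context {R : realType}.

Context {I : choiceType} {mu : I -> {posnum R}} {K : ipSpace R}.
Notation H := (ell2_ip mu).

(** A bounded operator on a sequence space has an adjoint without any appeal to the
Riesz theorem or to completeness: the coefficients of the image of k are the
numbers [<k, y i>] divided by the weights.  Square summability comes from testing
the bound on the finite combination with these very coefficients. *)
Lemma adjoint_family (y : I -> K) (c : R) : 0 <= c ->
  (forall (s : seq I) (g : I -> R[i]), uniq s ->
    sqn (\sum_(i <- s) g i *: y i) <= c * \sum_(i <- s) (mu i)%:num * sqmod (g i)) ->
  exists A : K -> H, [/\ linear A, bdd_by A c &
    forall k i, '[A k, basis mu i] = '[k, y i]].
Proof.
move=> c0 yc; pose a k i := (((mu i)%:num^-1)%:C)%C * '[k, y i].
have ac k s : uniq s -> \sum_(i <- s) (mu i)%:num * sqmod (a k i) <= c * sqn k.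
  move=> us; set S := \sum_(i <- s) _.
  have S0 : 0 <= S by apply: sumr_ge0 => i _; rewrite mulr_ge0// sqmod_ge0.
  have kS : '[k, \sum_(i <- s) a k i *: y i] = (S%:C)%C.
    rewrite dot_sumr (rmorph_sum (@real_complex R)); apply: eq_bigr => i _ /=.
    rewrite dotZr real_complexM sqmodE mulrA mulrC; congr (_ * _).
    by rewrite /a mulrA -real_complexM divff// mul1r.
  have := cauchy_schwarz k (\sum_(i <- s) a k i *: y i).
  rewrite kS sqmodC => /le_trans /(_ (ler_wpM2l (sqn_ge0 k) (yc _ _ us))).
  rewrite -/S mulrA => h; have [->|SN0] := eqVneq S 0.
    by rewrite mulr_ge0// sqn_ge0.
  by rewrite -(@ler_pM2r _ S) ?lt_def ?SN0// [c * _]mulrC -expr2.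
pose A k : H := Ell2 (sqsummable_bound (ac k)).
exists A; split=> [b x z|k|k i].
- by apply: ell2_ext => i; rewrite ell2D ell2Z /= /a dotDl dotZl mulrDr mulrCA.
- exact/sqn_le/ac.
- by rewrite dot_basis /= /a mulrA -real_complexM divff// mul1r.
Qed.

(** The adjoint exists as soon as A is bounded, by [adj_spec]; 0 is a default. *)
Definition adj (A : H -> K) : K -> H :=
  xget 0 [set B | bdd B /\ forall x k, '[A x, k] = '[x, B k]].

Lemma adj_spec (A : H -> K) : bdd A ->
  bdd (adj A) /\ forall x k, '[A x, k] = '[x, adj A k].
Proof.
move=> [lA [c c0 Ac]].
apply: (@xgetPex _ 0 [set B | bdd B /\ forall x k, '[A x, k] = '[x, B k]]).
have [|B [lB Bc Bi]] := @adjoint_family (A \o basis mu) c c0.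
  move=> s g us; rewrite -sqn_finsum//; apply: le_trans (Ac _).
  by rewrite lin_sum//; under [in leRHS]eq_bigr do rewrite linZ//.
exists B; split=> [|x k]; first by split=> //; exists c.
apply/eqP; rewrite -subr_eq0; apply/eqP; move: x.
apply: (@functional_eq0 _ _ _ _ (4 * c * sqn k)) => [|a x z|x|i].
- by rewrite !mulr_ge0// sqn_ge0.
- by rewrite lA !dotDl !dotZl mulrBr opprD addrACA.
- apply: le_trans (sqmodB_le _ _) _.
  have h1 := le_trans (cauchy_schwarz (A x) k) (ler_wpM2r (sqn_ge0 k) (Ac x)).
  have h2 := le_trans (cauchy_schwarz x (B k)) (ler_wpM2l (sqn_ge0 x) (Bc k)).
  lra.
- by apply/eqP; rewrite subr_eq0 [eqbRHS]dotC Bi -dotC.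
Qed.

Lemma adj_bdd (A : H -> K) : bdd A -> bdd (adj A).
Proof. by case/adj_spec. Qed.

Lemma adjE (A : H -> K) x k : bdd A -> '[A x, k] = '[x, adj A k].
Proof. by case/adj_spec. Qed.

Lemma adjEr (A : H -> K) x k : bdd A -> '[k, A x] = '[adj A k, x].
Proof. by move=> bA; rewrite dotC adjE// -dotC. Qed.

End Adjoint.

Section FinsumBound.
Context {R : realType} {I : choiceType} {mu : I -> {posnum R}}.
Notation H := (ell2_ip mu).

(** A bound on finite combinations passes to the adjoint by [adjoint_family], and
from the adjoint back to the operator since |A x|^4 = |<x, A* A x>|^2. *)
Lemma bdd_by_finsum (K : ipSpace R) (A : H -> K) c : bdd A -> 0 <= c ->
  (forall (s : seq I) (g : I -> R[i]), uniq s ->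
    sqn (A (\sum_(i <- s) g i *: basis mu i)) <=
    c * \sum_(i <- s) (mu i)%:num * sqmod (g i)) -> bdd_by A c.
Proof.
move=> bA c0 Ac; have lA := bA.1.
have [|B [lB Bc Bi]] := @adjoint_family _ _ mu _ (A \o basis mu) c c0.
  move=> s g us; apply: le_trans (Ac s g us).
  by rewrite (lin_sum lA); under [in leRHS]eq_bigr do rewrite (linZ lA).
have BE k : B k = adj A k.
  apply: ell2_ext => i; have := Bi k i.
  rewrite /= (adjEr _ _ bA) !dot_basis; apply: mulfI.
  by apply/eqP => /(congr1 (@complex.Re R)) /= /eqP; rewrite gt_eqF.
move=> x; have [->|AxN0] := eqVneq (sqn (A x)) 0; first by rewrite mulr_ge0// sqn_ge0.
have Ax0 : 0 < sqn (A x) by rewrite lt_def AxN0 sqn_ge0.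
rewrite -(ler_pM2r Ax0) -expr2 -sqmodC -dotxx (adjE _ _ bA) -BE.
apply: le_trans (cauchy_schwarz _ _) _.
by rewrite mulrC [c * _]mulrC -mulrA [sqn x * _]mulrC ler_wpM2r ?sqn_ge0.
Qed.

End FinsumBound.

Lemma ell2_ext_dot (R : realType) (I : choiceType) (mu : I -> {posnum R})
    (f g : ell2_ip mu) :
  (forall i, '[f, basis mu i] = '[g, basis mu i]) -> f = g.
Proof.
move=> fg; apply: ell2_ext => i; have := fg i; rewrite !dot_basis; apply: mulfI.
by apply/eqP => /(congr1 (@complex.Re R)) /= /eqP; rewrite gt_eqF.
Qed.

Lemma sqn_lincomb (R : realType) (H : ipSpace R) (I : Type) (s : seq I)
    (g : I -> R[i]) (y : I -> H) :
  sqn (\sum_(i <- s) g i *: y i) =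
  complex.Re (\sum_(i <- s) \sum_(j <- s) g i * ((g j)^* * '[y i, y j])).
Proof.
rewrite /sqn dot_suml; congr complex.Re; apply: eq_bigr => i _.
by rewrite dot_sumr; apply: eq_bigr => j _; rewrite dotZl dotZr.
Qed.

(** * The weak operator topology *)

Section WeakOperatorTopology.
Context {R : realType}.

Lemma sqmodD_le (z w : R[i]) : sqmod (z + w) <= 2 * sqmod z + 2 * sqmod w.
Proof. by rewrite -[w in leLHS]opprK -[in leRHS](sqmodN w) sqmodB_le. Qed.

Lemma sqmod_sum_le (T : eqType) (s : seq T) (F : T -> R[i]) (e : R) : 0 <= e ->
  {in s, forall p, sqmod (F p) <= e} -> sqmod (\sum_(p <- s) F p) <= 4 ^+ size s * e.
Proof.
move=> e0; elim: s => [|p s IH] Fe; first by rewrite big_nil sqmod0 mulr_ge0.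
rewrite big_cons exprS -mulrA; apply: le_trans (sqmodD_le _ _) _.
have {}IH := IH (fun q (qs : q \in s) => Fe q (@mem_behead _ (p :: s) q qs)).
have Fp := Fe p (mem_head _ _).
have : e <= 4 ^+ size s * e by rewrite ler_peMl// exprn_ege1//; lra.
lra.
Qed.

Section OneSpace.
Context {H : ipSpace R}.
Implicit Types (A : set (H -> H)) (T X : H -> H).

(** Finite lists of pairs of vectors replace indexed families of functionals, so that
lists can be concatenated in [wot_transfer]. *)
Lemma wot_closureP A T : weak_closure wot_functional A T <->
  bounded_op T /\ forall (s : seq (H * H)) (e : R), 0 < e ->
    exists2 X, A X & {in s, forall p, sqmod '[T p.1 - X p.1, p.2] < e}.
Proof.
split=> -[bT h]; split=> //.
  move=> s e e0; pose phi (k : 'I_(size s)) X := '[X (tnth (in_tuple s) k).1, (tnth (in_tuple s) k).2].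
  have e1 : 0 < ((Num.sqrt e)%:C)%C :> R[i] by rewrite ltcR sqrtr_gt0.
  have [|X AX hX] := h _ phi _ _ e1; first by move=> k; do 2 eexists.
  exists X => // p /(tnthP (in_tuple s))[k ->].
  by have := hX k; rewrite /phi -dotBl normC_lt ?sqrtr_gt0// sqr_sqrtr// ltW.
move=> n phi phiP e /gt0_complex[r r0 ->].
have /choice[xy xyP] k : exists p : H * H, phi k = fun X => '[X p.1, p.2].
  by have [x [y ->]] := phiP k; exists (x, y).
have [|X AX hX] := h [seq xy k | k <- enum 'I_n] (r ^+ 2); first by rewrite exprn_gt0.
exists X => // k; rewrite xyP -dotBl normC_lt//; apply: hX.
by rewrite map_f// mem_enum.
Qed.

Lemma wot_limit A T (s : seq (H * H)) c : weak_closure wot_functional A T ->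
  (forall X, A X -> \sum_(p <- s) '[X p.1, p.2] = c) ->
  \sum_(p <- s) '[T p.1, p.2] = c.
Proof.
move=> /wot_closureP[_ h] Ac; apply/eqP; rewrite -subr_eq0; apply/eqP.
apply: (@eq0_sqmod_small _ _ (4 ^+ size s)) => e e0.
have [X AX hX] := h s e e0; rewrite -(Ac X AX) -sumrB.
by apply: sqmod_sum_le (ltW e0) _ => p /hX /ltW; rewrite dotBl.
Qed.

Lemma wot_limit2 A T (x1 y1 x2 y2 : H) : weak_closure wot_functional A T ->
  (forall X, A X -> '[X x1, y1] = '[X x2, y2]) -> '[T x1, y1] = '[T x2, y2].
Proof.
move=> AT h; apply/eqP; rewrite -subr_eq0; apply/eqP.
have := @wot_limit A T [:: (x1, y1); (x2, - y2)] 0 AT.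
rewrite !big_cons !big_nil /= !addr0 !(raddfN (ip_form H _)); apply => X AX.
by rewrite !big_cons !big_nil /= !addr0 !(raddfN (ip_form H _)) h// subrr.
Qed.

End OneSpace.

(** A map of operators that pulls each vector functional back to a finite sum of vector
functionals is WOT-continuous; such a map carries limits to limits. *)
Lemma wot_transfer (H K : ipSpace R) (Th : (H -> H) -> K -> K)
    (A : set (H -> H)) (B : set (K -> K)) (T : H -> H) :
  (forall x y : K, exists s : seq (H * H), forall X, bdd X ->
     '[Th X x, y] = \sum_(p <- s) '[X p.1, p.2]) ->
  (forall X, A X -> bdd X /\ B (Th X)) ->
  wot_closed B -> weak_closure wot_functional A T -> bdd (Th T) -> B (Th T).
Proof.
move=> ThE AB clB AT bT; apply: clB; apply/wot_closureP; split; first exact/bddP.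
have [/bddP bdT clT] := (wot_closureP A T).1 AT.
move=> s e e0; have /choice[f fP] (p : K * K) := ThE p.1 p.2.
pose N := \max_(p <- s) size (f p).
have e1 : 0 < e / 2 / 4 ^+ N by rewrite !divr_gt0// exprn_gt0.
have [X AX hX] := clT (flatten [seq f p | p <- s]) _ e1.
have [bX BX] := AB _ AX; exists (Th X) => // p ps.
rewrite dotBl !fP// -sumrB; apply: (@le_lt_trans _ _ (e / 2)); last lra.
have fpN : (size (f p) <= N)%N by rewrite /N (big_rem p)//= leq_maxl.
apply: le_trans (sqmod_sum_le (ltW e1) _) _.
  move=> r rf; rewrite -dotBl ltW//; apply: hX.
  by apply/flattenP; exists (f p) => //; exact: map_f.
have e20 : 0 <= e / 2 by lra.
rewrite mulrCA ger_pMr ?divr_gt0// ler_pdivrMr ?exprn_gt0// mul1r.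
by rewrite ler_weXn2l//; lra.
Qed.

End WeakOperatorTopology.

(** * Shifts on the Fock space *)

Section Fock.
Context {R : realType} {d : nat}.
Notation word := (word d).
Notation HF := (fock R d).
Notation xi w := (basis (fun _ : word => 1%:pos : {posnum R}) w : HF).
Implicit Types (f g : HF) (u v w : word) (i j : 'I_d).

Lemma unit_weight (s : seq word) (F : word -> R) :
  \sum_(w <- s) (1%:pos : {posnum R})%:num * F w = \sum_(w <- s) F w.
Proof. by apply: eq_bigr => w _; exact: mul1r. Qed.

Lemma coefE f w : '[f, xi w] = f w.
Proof. by rewrite dot_basis mul1r. Qed.

Lemma xiE w v : xi w v = (v == w)%:R.
Proof. by []. Qed.

Lemma fock_partial f s : uniq s -> \sum_(w <- s) sqmod (f w) <= sqn f.
Proof.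
by move=> us; apply: le_trans (partial_le_sqn f us); rewrite unit_weight.
Qed.

Lemma fock_sqn_le f c :
  (forall s, uniq s -> \sum_(w <- s) sqmod (f w) <= c) -> sqn f <= c.
Proof. by move=> h; apply: sqn_le => s /h; rewrite unit_weight. Qed.

Lemma Lword_lin u : linear (Lword u : HF -> HF).
Proof.
move=> a f g; apply: ell2_ext => w; rewrite ell2D ell2Z /=.
by case: ifP; rewrite ?mulr0 ?addr0.
Qed.

Lemma Lword_bdd_by u : bdd_by (Lword u : HF -> HF) 1.
Proof.
move=> f; rewrite mul1r; apply: fock_sqn_le => s us.
have E : \sum_(w <- s) sqmod (Lword u f w) =
    \sum_(w <- [seq drop (size u) w | w <- s & prefix u w]) sqmod (f w).
  rewrite big_map big_filter [RHS]big_mkcond; apply: eq_bigr => w _ /=.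
  by case: ifP => // _; exact: sqmod0.
rewrite E; apply: fock_partial; rewrite map_inj_in_uniq ?filter_uniq//.
move=> v w; rewrite !mem_filter => /andP[/prefixP[v' ->] _] /andP[/prefixP[w' ->] _].
by rewrite !drop_size_cat// => ->.
Qed.

Lemma Lword_bdd u : bdd (Lword u : HF -> HF).
Proof. by split; [exact: Lword_lin|exists 1 => //; exact: Lword_bdd_by]. Qed.

Lemma Rdel_proof i f : (fun w => f (rcons w i)) \in sqsummable (fun _ : word => 1%:pos).
Proof.
apply: (@sqsummable_bound _ _ _ _ (sqn f)) => s us.
rewrite unit_weight.
rewrite -(big_map (rcons^~ i) xpredT (fun w => sqmod (f w))).
by apply: fock_partial; rewrite map_inj_uniq// => v w /rcons_inj[].
Qed.

(** The adjoint of the right shift [Rsh i]: it deletes a final letter i. *)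
Definition Rdel i f : HF := Ell2 (Rdel_proof i f).

Lemma RdelE i f w : Rdel i f w = f (rcons w i). Proof. by []. Qed.

Lemma Rdel_bdd i : bdd (Rdel i).
Proof.
split=> [a f g|]; first by apply: ell2_ext => w.
exists 1 => // f; rewrite mul1r; apply: fock_sqn_le => s us.
rewrite -(big_map (rcons^~ i) xpredT (fun w => sqmod (f w))).
by apply: fock_partial; rewrite map_inj_uniq// => v w /rcons_inj[].
Qed.

Definition Rsh i : HF -> HF := adj (Rdel i).

Lemma Rsh_bdd i : bdd (Rsh i). Proof. exact: adj_bdd (Rdel_bdd i). Qed.

Lemma Rsh_adj i f g : '[Rsh i f, g] = '[f, Rdel i g].
Proof. by rewrite (adjEr _ _ (Rdel_bdd i)). Qed.

Lemma Rdel_nil i : Rdel i (xi [::]) = 0.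
Proof. by apply: ell2_ext => w; rewrite RdelE xiE; case: w. Qed.

Lemma Rdel_rcons i w j : Rdel i (xi (rcons w j)) = (i == j)%:R *: xi w.
Proof.
apply: ell2_ext => v; rewrite RdelE ell2Z !xiE eqseq_rcons andbC.
by case: (i == j); rewrite ?mul1r ?mul0r.
Qed.

Lemma Rsh_nil i f : Rsh i f [::] = 0.
Proof. by rewrite -coefE Rsh_adj Rdel_nil dot0r. Qed.

Lemma Rsh_rcons i f w j : Rsh i f (rcons w j) = (i == j)%:R * f w.
Proof. by rewrite -coefE Rsh_adj Rdel_rcons dotZr coefE conjC_nat. Qed.

Lemma Rsh_xi i w : Rsh i (xi w) = xi (rcons w i).
Proof.
apply: ell2_ext => v; case/lastP: v => [|v j]; first by rewrite Rsh_nil xiE; case: w.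
rewrite Rsh_rcons !xiE eqseq_rcons andbC eq_sym.
by case: (j == i); rewrite ?mul1r ?mul0r.
Qed.

Lemma Rdel_Rsh i j f : Rdel i (Rsh j f) = (i == j)%:R *: f.
Proof. by apply: ell2_ext => w; rewrite RdelE Rsh_rcons ell2Z eq_sym. Qed.

(** The Cuntz-Toeplitz relation: the vacuum projection and the ranges of the right
shifts add up to the identity. *)
Lemma Rsh_decomp f : f = f [::] *: xi [::] + \sum_i Rsh i (Rdel i f).
Proof.
apply: ell2_ext => w; rewrite ell2D ell2Z ell2_sum xiE.
case/lastP: w => [|w j]; first by rewrite eqxx mulr1 big1 ?addr0// => i _; rewrite Rsh_nil.
rewrite (_ : rcons w j == [::] = false) ?mulr0 ?add0r; last by case: w.
rewrite (bigD1 j)//= Rsh_rcons eqxx mul1r big1 ?addr0// => i /negPf ij.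
by rewrite Rsh_rcons ij mul0r.
Qed.

Lemma sqn_Rsh_sum a (g : 'I_d -> HF) :
  sqn (a *: xi [::] + \sum_i Rsh i (g i)) = sqmod a + \sum_i sqn (g i).
Proof.
have orth (s : seq 'I_d) : uniq s ->
    sqn (\sum_(i <- s) Rsh i (g i)) = \sum_(i <- s) sqn (g i).
  elim: s => [|i s IH] /=; first by rewrite !big_nil sqn0.
  case/andP=> si us; rewrite !big_cons sqnD IH//.
  have -> : sqn (Rsh i (g i)) = sqn (g i).
    by rewrite /sqn Rsh_adj Rdel_Rsh eqxx scale1r.
  rewrite dot_sumr [X in complex.Re X]big1_seq ?mulr0 ?addr0// => j /andP[_ js].
  rewrite Rsh_adj Rdel_Rsh (_ : (i == j) = false) ?scale0r ?dot0r//.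
  by apply: contraNF si => /eqP->.
rewrite sqnD sqnZ sqn_basis mulr1 orth ?index_enum_uniq//.
rewrite dotZl dot_sumr [X in a * X]big1 ?mulr0 ?addr0// => i _.
by rewrite dotC Rsh_adj Rdel_nil dot0r rmorph0.
Qed.

Lemma sqn_decomp f : sqn f = sqmod (f [::]) + \sum_i sqn (Rdel i f).
Proof. by rewrite [f in LHS]Rsh_decomp sqn_Rsh_sum. Qed.

(** For bounded operators, commuting with the right shifts is membership in the free
semigroup algebra, by [calL_bdd_rcomm] and [rcomm_calL]. *)
Definition rcomm (X : HF -> HF) := forall i f, X (Rsh i f) = Rsh i (X f).

Lemma Lword_rcomm u : rcomm (Lword u).
Proof.
move=> i f.
suff : Lword u \o Rsh i = Rsh i \o Lword u by move/(congr1 (@^~ f)).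
apply: bdd_eq_basis => [||w].
- exact: bdd_comp (Lword_bdd u) (Rsh_bdd i).
- exact: bdd_comp (Rsh_bdd i) (Lword_bdd u).
- by rewrite /= Rsh_xi !Lword_basis Rsh_xi rcons_cat.
Qed.

Lemma calL_bdd_rcomm (X : HF -> HF) : calL X -> bdd X /\ rcomm X.
Proof.
move=> /(_ [set Z | bdd Z /\ rcomm Z]) h; apply: h => [|T clT|_ [u _ <-]]; last by split; [exact: Lword_bdd|exact: Lword_rcomm].
  split=> [Y [/bddP]//||c Y Z [bY cY] [bZ cZ]|Y Z [bY cY] [bZ cZ]].
  - split; [exact: bdd0|move=> i f].
    by rewrite -[RHS]/(Rsh i 0) lin0//; case: (Rsh_bdd i).
  - split; [exact: bdd_lin|move=> i f].
    rewrite -[LHS]/(c *: Y _ + Z _) cY cZ; case: (Rsh_bdd i) => lR _.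
    by rewrite -linZ// -linD.
  - by split; [exact: bdd_comp|move=> i f; rewrite /= cZ cY].
have [/bddP bT _] := (wot_closureP _ _).1 clT; split=> // i f.
apply: dot_inj => g; rewrite Rsh_adj; apply: (wot_limit2 clT) => Y [_ cY].
by rewrite cY Rsh_adj.
Qed.

End Fock.

(** * Homogeneous components *)

Section Components.
Context {R : realType} {d : nat}.
Notation word := (word d).
Notation HF := (fock R d).
Notation xi w := (basis (fun _ : word => 1%:pos : {posnum R}) w : HF).
Implicit Types (f g : HF) (u v w : word) (X Y : HF -> HF).

Lemma calL_subalgebra : op_subalgebra (calL : set (HF -> HF)).
Proof.
split=> [X /calL_bdd_rcomm[/bddP]//||c X Y LX LY|X Y LX LY] A subA clA GA.
- by case: subA.
- by have [_ _ + _] := subA; apply; [exact: (LX _ subA clA GA)|exact: (LY _ subA clA GA)].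
- by have [_ _ _] := subA; apply; [exact: (LX _ subA clA GA)|exact: (LY _ subA clA GA)].
Qed.

Lemma weak_closureS (H : ipSpace R) (A B : set (H -> H)) :
  A `<=` B -> weak_closure wot_functional A `<=` weak_closure wot_functional B.
Proof.
move=> AB T [bT h]; split=> // n phi Phi e e0.
by have [X /AB] := h n phi Phi e e0; exists X.
Qed.

Lemma calL_wot_closed : wot_closed (calL : set (HF -> HF)).
Proof.
move=> T clT A subA clA GA; apply: (clA); apply: weak_closureS clT.
by move=> X; apply.
Qed.

Lemma op_subalgebra_sum (H : ipSpace R) (A : set (H -> H)) (I : Type)
    (s : seq I) (c : I -> R[i]) (F : I -> H -> H) :
  A 0 -> (forall a S T, A S -> A T -> A (a *: S + T)) -> (forall k, A (F k)) ->
  A (\sum_(i <- s) c i *: F i).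
Proof.
move=> A0 AD AF; elim: s => [|k s IH]; first by rewrite big_nil.
by rewrite big_cons; exact: AD.
Qed.

(** The homogeneous component of degree k, read off from the image of the vacuum. *)
Definition hcomp k X : HF -> HF :=
  \sum_(u : k.-tuple 'I_d) (X (xi [::])) u *: Lword u.

Lemma op_sumE (H K : ipSpace R) (I : Type) (s : seq I) (F : I -> H -> K) x :
  (\sum_(i <- s) F i) x = \sum_(i <- s) F i x.
Proof.
elim: s => [|i s IH]; first by rewrite !big_nil.
by rewrite !big_cons -IH.
Qed.

Lemma hcomp_calL k X : calL (hcomp k X).
Proof.
have [_ L0 LD _] := calL_subalgebra.
by apply: (@op_subalgebra_sum _ calL) => // u; exact: (calL_Lop (Some (u : seq 'I_d))).
Qed.

Lemma hcomp_bdd k X : bdd (hcomp k X).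
Proof. by case: (calL_bdd_rcomm (hcomp_calL k X)). Qed.

Lemma hcomp_rcomm k X : rcomm (hcomp k X).
Proof. by case: (calL_bdd_rcomm (hcomp_calL k X)). Qed.

Lemma rcomm_xi X u w (i j : 'I_d) : rcomm X ->
  X (xi (rcons u i)) (rcons w j) = (i == j)%:R * X (xi u) w.
Proof. by move=> cX; rewrite -Rsh_xi cX Rsh_rcons. Qed.

Lemma rcomm_xi_nil X u i : rcomm X -> X (xi (rcons u i)) [::] = 0.
Proof. by move=> cX; rewrite -Rsh_xi cX Rsh_nil. Qed.

(** The vacuum is cyclic for the right shifts, so it separates their commutant. *)
Lemma rcomm_eq X Y : bdd X -> bdd Y -> rcomm X -> rcomm Y ->
  X (xi [::]) = Y (xi [::]) -> X = Y.
Proof.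
move=> bX bY cX cY XY; apply: bdd_eq_basis => // w.
by elim/last_ind: w => [//|w i IH]; rewrite -Rsh_xi cX cY [X _]IH.
Qed.

(** Operators commuting with the right shifts do not lower the length of words. *)
Lemma rcomm_lower X v w : rcomm X -> (size w < size v)%N -> X (xi v) w = 0.
Proof.
move=> cX; elim/last_ind: v w => [//|v i IH] w; rewrite size_rcons.
case/lastP: w => [|w j]; first by rewrite rcomm_xi_nil.
by rewrite size_rcons ltnS => /IH wv; rewrite rcomm_xi// wv mulr0.
Qed.

Lemma hcomp_coef k X v w : rcomm X ->
  hcomp k X (xi v) w = if size w == (size v + k)%N then X (xi v) w else 0.
Proof.
move=> cX; have cC := hcomp_rcomm k X.
elim/last_ind: v w => [|v i IH] w.
  rewrite /hcomp op_sumE ell2_sum add0n.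
  under eq_bigr => u _.
    rewrite (_ : _ w = X (xi [::]) u * (w == u)%:R); last first.
      by rewrite -[LHS]/(X (xi [::]) u * Lword u (xi [::]) w) Lword_basis cats0 xiE.
    over.
  case: ifPn => [/eqP sw|sw].
    have sw' : size w == k by apply/eqP.
    rewrite (bigD1 (Tuple sw')) //= eqxx mulr1 big1 ?addr0// => u.
    by rewrite -val_eqE /= eq_sym => /negPf->; rewrite mulr0.
  rewrite big1// => u _; rewrite (_ : w == u = false) ?mulr0//.
  by apply: contraNF sw => /eqP->; rewrite size_tuple.
case/lastP: w => [|w j]; first by rewrite !rcomm_xi_nil//; case: ifP.
by rewrite !rcomm_xi// IH !size_rcons addSn eqSS; case: ifP => //; rewrite mulr0.
Qed.

(** Both sides commute with the right shifts, so only their values at the vacuum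
matter.  In degree k the image of the vacuum under Y counts only up to degree k,
because X does not lower degrees; these finitely many components of Y then pick the
complementary components of X. *)
Lemma hcomp_compose k X Y : bdd X -> bdd Y -> rcomm X -> rcomm Y ->
  hcomp k (X \o Y) = \sum_(j < k.+1) (hcomp (k - j) X \o hcomp j Y).
Proof.
move=> bX bY cX cY; apply: rcomm_eq.
- exact: hcomp_bdd.
- apply: (@bdd_sum _ HF HF) => j; by apply: (@bdd_comp _ HF HF HF); exact: hcomp_bdd.
- exact: hcomp_rcomm.
- move=> i f; rewrite !op_sumE (lin_sum (Rsh_bdd i).1).
  by apply: eq_bigr => j _ /=; rewrite !hcomp_rcomm.
have cXY : rcomm (X \o Y) by move=> i f; rewrite /= cY cX.
apply: ell2_ext => w; rewrite hcomp_coef// op_sumE ell2_sum add0n.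
have [lX _] := bX.
have hom j : hcomp j Y (xi [::]) = \sum_(u : j.-tuple 'I_d) Y (xi [::]) u *: xi u.
  rewrite /hcomp op_sumE; apply: eq_bigr => u _.
  by rewrite -[LHS]/(_ *: Lword u (xi [::])) Lword_basis cats0.
have compE (Z : HF -> HF) j v : linear Z -> 
    Z (hcomp j Y (xi [::])) v = \sum_(u : j.-tuple 'I_d) Y (xi [::]) u * Z (xi u) v.
  move=> lZ; rewrite hom lin_sum// ell2_sum.
  by apply: eq_bigr => u _; rewrite linZ.
case: eqVneq => [sw|sw]; last first.
  rewrite big1// => j _ /=.
  rewrite (compE _ _ _ (hcomp_bdd (k - j) X).1).
  rewrite big1// => u _; rewrite hcomp_coef// size_tuple subnKC ?(negPf sw) ?mulr0//.
  by rewrite -ltnS.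
pose r := Y (xi [::]) - \sum_(j < k.+1) hcomp j Y (xi [::]).
have r0 v : (size v <= k)%N -> r v = 0.
  move=> vk; rewrite /r ell2D ell2N ell2_sum.
  rewrite (bigD1 (Ordinal (vk : (size v < k.+1)%N)))//= hcomp_coef// add0n eqxx.
  rewrite big1 ?addr0 ?subrr// => j; rewrite -val_eqE /= => /negPf jv.
  by rewrite hcomp_coef// add0n eq_sym jv.
rewrite -[(X \o Y) _]/(X (Y (xi [::]))).
have -> : Y (xi [::]) = r + \sum_(j < k.+1) hcomp j Y (xi [::]) by rewrite subrK.
rewrite linD// ell2D lin_sum// ell2_sum.
(* r has no component of degree at most k, and X does not lower degrees. *)
have -> : X r w = 0.
  rewrite -coefE adjE//; apply: dot_ell2_eq0 => v.
  have [vk|vk] := leqP (size v) k; first by left; exact: r0.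
  right; rewrite -coefE dotC -adjE// coefE rcomm_lower ?rmorph0// sw.
  exact: vk.
rewrite add0r; apply: eq_bigr => j _ /=.
rewrite (compE _ _ _ lX) (compE _ _ _ (hcomp_bdd (k - j) X).1).
apply: eq_bigr => u _; rewrite hcomp_coef// size_tuple sw subnKC ?eqxx//.
by rewrite -ltnS.
Qed.

End Components.

(** * Fejer means *)

Section Fejer.
Context {R : realType} {d : nat}.
Notation word := (word d).
Notation HF := (fock R d).
Notation xi w := (basis (fun _ : word => 1%:pos : {posnum R}) w : HF).
Implicit Types (f g : HF) (u v w : word) (X Y : HF -> HF).

(** The n-th Fejer sum, without its factor 1/n. *)
Definition fejer n X : HF -> HF := \sum_(k < n) ((n - k)%:R : R[i]) *: hcomp k X.

Lemma fejer_calL n X : calL (fejer n X).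
Proof.
have [_ L0 LD _] := (@calL_subalgebra R d).
by apply: (@op_subalgebra_sum _ _ calL) => // k; exact: hcomp_calL.
Qed.

(** The truncated subtraction makes the coefficient vanish once the length grows by n
or more; where it would exceed n, the matrix entry of X is zero. *)
Lemma fejer_coef n X u v : rcomm X ->
  fejer n X (xi u) v = (n + size u - size v)%:R * X (xi u) v.
Proof.
move=> cX; rewrite /fejer op_sumE ell2_sum.
under eq_bigr => k _.
  rewrite (_ : _ v = (n - k)%:R * hcomp k X (xi u) v)//.
  rewrite hcomp_coef//; over.
have [vu|uv] := ltnP (size v) (size u).
  by rewrite rcomm_lower// big1 ?mulr0// => k _; case: ifP; rewrite mulr0.
have [k0n|nk0] := ltnP (size v - size u) n.
  rewrite (bigD1 (Ordinal k0n))//= subnKC// eqxx big1 ?addr0.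
    by congr (_%:R * _); lia.
  move=> k; rewrite -val_eqE /= => kk0.
  by rewrite (_ : size v == _ = false) ?mulr0//; lia.
rewrite (_ : (n + _ - _)%N = 0)%N; last lia.
rewrite mul0r big1// => k _; rewrite (_ : size v == _ = false) ?mulr0//.
by have := ltn_ord k; lia.
Qed.

(** The words whose length lies among the n values l - n + 1, ..., l. *)
Definition window n l w := (size w <= l < size w + n)%N.

Lemma sum_interval L a b : (\sum_(l < L) (a <= l < b) = minn b L - a)%N.
Proof. by elim: L => [|L IH]; rewrite ?big_ord0 ?big_ord_recr /= ?IH; lia. Qed.

Lemma sum_window (A : pzSemiRingType) n L u : (size u + n <= L)%N ->
  \sum_(l < L) (window n l u)%:R = n%:R :> A.
Proof. by move=> uL; rewrite -natr_sum sum_interval; congr _%:R; lia. Qed.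

Lemma sum_window_le n L u : \sum_(l < L) (window n l u)%:R <= n%:R :> R.
Proof. by rewrite -natr_sum sum_interval ler_nat; lia. Qed.

Lemma sum_window2 (A : pzSemiRingType) n L u v : (size u + n <= L)%N -> (size u <= size v)%N ->
  \sum_(l < L) (window n l u)%:R * (window n l v)%:R = (n + size u - size v)%:R :> A.
Proof.
move=> uL uv; have -> : (n + size u - size v = minn (size u + n) L - size v)%N by lia.
rewrite -sum_interval natr_sum; apply: eq_bigr => l _.
by rewrite -natrM mulnb; congr (nat_of_bool _)%:R; rewrite /window; lia.
Qed.

Lemma sqmod_nat n : sqmod (n%:R : R[i]) = n%:R ^+ 2.
Proof. by rewrite -(rmorph_nat (@real_complex R)) sqmodC. Qed.

Lemma sqn_window n l (s : seq word) (a : word -> R[i]) : uniq s ->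
  sqn (\sum_(u <- s) ((window n l u)%:R * a u) *: xi u) =
  \sum_(u <- s) (window n l u)%:R * sqmod (a u).
Proof.
move=> us; rewrite sqn_finsum//; apply: eq_bigr => u _.
rewrite mul1r sqmodM sqmod_nat.
by case: window; rewrite ?expr1n ?expr0n.
Qed.

Lemma two_Re_le (H : ipSpace R) (x y : H) : 2 * complex.Re '[x, y] <= sqn x + sqn y.
Proof. by have := sqn_ge0 (x - y); rewrite sqnB; lra. Qed.

(** The Fejer kernel is a sum of rank-one positive kernels: two words of lengths a <= b
share n + a - b windows, which is their weight in the Fejer sum.  So this sum is the
sum over l of the corners of X on the windows, and the norm of X controls it. *)
Lemma fejer_windows n X (s t : seq word) (a b : word -> R[i]) L : linear X -> rcomm X ->
  {in s, forall u, size u + n <= L}%N ->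
  '[fejer n X (\sum_(u <- s) a u *: xi u), \sum_(v <- t) b v *: xi v] =
  \sum_(l < L) '[X (\sum_(u <- s) ((window n l u)%:R * a u) *: xi u),
                  \sum_(v <- t) ((window n l v)%:R * b v) *: xi v].
Proof.
move=> lX cX sL; have lF := (calL_bdd_rcomm (fejer_calL n X)).1.1.
under [RHS]eq_bigr do rewrite (lin_sum lX) dot_suml.
rewrite exchange_big (lin_sum lF) dot_suml; apply: eq_big_seq => u us.
under [RHS]eq_bigr do rewrite dot_sumr.
rewrite exchange_big dot_sumr; apply: eq_bigr => v _.
rewrite (linZ lF) dotZl dotZr coefE fejer_coef//.
under eq_bigr do rewrite (linZ lX) dotZl dotZr coefE conjM conj_nat.
have [vu|uv] := ltnP (size v) (size u).
  by rewrite rcomm_lower// !mulr0 big1// => l _; rewrite !mulr0.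
rewrite -(sum_window2 _ (sL u us) uv) mulr_suml !mulr_sumr.
by apply: eq_bigr => l _; ring.
Qed.

(** Each word lies in n + 1 windows at most, so the corners of X add up to n + 1 times
the norm of X.  The vector paired with the Fejer sum is a multiple of the sum itself,
restricted to finitely many words. *)
Lemma fejer_finsum n X c (s : seq word) (a : word -> R[i]) :
  0 <= c -> bdd X -> bdd_by X c -> rcomm X -> uniq s ->
  sqn (fejer n.+1 X (\sum_(u <- s) a u *: xi u)) <=
  n.+1%:R ^+ 2 * c * \sum_(u <- s) sqmod (a u).
Proof.
move=> c0 bX Xc cX us; have lX := bX.1.
set f := \sum_(u <- s) _; set S := \sum_(u <- s) _.
set N : R := n.+1%:R; have N0 : 0 < N by rewrite ltr0n.
apply: fock_sqn_le => t ut; set A := \sum_(v <- t) _.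
(* The factor 1/N balances the two terms of 2 Re <x, y> <= |x|^2 + |y|^2 below. *)
pose b v := ((N^-1)%:C)%C * fejer n.+1 X f v.
have sqb v : sqmod (b v) = N^-1 ^+ 2 * sqmod (fejer n.+1 X f v) by rewrite sqmodM sqmodC.
have E : '[fejer n.+1 X f, \sum_(v <- t) b v *: xi v] = ((N^-1 * A)%:C)%C.
  rewrite dot_sumr mulr_sumr (rmorph_sum (@real_complex R)); apply: eq_bigr => v _.
  rewrite dotZr coefE [RHS]real_complexM sqmodE conjM conj_real_complex -mulrA.
  by congr (_ * _); exact: mulrC.
pose L := (\max_(u <- s) size u + n.+1)%N.
have sL : {in s, forall u, size u + n.+1 <= L}%N.
  by move=> u us'; rewrite leq_add2r (big_rem u)//= leq_maxl.
rewrite (@fejer_windows n.+1 X s t a b L lX cX sL) in E.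
have : 2 * (N^-1 * A) <= \sum_(l < L)
   (c * (\sum_(u <- s) (window n.+1 l u)%:R * sqmod (a u)) +
    \sum_(v <- t) (window n.+1 l v)%:R * sqmod (b v)).
  rewrite -[X in 2 * X]/(complex.Re (((N^-1 * A)%:C)%C)) -E Re_sum mulr_sumr.
  apply: ler_sum => l _; apply: le_trans (two_Re_le _ _) _.
  rewrite (sqn_window n.+1 l b ut) lerD2r -(sqn_window n.+1 l a us).
  exact: Xc.
rewrite big_split /= -mulr_sumr exchange_big /= [X in _ + X]exchange_big /=.
under eq_big_seq => u us' do rewrite -mulr_suml (sum_window _ (sL u us')).
rewrite -mulr_sumr -/S -/N.
have : \sum_(v <- t) \sum_(l < L) (window n.+1 l v)%:R * sqmod (b v) <= N^-1 * A.
  rewrite mulr_sumr; apply: ler_sum => v _; rewrite -mulr_suml sqb.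
  apply: le_trans (ler_wpM2r _ (sum_window_le _ _ _)) _.
    by rewrite mulr_ge0 ?sqmod_ge0 ?sqr_ge0.
  by rewrite mulrA expr2 mulrA divff ?gt_eqF// mul1r.
move=> h1 h2; have h3 : N^-1 * A <= c * (N * S).
  have := le_trans h2 (lerD (lexx _) h1).
  by rewrite [2 * _]mulr_natl mulr2n lerD2r.
have -> : A = N * (N^-1 * A) by rewrite mulrA divff ?mul1r ?gt_eqF.
have -> : N ^+ 2 * c * S = N * (c * (N * S)) by ring.
by rewrite ler_pM2l.
Qed.

Definition cesaro n X : HF -> HF := (((n.+1%:R : R)^-1)%:C)%C *: fejer n.+1 X.

Lemma cesaroE n X f : cesaro n X f = (((n.+1%:R : R)^-1)%:C)%C *: fejer n.+1 X f.
Proof. by []. Qed.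

Lemma cesaro_calL n X : calL (cesaro n X).
Proof.
have [_ L0 LD _] := (@calL_subalgebra R d).
by rewrite /cesaro -[_ *: _]addr0; apply: LD L0; exact: fejer_calL.
Qed.

Lemma cesaro_bdd_by n X c : 0 <= c -> bdd X -> bdd_by X c -> rcomm X ->
  bdd_by (cesaro n X) c.
Proof.
move=> c0 bX Xc cX; apply: bdd_by_finsum => // [|s g us].
  by case: (calL_bdd_rcomm (cesaro_calL n X)).
rewrite unit_weight cesaroE sqnZ sqmodC.
have N0 : 0 < n.+1%:R :> R by rewrite ltr0n.
apply: le_trans (ler_wpM2l (sqr_ge0 _) (fejer_finsum _ _ c0 bX Xc cX us)) _.
by rewrite exprVn [_ ^- 2 * _]mulrA [_ ^- 2 * _]mulrA mulVf ?mul1r.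
Qed.

(** On a matrix entry the Cesaro mean is off by a factor that tends to 0 with 1/n. *)
Lemma cesaro_defect n X u v : rcomm X -> (size v <= n.+1)%N ->
  (X (xi u) - cesaro n X (xi u)) v =
  (((n.+1%:R : R)^-1)%:C)%C * ((size v - size u)%:R * X (xi u) v).
Proof.
move=> cX vn; rewrite ell2D ell2N cesaroE ell2Z fejer_coef//.
have [vu|uv] := ltnP (size v) (size u); first by rewrite rcomm_lower// !mulr0 subrr.
set z := X _ v; have N0 : n.+1%:R != 0 :> R by rewrite pnatr_eq0.
have E : (((n.+1%:R : R)^-1)%:C)%C * n.+1%:R = 1 :> R[i].
  by rewrite -(rmorph_nat (@real_complex R)) -real_complexM mulVf.
have -> : (size v - size u)%:R = n.+1%:R - (n.+1 + size u - size v)%:R :> R[i].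
  by rewrite -natrB; [congr _%:R|]; lia.
by rewrite mulrBl mulrBr [_ * (n.+1%:R * z)]mulrA E mul1r.
Qed.

(** The Cesaro means are uniformly bounded by [cesaro_bdd_by], so it suffices to test
them on finite combinations of basis vectors, where [cesaro_defect] applies. *)
Lemma cesaro_cvg X x y (e : R) : bdd X -> rcomm X -> 0 < e ->
  exists N, forall n, (N <= n)%N -> sqmod '[X x - cesaro n X x, y] < e.
Proof.
move=> bX cX e0; have [lX [c c0 Xc]] := bX.
pose D n := X \- cesaro n X.
have lS n := (calL_bdd_rcomm (cesaro_calL n X)).1.1.
have DB n : {morph D n : f g / f - g}.
  move=> f g; rewrite /D /= (linB lX) (linB (lS n)) !opprB.
  by rewrite [cesaro n X g - _]addrC addrACA [- X g + _]addrC.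
pose C := 4 * c + 1.
have DC n f : sqn (D n f) <= C * sqn f.
  rewrite /D /= -[X f - _]/(X f + - cesaro n X f); apply: le_trans (sqnD_le _ _) _.
  have := Xc f; have := cesaro_bdd_by n c0 bX Xc cX f; rewrite sqnN.
  by have := sqn_ge0 f; rewrite /C; lra.
have C0 : 0 < C by rewrite /C; lra.
have M0 : 0 < 16 * C * (sqn x + sqn y + 1).
  by rewrite !mulr_gt0//; have := sqn_ge0 x; have := sqn_ge0 y; lra.
set dl := e / (16 * C * (sqn x + sqn y + 1)).
have dl0 : 0 < dl by rewrite divr_gt0.
have [s us hs] := ell2_dense x dl0; set x' : HF := (X in sqn (x - X)) in hs.
have [t ut ht] := ell2_dense y dl0; set y' : HF := (X in sqn (y - X)) in ht.
pose kap := \sum_(u <- s) \sum_(v <- t) x u * (y v)^* * ((size v - size u)%:R * X (xi u) v).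
pose N1 := Num.truncn (8 * sqmod kap / e).
exists (maxn N1 (\max_(v <- t) size v)) => n; rewrite geq_max => /andP[nN nt].
have K : '[D n x', y'] = (((n.+1%:R : R)^-1)%:C)%C * kap.
  rewrite /x' /y' mulr_sumr.
  have DE (r : seq word) (a : word -> R[i]) :
      D n (\sum_(u <- r) a u *: xi u) = \sum_(u <- r) a u *: D n (xi u).
    by rewrite /D /= (lin_sum lX) (lin_sum (lS n)) -sumrB; apply: eq_bigr => u _;
      rewrite (linZ lX) (linZ (lS n)) scalerBr.
  rewrite DE dot_suml; apply: eq_bigr => u _.
  rewrite dot_sumr mulr_sumr; apply: eq_big_seq => v vt.
  rewrite dotZl dotZr coefE -[D n _]/(X (xi u) - cesaro n X (xi u)) cesaro_defect//.
    by rewrite [LHS]mulrA [LHS]mulrCA.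
  by apply: leq_trans _ (leqnSn n); apply: leq_trans nt; rewrite (big_rem v)//= leq_maxl.
(* Split off the finite parts x' and y'; the remaining terms are small uniformly in n. *)
have -> : '[X x - cesaro n X x, y] = '[D n x', y'] + ('[D n x', y - y'] + '[D n (x - x'), y]).
  by rewrite -[X x - _]/(D n x) DB (dotBl (D n x) (D n x')) (dotBr _ y y'); ring.
have x'x : sqn x' <= sqn x.
  by rewrite sqn_finsum// unit_weight; exact: fock_partial.
apply: le_lt_trans (sqmodD_le _ _) _.
have h1 := sqmodD_le '[D n x', y - y'] '[D n (x - x'), y].
have h2 := cauchy_schwarz (D n x') (y - y').
have h3 := cauchy_schwarz (D n (x - x')) y.
have h4 := DC n x'; have h5 := DC n (x - x').
have y0 := sqn_ge0 y; have x0 := sqn_ge0 x.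
have x'0 := sqn_ge0 x'; have yy0 := sqn_ge0 (y - y').
have g2 : sqmod '[D n x', y - y'] <= C * sqn x * dl.
  apply: le_trans h2 _; apply: ler_pM => //; [exact: sqn_ge0| |exact: ltW].
  by apply: le_trans h4 _; rewrite ler_pM2l.
have g3 : sqmod '[D n (x - x'), y] <= C * dl * sqn y.
  apply: le_trans h3 _; apply: ler_wpM2r => //.
  by apply: le_trans h5 _; rewrite ler_pM2l// ltW.
have dlE : 16 * (C * (sqn x + sqn y + 1)) * dl = e.
  by rewrite /dl mulrA mulrC divfK// gt_eqF.
have g1 : sqmod '[D n x', y'] <= e / 8.
  rewrite K sqmodM sqmodC exprVn; set N : R := n.+1%:R.
  have N1' : 1 <= N by rewrite ler1n.
  rewrite mulrC ler_pdivrMr; last by rewrite exprn_gt0//; lra.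
  have kN : 8 * sqmod kap / e < N.
    by apply: lt_le_trans (truncnS_gt _) _; rewrite ler_nat ltnS.
  rewrite ltr_pdivrMr// in kN.
  have : N <= N ^+ 2 by rewrite expr2 ler_peMl//; lra.
  rewrite -(ler_pM2l e0); lra.
have Cdl : 0 < C * dl by rewrite mulr_gt0.
move: g2 g3; rewrite [C * _ * dl]mulrAC => g2 g3.
have eE : 16 * (C * dl * sqn x) + 16 * (C * dl * sqn y) + 16 * (C * dl) = e.
  by rewrite -dlE; ring.
move: g1 g2 g3 eE Cdl h1.
set a := sqmod _; set b := sqmod _; set b' := sqmod _; set b'' := sqmod _.
set P := C * dl * sqn x; set Q := C * dl * sqn y; set Z := C * dl.
by move=> *; lra.
Qed.

(** The Cesaro means are polynomials in the shifts and converge in the WOT. *)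
Lemma rcomm_calL X : bdd X -> rcomm X -> calL X.
Proof.
move=> bX cX; apply: calL_wot_closed; apply/wot_closureP; split; first exact/bddP.
move=> s e e0; have /choice[N NP] (p : HF * HF) := cesaro_cvg p.1 p.2 bX cX e0.
exists (cesaro (\max_(p <- s) N p) X); first exact: cesaro_calL.
by move=> p ps; apply: NP; rewrite (big_rem p)//= leq_maxl.
Qed.

End Fejer.

(** * Extension of functionals *)

Section HahnBanach.
Context {R : realType} {V : lmodType R[i]}.
Implicit Types (x y m : V) (M : V -> Prop).

Notation "a *r x" := (((a : R)%:C)%C *: x) (at level 40).

Definition convex_on M (P : V -> R) := forall x y (l : R), M x -> M y -> 0 <= l <= 1 ->
  P (l *r x + (1 - l) *r y) <= l * P x + (1 - l) * P y.

Definition real_linear (u : V -> R) :=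
  forall (a b : R) x y, u (a *r x + b *r y) = a * u x + b * u y.

Definition real_closed M := forall (a b : R) x y, M x -> M y -> M (a *r x + b *r y).

(** Only real multiples of z are adjoined: a complex line takes two steps. *)
Definition adjoin M z x := exists2 m, M m & exists t : R, x = m + t *r z.

(** The Hahn-Banach step for a convex majorant.  The values allowed for z are
bounded below by the difference quotients at - t z and above by those at s z, and
convexity on the segment from m - t z to m' + s z orders the two. *)
Lemma real_extension M z (u P : V -> R) : M 0 -> real_closed M -> real_linear u ->
  convex_on (adjoin M z) P -> (forall m, M m -> u m <= P m) ->
  exists c : R, forall m (t : R), M m -> u m + t * c <= P (m + t *r z).
Proof.
move=> M0 Mcl lu cP uP.
pose lo := [set r | exists m (t : R), [/\ M m, 0 < t & r = (u m - P (m + (- t) *r z)) / t]].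
have key m m' (s t : R) : M m -> M m' -> 0 < s -> 0 < t ->
    (u m - P (m + (- t) *r z)) / t <= (P (m' + s *r z) - u m') / s.
  move=> Mm Mm' s0 t0; rewrite ler_pdivrMr// mulrAC ler_pdivlMr//.
  have st0 : 0 < s + t by rewrite addr_gt0.
  (* The weight for which the multiples of z cancel in the convex combination. *)
  pose l := s / (s + t); have l1 : 1 - l = t / (s + t).
    by apply: (mulIf (lt0r_neq0 st0)); rewrite mulrBl !divfK ?lt0r_neq0//; ring.
  have l01 : 0 <= l <= 1.
    rewrite divr_ge0 ?(ltW s0) ?(ltW st0)//=.
    by rewrite -subr_ge0 l1 divr_ge0 ?(ltW t0) ?(ltW st0).
  have E1 : l * (s + t) = s by rewrite divfK ?lt0r_neq0.
  have E2 : (1 - l) * (s + t) = t by rewrite l1 divfK ?lt0r_neq0.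
  have E0 : l * - t + (1 - l) * s = 0 by rewrite -[in X in X + _]E2 -[in X in _ + X]E1; ring.
  clear l1; clearbody l.
  have := cP (m + (- t) *r z) (m' + s *r z) l.
  have -> : l *r (m + (- t) *r z) + (1 - l) *r (m' + s *r z) = l *r m + (1 - l) *r m'.
    rewrite !scalerDr !scalerA -!real_complexM addrACA -scalerDl -[_%:C%C + _]real_complexD.
    by rewrite E0 scale0r addr0.
  move=> /(_ (ex_intro2 _ _ _ Mm (ex_intro _ _ erefl)) (ex_intro2 _ _ _ Mm' (ex_intro _ _ erefl)) l01).
  move=> /(le_trans (uP _ (Mcl _ _ _ _ Mm Mm'))); rewrite lu -(ler_pM2r st0).
  rewrite [leLHS]mulrDl [leRHS]mulrDl !(mulrAC _ _ (s + t)) E1 E2.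
  by rewrite mulrBl mulrBl; move=> h; lra.
have lo0 : lo ((u 0 - P (0 + (-1) *r z)) / 1) by exists 0, 1.
have ub m (s : R) : M m -> 0 < s -> ubound lo ((P (m + s *r z) - u m) / s).
  by move=> Mm s0 _ [m' [t [Mm' t0 ->]]]; exact: key.
have suplo : has_sup lo.
  by split; [eexists; exact: lo0|eexists; exact: (ub 0 1)].
exists (sup lo) => m t Mm; have [t0|t0|->] := ltgtP t 0.
- have : lo ((u m - P (m + (- (- t)) *r z)) / (- t)).
    by exists m, (- t); rewrite oppr_gt0.
  move/(sup_upper_bound suplo); rewrite opprK ler_pdivrMr ?oppr_gt0//; lra.
- have := sup_le_ub (ex_intro _ _ lo0) (ub _ _ Mm t0).
  rewrite ler_pdivlMr//; lra.
- by rewrite mul0r addr0 scale0r addr0; exact: uP.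
Qed.

Definition subspace M := M 0 /\ forall a x y, M x -> M y -> M (a *: x + y).

Lemma subspace_real M : subspace M -> real_closed M.
Proof.
move=> [M0 MD] a b x y Mx My; apply: (MD) => //.
by rewrite -[_ *: y]addr0; exact: MD.
Qed.

Definition functional (phi : V -> R[i]) := forall a x y, phi (a *: x + y) = a * phi x + phi y.

Lemma functionalD phi x y : functional phi -> phi (x + y) = phi x + phi y.
Proof. by move=> lphi; rewrite -[x]scale1r lphi mul1r scale1r. Qed.

Lemma functional0 phi : functional phi -> phi 0 = 0.
Proof. by move=> lphi; have := lphi (-1) 0 0; rewrite scaler0 addr0 mulN1r addNr. Qed.

Lemma functionalZ phi a x : functional phi -> phi (a *: x) = a * phi x.
Proof. by move=> lphi; rewrite -[a *: x]addr0 lphi functional0// addr0. Qed.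

Lemma functional_real phi c : functional phi ->
  real_linear (fun x => c * complex.Re (phi x)).
Proof.
move=> lphi a b x y; rewrite lphi functionalZ// ReD !ReCM; ring.
Qed.

(** The real part of the functional is extended first to z and then to i z; the two
real constants are the parts of a complex one.  Adding a multiple of a functional del
that vanishes on M keeps the extension defined on the whole space. *)
Lemma complex_extension M z (phi del : V -> R[i]) (P : V -> R) : subspace M ->
  functional phi -> functional del ->
  (forall m, M m -> del m = 0) -> del z = 1 ->
  convex_on (fun x => M (x - del x *: z)) P ->
  (forall m, M m -> 2 * complex.Re (phi m) <= P m) ->
  exists c : R[i], forall x, M (x - del x *: z) ->
    2 * complex.Re (phi x + c * del x) <= P x.
Proof.
move=> sM lphi ldel delM delz cP phiP; have [M0 MD] := sM.
(* The functional phi, made to vanish at z so that it can be prescribed there. *)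
pose phi0 x := phi x - del x * phi z.
have lphi0 : functional phi0.
  by move=> a x y; rewrite /phi0 lphi ldel; ring.
have phi0M m : M m -> phi0 m = phi m by move=> Mm; rewrite /phi0 delM// mul0r subr0.
have phi0z : phi0 z = 0 by rewrite /phi0 delz mul1r subrr.
have inM' m (w : R[i]) : M m -> M (m + w *: z - del (m + w *: z) *: z).
  move=> Mm; rewrite functionalD// functionalZ// delM// delz mulr1 add0r.
  by rewrite addrK.
pose u x := 2 * complex.Re (phi0 x).
have lu : real_linear u by exact: functional_real.
have cP1 : convex_on (adjoin M z) P.
  by move=> x y l [m Mm [t ->]] [m' Mm' [t' ->]]; apply: cP; exact: inM'.
have [|c1 c1P] := real_extension M0 (subspace_real sM) lu cP1.
  by move=> m Mm; rewrite /u phi0M//; exact: phiP.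
pose u1 x := u x + c1 * complex.Re (del x).
have lu1 : real_linear u1.
  by move=> a b x y; rewrite /u1 lu (functional_real c1 ldel); ring.
have u1E m (t : R) : M m -> u1 (m + t *r z) = 2 * complex.Re (phi m) + c1 * t.
  move=> Mm; rewrite /u1 /u (functionalD _ _ lphi0) (functionalD _ _ ldel).
  by rewrite !functionalZ// phi0z delM// delz mulr0 addr0 mulr1 add0r phi0M.
have [|||||c2 c2P] := @real_extension (adjoin M z) ('i%C *: z) u1 P.
- by exists 0 => //; exists 0; rewrite add0r scale0r.
- move=> a b _ _ [m Mm [t ->]] [m' Mm' [t' ->]]; exists (a *r m + b *r m').
    exact: subspace_real.
  exists (a * t + b * t').
  by rewrite !scalerDr !scalerA -!real_complexM addrACA -scalerDl real_complexD.
- exact: lu1.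
- move=> x y l [_ [m Mm [t ->]] [s ->]] [_ [m' Mm' [t' ->]] [s' ->]].
  have E (p : V) (a b : R) : p + a *r z + b *r ('i%C *: z) = p + (a%:C%C + b%:C%C * 'i%C) *: z.
    by rewrite -addrA scalerA -scalerDl.
  by apply: cP; rewrite E; exact: inM'.
- move=> _ [m Mm [t ->]]; rewrite u1E//.
  by have := c1P m t Mm; rewrite /u phi0M// [t * c1]mulrC.
exists (Complex (c1 / 2) (- c2 / 2) - phi z) => x Mx.
set w := del x in Mx *; set m := x - w *: z in Mx.
have xE : x = m + (complex.Re w) *r z + (complex.Im w) *r ('i%C *: z).
  rewrite /m -addrA scalerA -scalerDl [_%:C%C * 'i%C]mulrC -complexE; exact/esym/subrK.
have := c2P (m + (complex.Re w) *r z) (complex.Im w).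
rewrite -xE => /(_ (ex_intro2 _ _ _ Mx (ex_intro _ _ erefl))).
rewrite u1E//.
have -> : phi x = phi m + w * phi z by rewrite -{1}[x](subrK (w *: z)) functionalD// functionalZ.
rewrite mulrBl addrACA [phi z * w]mulrC subrr addr0 ReD /=.
by move=> h; apply: le_trans h; case: (w) => wr wi /=; lra.
Qed.

End HahnBanach.

(** * Commutant lifting *)

Section CommutantLifting.
Context {R : realType} {d : nat}.
Notation word := (word d).
Notation word0 := (word0 d).
Notation HF := (fock R d).
Notation xi w := (basis (fun _ : word => 1%:pos : {posnum R}) w : HF).
Implicit Types (f g : HF) (w : word) (u v : word0) (W : pred word).

(** Functions on words extend by 0 to the adjoined zero, so that vanishing on the null
class is one more case of being constant on classes. *)
Definition ext f u : R[i] := if u is Some w then f w else 0.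

Lemma ext_lin u : functional (ext^~ u).
Proof. by case: u => [w|] a f g //=; rewrite mulr0 addr0. Qed.

Variable e : word0 -> word0 -> Prop.
Hypothesis e_sym : forall u v, e u v -> e v u.
Hypothesis e_trans : forall u v r, e u v -> e v r -> e u r.
Hypothesis e_mulr : forall u v r, e u v -> e (mulw u r) (mulw v r).
Hypothesis e_graded : forall w w', e (Some w) (Some w') ->
  size w = size w' \/ e (Some w) None.

Definition outside W u := if u is Some w then ~~ W w else true.

(** The functions constant on classes once the words in W are removed.  For empty W
these are the invariant functions; each word added to W frees one coefficient. *)
Definition invariant_off W f :=
  forall u v, e u v -> outside W u -> outside W v -> ext f u = ext f v.

Lemma outside_predU1 W w u :
  outside [predU1 w & W] u = (u != Some w) && outside W u.
Proof. by case: u => //= u; rewrite negb_or. Qed.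

Lemma invariant_off_subspace W : subspace (invariant_off W).
Proof.
split=> [|a f g If Ig] u v uv Wu Wv; first by case: u v {uv Wu Wv} => [?|] [?|].
by rewrite !ext_lin (If u v)// (Ig u v).
Qed.

Lemma invariant_off_sub W W' f : {subset W <= W'} ->
  invariant_off W f -> invariant_off W' f.
Proof.
move=> WW' If u v uv Wu Wv; apply: If => //.
  by case: u {uv} Wu => // w /=; apply: contra => /WW'.
by case: v {uv} Wv => // w /=; apply: contra => /WW'.
Qed.

Lemma ext_xi w u : ext (xi w) u = (u == Some w)%:R.
Proof. by case: u. Qed.

Lemma invariant_off_xi W w : W w -> invariant_off W (xi w).
Proof.
have ext0 u : W w -> outside W u -> ext (xi w) u = 0.
  move=> Ww Wu; rewrite ext_xi (_ : u == Some w = false)//.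
  by apply: contraTF Wu => /eqP->; rewrite /= Ww.
by move=> Ww u v _ Wu Wv; rewrite !ext0.
Qed.

(** Freeing the coefficient at w adds at most one dimension.  It adds none if w is
alone in its class off W; otherwise the difference with the value at another element
of the class detects the new direction. *)
Lemma separating_functional W w : ~~ W w ->
  (forall f, invariant_off [predU1 w & W] f -> invariant_off W f) \/
  exists del : HF -> R[i], [/\ functional del, del (xi w) = 1,
    forall f, invariant_off W f -> del f = 0 &
    forall f, invariant_off [predU1 w & W] f -> invariant_off W (f - del f *: xi w)].
Proof.
move=> Ww.
have [[r [wr rN Wr]]|none] :=
    pselect (exists r, [/\ e (Some w) r, r != Some w & outside W r]).
  right; exists (fun f => f w - ext f r); split.
  - by move=> a f g; rewrite ell2D ell2Z ext_lin; ring.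
  - by rewrite -[xi w w]/(ext (xi w) (Some w)) !ext_xi eqxx (negPf rN) subr0.
  - by move=> f If; rewrite [ext f r](If _ (Some w))//; [rewrite subrr|exact: e_sym].
  - move=> f If; set g := f - _.
    have gE u : ext g u = ext f u - (f w - ext f r) * (u == Some w)%:R.
      case: u => [a|]; last by rewrite mulr0 subr0.
      by rewrite -[LHS]/(g a) /g ell2D ell2N ell2Z xiE.
    have gw : ext g (Some w) = ext f r by rewrite gE eqxx mulr1 opprB addrC subrK.
    have gN u : u != Some w -> ext g u = ext f u.
      by move=> /negPf uw; rewrite gE uw mulr0 subr0.
    have off u : outside W u -> u != Some w -> outside [predU1 w & W] u.
      by move=> Wu uw; rewrite outside_predU1 uw.
    have aux u : e (Some w) u -> outside W u -> u != Some w -> ext f r = ext g u.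
      move=> wu Wu uw; rewrite gN//; apply: If; [|exact: off|exact: off].
      exact: e_trans (e_sym wr) wu.
    move=> u v uv Wu Wv.
    have [uw|uw] := eqVneq u (Some w); have [vw|vw] := eqVneq v (Some w).
    + by rewrite uw vw.
    + by rewrite uw gw; apply: aux => //; rewrite -uw.
    + by rewrite vw gw; apply/esym/aux => //; rewrite -vw; exact: e_sym.
    + by rewrite !gN//; apply: If => //; exact: off.
left=> f If u v uv Wu Wv.
have [uw|uw] := eqVneq u (Some w); have [vw|vw] := eqVneq v (Some w).
- by rewrite uw vw.
- by case: none; exists v; split=> //; rewrite -uw.
- by case: none; exists u; split=> //; rewrite -vw; exact: e_sym.
- by apply: If => //; rewrite outside_predU1 ?uw ?vw.
Qed.

Lemma extend_words W (s : seq word) (phi : HF -> R[i]) (P : HF -> R) :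
  functional phi -> convex_on (invariant_off [predU s & W]) P ->
  (forall f, invariant_off W f -> 2 * complex.Re (phi f) <= P f) ->
  exists psi, [/\ functional psi, forall f, invariant_off W f -> psi f = phi f &
    forall f, invariant_off [predU s & W] f -> 2 * complex.Re (psi f) <= P f].
Proof.
move=> lphi; elim: s => [|w s IH] cP phiP.
  by exists phi.
have sub : {subset [predU s & W] <= [predU (w :: s) & W]}.
  by move=> v; rewrite !inE => /orP[]->; rewrite ?orbT.
have sub2 f : invariant_off [predU (w :: s) & W] f ->
    invariant_off [predU1 w & [predU s & W]] f.
  by apply: invariant_off_sub => v; rewrite !inE orbA.
have [|//|psi [lpsi psiphi psiP]] := IH.
  move=> x y l Mx My; apply: cP; exact: invariant_off_sub sub _.
have [sw|sw] := boolP ([predU s & W] w).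
  exists psi; split=> // f /sub2 If; apply: psiP; apply: invariant_off_sub If => v.
  by rewrite !inE => /orP[/eqP->|].
have [same|[del [ldel delw del0 delM]]] := separating_functional sw.
  by exists psi; split=> // f /sub2/same; exact: psiP.
have back f : invariant_off [predU s & W] (f - del f *: xi w) ->
    invariant_off [predU (w :: s) & W] f.
  move=> If; rewrite -[f](subrK (del f *: xi w)) addrC.
  apply: (invariant_off_subspace _).2; last exact: invariant_off_sub If.
  by apply: invariant_off_xi; rewrite inE mem_head.
have [|c cP'] := complex_extension (invariant_off_subspace _) lpsi ldel del0 delw _ psiP.
  by move=> x y l /back Mx /back My; exact: cP.
exists (fun f => psi f + c * del f); split.
- by move=> a f g; rewrite lpsi ldel; ring.
- move=> f If; rewrite del0 ?mulr0 ?addr0 ?psiphi//.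
  by apply: invariant_off_sub If => v; rewrite !inE orbC => ->.
- by move=> f /sub2/delM; exact: cP'.
Qed.

Lemma invariant_off_Rdel W W' f i : (forall w, W' (rcons w i) -> W w) ->
  invariant_off W' f -> invariant_off W (Rdel i f).
Proof.
move=> WW' If.
have extR u : ext (Rdel i f) u = ext f (mulw u (Some [:: i])).
  by case: u => //= w; rewrite cats1.
have off u : outside W u -> outside W' (mulw u (Some [:: i])).
  by case: u => //= w; rewrite cats1; apply: contra; exact: WW'.
by move=> u v uv Wu Wv; rewrite !extR; apply: If; [exact: e_mulr|exact: off|exact: off].
Qed.

Definition short k : pred word := fun w => (size w < k)%N.

Lemma invariant_off_RdelS k f i :
  invariant_off (short k.+1) f -> invariant_off (short k) (Rdel i f).
Proof. by apply: invariant_off_Rdel => w; rewrite /short size_rcons. Qed.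

Lemma invariant_off_Rdel0 f i :
  invariant_off (short 0) f -> invariant_off (short 0) (Rdel i f).
Proof. exact: invariant_off_Rdel. Qed.

Definition words k : seq word := [seq bseqval b | b <- enum {: k.-bseq 'I_d}].

Lemma mem_words k w : (w \in words k) = (size w <= k)%N.
Proof.
apply/mapP/idP => [[b _ ->]|wk]; first exact: size_bseq.
by exists (Bseq wk); rewrite ?mem_enum.
Qed.

Lemma words_uniq k : uniq (words k).
Proof. by rewrite map_inj_uniq ?enum_uniq//; exact: val_inj. Qed.

(** The condition 2 Re psi <= Q + 1 is convex and passes through [extend_words];
scaling the argument recovers the homogeneous bound from it. *)
Lemma dominated_functional (M : HF -> Prop) (psi : HF -> R[i]) (Q : HF -> R) :
  subspace M -> functional psi -> (forall a f, Q (a *: f) = sqmod a * Q f) ->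
  (forall f, M f -> 0 <= Q f) -> (forall f, M f -> 2 * complex.Re (psi f) <= Q f + 1) ->
  forall f, M f -> sqmod (psi f) <= Q f.
Proof.
move=> [M0 MD] lpsi QZ Q0 psiQ f Mf; set D := sqmod (psi f).
have D0 : 0 <= D := sqmod_ge0 _.
(* The hypothesis at t times the conjugate of psi f times f. *)
have key (t : R) : 2 * (t * D) <= t ^+ 2 * D * Q f + 1.
  have Mt : M (((t%:C)%C * (psi f)^* ) *: f) by rewrite -[_ *: f]addr0; exact: MD.
  have := psiQ _ Mt; rewrite functionalZ// QZ sqmodM sqmodJ sqmodC.
  by rewrite -[(_ * _^* * psi f)]mulrA ReCM [_^* * _]mulrC Re_sqmod.
have [D00|DN0] := eqVneq D 0; first by rewrite D00; exact: Q0.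
have Dgt : 0 < D by rewrite lt_def DN0.
have [Qf0|QN0] := eqVneq (Q f) 0.
  have := key D^-1; rewrite Qf0 mulr0 add0r mulVf//; lra.
have Qgt : 0 < Q f by rewrite lt_def QN0 Q0.
have := key (Q f)^-1.
have -> : (Q f)^-1 ^+ 2 * D * Q f = (Q f)^-1 * D by field.
move=> h; have : (Q f)^-1 * D <= 1 by lra.
by rewrite mulrC ler_pdivrMr// mul1r.
Qed.

(** The state of the construction once all words shorter than k are free. *)
Definition partial_lift c k (Y : HF -> HF) := [/\ linear Y,
  forall f, invariant_off (short k) f -> sqn (Y f) <= c * sqn f &
  forall f i, invariant_off (short k) f -> Rdel i (Y f) = Y (Rdel i f)].

Lemma sqn_convex (H : ipSpace R) (x y : H) (l : R) :
  sqn ((l%:C)%C *: x + ((1 - l)%:C)%C *: y : H) =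
  l * sqn x + (1 - l) * sqn y - l * (1 - l) * sqn (x - y).
Proof.
rewrite [LHS]sqnD !sqnZ !sqmodC sqnB dotZl dotZr conj_real_complex !ReCM; ring.
Qed.

(** Commutation forces the extension to be psi (f) xi_0 + Z f, where Z f is the sum of
Rsh i (Y (Rdel i f)): deleting a letter leads back to where Y is a partial lift.
The two terms are orthogonal, so the norm bound on the extension says that |psi|^2 is
at most Q = c |f|^2 - |Z f|^2.  This form is nonnegative by the bound on Y. *)
Lemma partial_lift_step c k Y : 0 <= c -> partial_lift c k Y ->
  exists Y', partial_lift c k.+1 Y' /\ forall f, invariant_off (short k) f -> Y' f = Y f.
Proof.
move=> c0 [lY Yc Ycomm].
pose Z f := \sum_i Rsh i (Y (Rdel i f)).
have lZ : linear Z.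
  move=> a f g; rewrite /Z scaler_sumr -big_split; apply: eq_bigr => i _ /=.
  by rewrite (Rdel_bdd i).1 lY (Rsh_bdd i).1.
have sqnaZ a f : sqn (a *: xi [::] + Z f) = sqmod a + sqn (Z f).
  rewrite sqn_Rsh_sum -[Z f]add0r -[X in sqn (X + Z f)](scale0r (xi [::])) sqn_Rsh_sum.
  by rewrite sqmod0 add0r.
pose Q f := c * sqn f - sqn (Z f).
have QZ a f : Q (a *: f) = sqmod a * Q f by rewrite /Q (linZ lZ) !sqnZ; ring.
have Q0 f : invariant_off (short k.+1) f -> 0 <= Q f.
  move=> If; rewrite subr_ge0 -[Z f]add0r -[X in sqn (X + Z f)](scale0r (xi [::])).
  rewrite sqn_Rsh_sum sqmod0 add0r sqn_decomp mulrDr.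
  apply: (@le_trans _ _ (c * \sum_i sqn (Rdel i f))).
    rewrite mulr_sumr; apply: ler_sum => i _; apply: Yc; exact: invariant_off_RdelS.
  by rewrite lerDr mulr_ge0// sqmod_ge0.
pose phi f := Y f [::].
have lphi : functional phi by move=> a f g; rewrite /phi lY ell2D ell2Z.
have YE f : invariant_off (short k) f -> Y f = phi f *: xi [::] + Z f.
  move=> If; rewrite [LHS]Rsh_decomp; congr (_ + _).
  by apply: eq_bigr => i _; rewrite Ycomm.
have phiQ f : invariant_off (short k) f -> 2 * complex.Re (phi f) <= Q f + 1.
  move=> If; have := Yc _ If; rewrite {1}YE// sqnaZ /Q.
  have := Re_le_sqmod (phi f); have := sqr_ge0 (complex.Re (phi f) - 1); lra.
pose s := words k.
have sk f : invariant_off [predU s & short k] f <-> invariant_off (short k.+1) f.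
  split; apply: invariant_off_sub => w; rewrite !inE mem_words !unfold_in /short.
    by case/orP => // /ltnW.
  by rewrite ltnS => ->.
have [||psi [lpsi psiphi psiQ]] := @extend_words (short k) s phi (fun f => Q f + 1) lphi.
- move=> x y l /sk Ix /sk Iy /andP[l0 l1]; rewrite /Q lZ (linZ lZ) !sqn_convex.
  have : 0 <= l * (1 - l) * Q (x - y).
    apply: mulr_ge0; first by rewrite mulr_ge0 ?subr_ge0.
    apply: Q0.
    rewrite addrC -scaleN1r; exact: (invariant_off_subspace _).2.
  rewrite /Q (linB lZ); lra.
- exact: phiQ.
have psiQ' f : invariant_off (short k.+1) f -> sqmod (psi f) <= Q f.
  apply: (dominated_functional (invariant_off_subspace _) lpsi QZ Q0) => g /sk; exact: psiQ.
have Y'E f : invariant_off (short k) f -> psi f *: xi [::] + Z f = Y f.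
  by move=> If; rewrite psiphi// -YE.
exists (fun f => psi f *: xi [::] + Z f); split; last exact: Y'E.
split.
- by move=> a f g; rewrite lpsi lZ scalerDl scalerDr scalerA addrACA.
- by move=> f If; rewrite sqnaZ; have := psiQ' f If; rewrite /Q; lra.
- move=> f i If; rewrite (Y'E (Rdel i f)); last exact: invariant_off_RdelS.
  rewrite (linD (Rdel_bdd i).1) (linZ (Rdel_bdd i).1) Rdel_nil scaler0 add0r.
  rewrite /Z (lin_sum (Rdel_bdd i).1) (bigD1 i)//= Rdel_Rsh eqxx scale1r.
  rewrite big1 ?addr0// => j /negPf ji; by rewrite Rdel_Rsh eq_sym ji scale0r.
Qed.

Definition trunc k f : HF := \sum_(w <- words k) f w *: xi w.

Lemma truncE k f w : trunc k f w = if (size w <= k)%N then f w else 0.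
Proof.
rewrite /trunc ell2_sum; case: ifPn => [wk|wk].
  rewrite (bigD1_seq w) ?mem_words ?words_uniq// big1 => [|v /negPf vw].
    by rewrite ell2Z xiE eqxx mulr1; exact: addr0.
  by rewrite ell2Z xiE eq_sym vw mulr0.
rewrite big1_seq// => v /andP[_]; rewrite mem_words => vk.
rewrite ell2Z xiE (_ : w == v = false) ?mulr0//.
by apply: contraNF wk => /eqP->.
Qed.

Lemma trunc_approx f (dl : R) : 0 < dl -> exists k, sqn (f - trunc k f) < dl.
Proof.
move=> dl0; have [s us h] := ell2_dense f dl0.
exists (\max_(w <- s) size w); apply: le_lt_trans h; set k := \max_(w <- s) _.
rewrite !sqn_trunc ?words_uniq// !unit_weight lerD2l lerN2.
have sk : {subset s <= words k}.
  by move=> w ws; rewrite mem_words /k (big_rem w)//= leq_maxl.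
rewrite [leRHS](bigID (mem s)) /= -[X in _ <= X + _]big_filter.
rewrite [X in _ <= X + _](perm_big s) /=.
  by rewrite lerDl sumr_ge0// => w _; exact: sqmod_ge0.
apply: uniq_perm => // [|w]; first exact: filter_uniq (words_uniq k).
by rewrite mem_filter /= andb_idr// => /sk.
Qed.

(** Classes that are not null have a single length, so truncation respects them. *)
Lemma invariant_trunc k f : invariant_off (short 0) f -> invariant_off (short 0) (trunc k f).
Proof.
move=> If.
have extT u : ext (trunc k f) u =
    if (if u is Some w then size w <= k else true)%N then ext f u else 0.
  by case: u => //= w; rewrite truncE.
have out u : outside (short 0) u by case: u.
have fN w : e (Some w) None -> f w = 0.
  by move=> wN; exact: (If (Some w) None wN (out _) (out _)).
have exts u v : e u v -> ext f u = ext f v by move=> uv; apply: If; rewrite ?out.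
move=> [a|] [b|] ab _ _ //; rewrite !extT /=.
- have [->|aN] := e_graded ab; first by case: ifP => // _; exact: (exts _ _ ab).
  by rewrite (fN a aN) (fN b (e_trans (e_sym ab) aN)) !if_same.
- by rewrite (fN a ab) if_same.
- by rewrite (fN b (e_sym ab)) if_same.
Qed.

(** The partial lifts agree on finitely supported vectors and give the adjoint of X
there.  They agree with Y0 on truncations of invariant vectors, hence on all
invariant vectors by continuity. *)
Theorem commutant_lifting (Y0 : HF -> HF) : bdd Y0 ->
  (forall f i, invariant_off (short 0) f -> Rdel i (Y0 f) = Y0 (Rdel i f)) ->
  exists X : HF -> HF, [/\ bdd X, rcomm X &
    forall f, invariant_off (short 0) f -> adj X f = Y0 f].
Proof.
move=> bY0 Y0comm; have [lY0 [c c0 Y0c]] := bY0.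
(* Stated for all operators, so that choice gives a function to iterate. *)
have step (p : nat * (HF -> HF)) : exists Y', partial_lift c p.1 p.2 ->
    partial_lift c p.1.+1 Y' /\ forall f, invariant_off (short p.1) f -> Y' f = p.2 f.
  have [gp|ngp] := pselect (partial_lift c p.1 p.2); last by exists (p.2).
  by have [Y' ?] := partial_lift_step c0 gp; exists Y'.
have /choice[F FP] := step.
pose Y k := iteri k (fun k Y => F (k, Y)) Y0.
have Ygood k : partial_lift c k (Y k).
  elim: k => [|k IH]; first by split=> // f _; exact: Y0c.
  by have [] := FP (k, Y k) IH.
have Ystable k l f : (k <= l)%N -> invariant_off (short k) f -> Y l f = Y k f.
  move=> kl If; elim: l kl => [|l IH]; first by rewrite leqn0 => /eqP->.
  rewrite leq_eqVlt ltnS => /predU1P[->//|kl]; rewrite -IH//.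
  have [_] := FP (l, Y l) (Ygood l); apply => /=.
  by apply: invariant_off_sub If => w; rewrite !unfold_in /short => /leq_trans; exact.
have Ylin k : linear (Y k) by case: (Ygood k).
have inv_xi w : invariant_off (short (size w).+1) (xi w).
  by apply: invariant_off_xi; rewrite /short.
pose y w := Y (size w).+1 (xi w).
have ysum k (s : seq word) (a : word -> R[i]) : {in s, forall w, size w < k}%N ->
    \sum_(w <- s) a w *: y w = Y k (\sum_(w <- s) a w *: xi w).
  move=> sk; rewrite (lin_sum (Ylin k)); apply: eq_big_seq => w ws.
  by rewrite (linZ (Ylin k)) /y -(Ystable _ k)//; exact: sk.
have Mfin k (s : seq word) (a : word -> R[i]) : {in s, forall w, size w < k}%N ->
    invariant_off (short k) (\sum_(w <- s) a w *: xi w).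
  have [M0 MD] := invariant_off_subspace (short k).
  elim: s => [|w s IH] sk; first by rewrite big_nil.
  rewrite big_cons; apply: MD.
    by apply: invariant_off_xi; exact: sk (mem_head _ _).
  by apply: IH => v vs; apply: sk; rewrite inE vs orbT.
have [|X [lX Xc Xy]] := @adjoint_family _ _ (fun=> 1%:pos) _ y c c0.
  move=> s g us; rewrite -sqn_finsum//.
  have sk : {in s, forall w, size w < (\max_(w <- s) size w).+1}%N.
    by move=> w ws; rewrite ltnS (big_rem w)//= leq_maxl.
  rewrite (ysum _ _ _ sk); have [_ + _] := Ygood (\max_(w <- s) size w).+1.
  by apply; exact: Mfin.
have bX : bdd X by split=> //; exists c.
have adjX w : adj X (xi w) = y w.
  by apply: dot_inj => g; rewrite -adjEr// dotC Xy -dotC.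
have Rdely i w : Rdel i (y w) = Y (size w).+1 (Rdel i (xi w)).
  by have [_ _] := Ygood (size w).+1; exact.
exists X; split=> //.
  move=> i f; apply: ell2_ext => w.
  rewrite -!coefE Xy Rsh_adj (Rsh_adj i (X f)) Rdely.
  case/lastP: w => [|w j]; first by rewrite Rdel_nil (lin0 (Ylin _)) !dot0r.
  rewrite Rdel_rcons (linZ (Ylin _)) !dotZr Xy; congr (_ * '[_, _]).
  by apply: Ystable => //; rewrite size_rcons.
move=> f If; apply/eqP; rewrite -subr_eq0.
have [lD [b b0 Db]] := bdd_lin (-1) bY0 (adj_bdd bX).
set D := -1 *: Y0 + adj X in lD Db.
have DE g : D g = adj X g - Y0 g by rewrite /D -[LHS]/(-1 *: Y0 g + adj X g) scaleN1r addrC.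
have DT k : D (trunc k f) = 0.
  have sk : {in words k, forall w, size w < k.+1}%N by move=> w; rewrite mem_words.
  rewrite DE (lin_sum (adj_bdd bX).1).
  under eq_bigr do rewrite (linZ (adj_bdd bX).1) adjX.
  rewrite (ysum _ _ _ sk) -/(trunc k f) (Ystable 0%N)// ?subrr//.
  exact: invariant_trunc.
rewrite -DE; apply/eqP/sqn_eq0/eqP; rewrite eq_le sqn_ge0 andbT.
apply/ler_addgt0Pr => dl dl0; rewrite add0r.
have b1 : 0 < b + 1 by lra.
have [k hk] := trunc_approx f (divr_gt0 dl0 b1).
rewrite -[D f]subr0 -(DT k) -(linB lD); apply: le_trans (Db _) _.
apply: le_trans (ler_wpM2l b0 (ltW hk)) _.
by rewrite mulrCA -[leRHS]mulr1 ler_pM2l// ler_pdivrMr// mul1r; lra.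
Qed.

End CommutantLifting.

(** * Finite-dimensional linear algebra *)

Section FiniteAlgebra.
Context {F : fieldType}.

(** A matrix of maximal rank among those with rows in B has B as row space; its
cokernel provides the annihilators. *)
Lemma row_double_annihilator n (B : 'rV[F]_n -> Prop) (g : 'rV[F]_n) :
  B 0 -> (forall c x y, B x -> B y -> B (c *: x + y)) ->
  (forall f : 'cV[F]_n, (forall b, B b -> b *m f = 0) -> g *m f = 0) -> B g.
Proof.
move=> B0 BD gB.
pose P r := `[< exists m (M : 'M[F]_(m, n)), (forall i, B (row i M)) /\ \rank M = r >].
have P0 : exists r, P r.
  by exists 0%N; apply/asboolP; exists 0%N, 0; split=> [[]//|]; exact: mxrank0.
have Pn r : P r -> (r <= n)%N by move=> /asboolP[m [M [_ <-]]]; exact: rank_leq_col.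
case: (ex_maxnP P0 Pn) => r /asboolP[m [M [MB Mr]]] rmax.
have BM b : B b -> (b <= M)%MS.
  move=> Bb; have := submx_refl (col_mx M b); rewrite col_mx_sub => /andP[MM bM].
  have [rle rif] := mxrank_leqif_sup MM.
  apply: submx_trans bM _; rewrite -rif eqn_leq rle Mr; apply: rmax.
  apply/asboolP; exists (m + 1)%N, (col_mx M b); split=> // i.
  case: (split_ordP i) => j ->; first by rewrite rowKu.
  by rewrite rowKd ord1 row_id.
have /submxP[D ->] : (g <= M)%MS.
  rewrite submxE; apply/eqP/matrixP => i j; rewrite ord1.
  have : g *m col j (cokermx M) = 0.
    apply: gB => b /BM; rewrite submxE => /eqP bM.
    by rewrite colE mulmxA bM mul0mx.
  by rewrite colE mulmxA -colE => /matrixP/(_ 0 0); rewrite !mxE.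
rewrite mulmx_sum_row; elim/big_ind: _ => // [x y Bx By|i _].
  by rewrite -[x]scale1r; exact: BD.
by rewrite -[_ *: _]addr0; exact: BD.
Qed.

Context {T : finType}.
Implicit Types (f g : T -> F) (A : (T -> F) -> Prop).

Definition fsubspace A :=
  A (fun=> 0) /\ forall c f g, A f -> A g -> A (fun t => c * f t + g t).

Lemma double_annihilator (B : (T -> F) -> Prop) g : fsubspace B ->
  (forall f, (forall b, B b -> \sum_t b t * f t = 0) -> \sum_t g t * f t = 0) -> B g.
Proof.
move=> [B0 BD] gB; pose tofun (r : 'rV[F]_#|T|) t := r 0 (enum_rank t).
have tofunE h : tofun (\row_i h (enum_val i)) = h.
  by apply/funext => t; rewrite /tofun mxE enum_rankK.
rewrite -(tofunE g).
apply: (@row_double_annihilator _ (fun r => B (tofun r))) => [|c x y Bx By|f fB].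
- by congr B : B0; apply/funext => t; rewrite /tofun mxE.
- by congr B : (BD c _ _ Bx By); apply/funext => t; rewrite /tofun !mxE.
have sumE h : \sum_t h t * f (enum_rank t) 0 = ((\row_i h (enum_val i)) *m f) 0 0.
  rewrite mxE (reindex_onto enum_rank enum_val) => [|i _]; last exact: enum_valK.
  apply: eq_big => t; first by rewrite enum_rankK eqxx.
  by rewrite mxE enum_rankK.
apply/matrixP => i j; rewrite !ord1 -sumE mxE; apply: gB => b Bb.
by rewrite sumE fB ?mxE// tofunE.
Qed.

(** To kill h at a point t that some f in A separates from t0, multiply h by
f - f t; this stays in A although A need not contain constants, since it is
f h - f(t) h. *)
Lemma class_indicator A t0 : fsubspace A ->
  (forall f g, A f -> A g -> A (fun t => f t * g t)) ->
  (exists2 f, A f & f t0 != 0) ->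
  exists h, [/\ A h, forall t, (forall f, A f -> f t = f t0) -> h t = 1 &
    forall t, ~ (forall f, A f -> f t = f t0) -> h t = 0].
Proof.
move=> [A0 AD] AM [f0 Af0 f0t0].
have AZ c f : A f -> A (fun t => c * f t).
  by move=> Af; congr A : (AD c _ _ Af A0); apply/funext => t; rewrite addr0.
(* Kill the points that are not in the class one after the other. *)
have : exists h, [/\ A h, h t0 != 0 & {in enum T, forall t,
    ~ (forall f, A f -> f t = f t0) -> h t = 0}].
  elim: (enum T) => [|t s [h [Ah ht0 hs]]]; first by exists f0.
  have [same|/existsNP[f /not_implyP[Af ft]]] := pselect (forall f, A f -> f t = f t0).
    exists h; split=> // t'; rewrite inE => /predU1P[->//|]; exact: hs.
  exists (fun t' => - f t * h t' + f t' * h t'); split.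
  - by apply: AD => //; exact: AM.
  - rewrite -mulrDl mulf_neq0// addrC subr_eq0; apply/eqP => E; exact: ft.
  - move=> t'; rewrite inE => /predU1P[->|t's]; first by rewrite mulNr addNr.
    by move/(hs t' t's) => ->; rewrite !mulr0 addr0.
move=> [h [Ah ht0 hs]]; exists (fun t => (h t0)^-1 * h t); split.
- exact: AZ.
- by move=> t same; rewrite same// mulVf.
- by move=> t /hs ->; rewrite ?mulr0// mem_enum.
Qed.

End FiniteAlgebra.

(** * Homogeneous Hopf ideals *)

Section HopfIdeal.
Context {R : realType} {d : nat}.
Notation word := (word d).
Notation word0 := (word0 d).
Notation HF := (fock R d).
Notation HFF := (fock2 R d).
Notation xi w := (basis (fun _ : word => 1%:pos : {posnum R}) w : HF).
Variable (J : set (HF -> HF)).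
Hypothesis J_ideal : op_ideal calL J.
Hypothesis J_closed : wot_closed J.
Implicit Types (w : word) (X Y : HF -> HF).

Lemma ideal_calL X : J X -> calL X. Proof. by case: J_ideal => + _ _ _; apply. Qed.
Lemma ideal_zero : J 0. Proof. by case: J_ideal. Qed.
Lemma ideal_lin c X Y : J X -> J Y -> J (c *: X + Y). Proof. by case: J_ideal => _ _ + _; apply. Qed.
Lemma ideal_mull X Y : calL X -> J Y -> J (X \o Y).
Proof. by move=> LX JY; case: J_ideal => _ _ _ /(_ X Y LX JY)[]. Qed.
Lemma ideal_mulr X Y : J X -> calL Y -> J (X \o Y).
Proof. by move=> JX LY; case: J_ideal => _ _ _ /(_ Y X LY JX)[]. Qed.

Lemma hcomp_lin k c X Y : hcomp k (c *: X + Y) = c *: hcomp k X + hcomp k Y.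
Proof.
rewrite /hcomp scaler_sumr -big_split; apply: eq_bigr => u _ /=.
by rewrite scalerA -scalerDl.
Qed.

Lemma hcomp0 k : hcomp k 0 = 0 :> (HF -> HF).
Proof. by rewrite /hcomp big1// => u _; exact: scale0r. Qed.

Lemma poly_coef k (c : k.-tuple 'I_d -> R[i]) w :
  (\sum_(u : k.-tuple 'I_d) c u *: Lword u) (xi [::]) w =
  \sum_(u : k.-tuple 'I_d) c u * (w == u)%:R.
Proof.
rewrite op_sumE ell2_sum; apply: eq_bigr => u _.
by rewrite -[LHS]/(c u * Lword u (xi [::]) w) Lword_basis cats0 xiE.
Qed.

Lemma poly_coef_tuple k (c : k.-tuple 'I_d -> R[i]) (t : k.-tuple 'I_d) :
  (\sum_(u : k.-tuple 'I_d) c u *: Lword u) (xi [::]) t = c t.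
Proof.
rewrite poly_coef (bigD1 t)//= eqxx mulr1 big1 ?addr0// => u ut.
by rewrite val_eqE eq_sym (negPf ut) mulr0.
Qed.

Lemma hcomp_poly k n (c : n.-tuple 'I_d -> R[i]) :
  let p := \sum_(u : n.-tuple 'I_d) c u *: Lword u : HF -> HF in
  hcomp k p = if k == n then p else 0.
Proof.
move=> p; case: eqVneq => [->|kn].
  by apply: eq_bigr => u _; rewrite poly_coef_tuple.
rewrite /hcomp big1// => u _; rewrite /p poly_coef big1 ?scale0r// => v _.
rewrite (_ : _ == _ = false) ?mulr0//.
by apply: contraNF kn => /eqP E; rewrite -(size_tuple u) E size_tuple.
Qed.

Hypothesis J_homogeneous : homogeneous J.

(** The elements of J with all their components in J form a WOT-closed ideal that
contains the homogeneous generators: components of products are given by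
[hcomp_compose], and taking a component is WOT-continuous. *)
Lemma hcomp_ideal k X : J X -> J (hcomp k X).
Proof.
have [P Phom JE] := J_homogeneous.
pose J' := [set X | J X /\ forall k, J (hcomp k X)].
suff : J `<=` J' by move=> JJ' /JJ'[].
have PJ : P `<=` J by rewrite JE => p Pp I _ _; exact.
rewrite {1}JE => Z; apply.
- split=> [Y [/ideal_calL]//||c Y Z' [JY JcY] [JZ' JcZ]|A B LA [JB JcB]].
  + by split=> [|m]; rewrite ?hcomp0; exact: ideal_zero.
  + by split=> [|m]; rewrite ?hcomp_lin; exact: ideal_lin.
  + have [bA cA] := calL_bdd_rcomm LA; have [bB cB] := calL_bdd_rcomm (ideal_calL JB).
    split; split=> [|m]; [exact: ideal_mull| |exact: ideal_mulr|]; rewrite hcomp_compose//.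
      by elim/big_ind: _ => [|f g Jf Jg|j _]; [exact: ideal_zero|rewrite -[f]scale1r; exact: ideal_lin|
        apply: ideal_mull => //; exact: hcomp_calL].
    by elim/big_ind: _ => [|f g Jf Jg|j _]; [exact: ideal_zero|rewrite -[f]scale1r; exact: ideal_lin|
      apply: ideal_mulr => //; exact: hcomp_calL].
- move=> T clT; split; first by apply: J_closed; apply: weak_closureS clT => Y [].
  move=> m; apply: (@wot_transfer _ _ _ (hcomp m) J' J T) => //.
  + move=> x y; exists [seq (xi [::], ('[Lword u x, y])^* *: xi u) | u : m.-tuple 'I_d].
    move=> Y _; rewrite big_map /hcomp op_sumE dot_suml big_enum.
    apply: eq_bigr => u _; rewrite -[RHS]/('[Y (xi [::]), ('[Lword u x, y])^* *: xi u]).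
    by rewrite -[LHS]/('[Y (xi [::]) u *: Lword u x, y]) dotZl dotZr conjCK coefE mulrC.
  + by move=> Y [JY JcY]; split=> //; case: (calL_bdd_rcomm (ideal_calL JY)).
  + exact: hcomp_bdd.
- move=> p Pp; split; first exact: PJ.
  move=> m; have [n [c pE]] := Phom _ Pp; rewrite pE hcomp_poly -pE.
  by case: ifP => _; [exact: PJ|exact: ideal_zero].
Qed.

(** The functions on words of length k, as functionals on the homogeneous polynomials
of degree k, that vanish on J.  The pairing is bilinear, so that [ann_mul] is about
plain products. *)
Definition ann k (f : k.-tuple 'I_d -> R[i]) :=
  forall X, J X -> \sum_(u : k.-tuple 'I_d) X (xi [::]) u * f u = 0.

Lemma ann_subspace k : fsubspace (@ann k).
Proof.
split=> [X JX|c f g Af Ag X JX]; first by rewrite big1// => u _; rewrite mulr0.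
transitivity (c * (\sum_(u : k.-tuple 'I_d) X (xi [::]) u * f u) +
  \sum_(u : k.-tuple 'I_d) X (xi [::]) u * g u).
  by rewrite mulr_sumr -big_split; apply: eq_bigr => u _ /=; ring.
by rewrite Af// Ag// mulr0 addr0.
Qed.

(** The double annihilator theorem, in one degree. *)
Lemma ann_separates k (g : k.-tuple 'I_d -> R[i]) :
  (forall f, ann f -> \sum_u g u * f u = 0) ->
  J (\sum_(u : k.-tuple 'I_d) g u *: Lword u).
Proof.
move=> gA; apply: (@double_annihilator _ _
    (fun g : k.-tuple 'I_d -> R[i] => J (\sum_(u : k.-tuple 'I_d) g u *: Lword u))).
  split=> [|c f h Jf Jh]; first by rewrite big1 => [|u _]; [exact: ideal_zero|exact: scale0r].
  rewrite (_ : \sum_u _ = c *: (\sum_(u : k.-tuple 'I_d) f u *: Lword u) +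
      \sum_(u : k.-tuple 'I_d) h u *: Lword u).
    exact: ideal_lin.
  rewrite scaler_sumr -big_split; apply: eq_bigr => u _ /=.
  by rewrite scalerA -scalerDl.
move=> f fJ; apply: gA => X JX.
exact: (fJ (fun u : k.-tuple 'I_d => X (xi [::]) u) (hcomp_ideal k JX)).
Qed.

Variable Delta : (HF -> HF) -> (HFF -> HFF).
Hypothesis Delta_comult : comultiplication Delta.
Hypothesis J_hopf : forall X, J X -> wstar_closure
  [set Y + Z | Y in alg_tensor J calL & Z in alg_tensor calL J] (Delta X).

Notation xixi := (tensor (xi [::]) (xi [::])).

Lemma Delta_poly k (c : k.-tuple 'I_d -> R[i]) :
  Delta (\sum_(u : k.-tuple 'I_d) c u *: Lword u) =
  \sum_(u : k.-tuple 'I_d) c u *: Delta (Lword u).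
Proof.
have [_ [Dlin _ _] _ _ _] := Delta_comult.
have [_ L0 LD _] := (@calL_subalgebra R d).
have D0 : Delta 0 = 0.
  have := Dlin (-1) 0 0 L0 L0; rewrite scaler0 addr0 => ->.
  by rewrite scaleN1r addNr.
suff H (s : seq (k.-tuple 'I_d)) : calL (\sum_(u <- s) c u *: Lword u : HF -> HF) /\
    Delta (\sum_(u <- s) c u *: Lword u) = \sum_(u <- s) c u *: Delta (Lword u).
  by case: (H (index_enum _)).
elim: s => [|u s [Ls IH]]; first by rewrite !big_nil.
have Lu : calL (Lword u : HF -> HF) := calL_Lop (Some (u : seq 'I_d)).
by rewrite !big_cons; split; [exact: LD|rewrite Dlin// IH].
Qed.

Lemma wstar_vector_functional (H : ipSpace R) (x y : H) :
  wstar_functional (fun T : H -> H => '[T x, y]).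
Proof.
(* The series reduced to its first term. *)
pose at0 (z : H) n := if n is 0%N then z else 0.
have sum0 (z : H) : rsummable (fun n => hnorm (at0 z n) ^+ 2).
  apply: (@rsummable_bound _ _ _ (sqn z)) => [n|s us]; first exact: sqr_ge0.
  under eq_bigr do rewrite hnorm_sqr.
  have [s0|s0] := boolP (0%N \in s).
    by rewrite (bigD1_seq 0%N)//= big1 ?addr0// => -[|n]//= _; exact: sqn0.
  rewrite big1_seq ?sqn_ge0// => -[|n] /andP[_ ns]; last exact: sqn0.
  by rewrite ns in s0.
exists (at0 x), (at0 y); split=> //; apply/funext => T.
have E n : n != 0%N -> '[T (at0 x n), at0 y n] = 0 by case: n => // n _; rewrite dot0r.
rewrite /csum !(@rsum_single _ _ _ 0%N) => [|n /E ->//|n /E ->//] /=.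
by case: (ip_form _ _ _).
Qed.

(** Apply the Hopf condition to the degree k component of X.  The vector Psi is chosen so
that pairing with it is f tensor g: this functional kills J tensor L because f
annihilates J, and L tensor J because g does, while on Delta (L_u) it takes the
value f(u) g(u). *)
Lemma ann_mul k (f g : k.-tuple 'I_d -> R[i]) : ann f -> ann g ->
  ann (fun u => f u * g u).
Proof.
move=> Af Ag X JX; have Jp := hcomp_ideal k JX.
have [_ _ _ _ Dtensor] := Delta_comult.
pose Psi : HFF := \sum_(u : k.-tuple 'I_d) \sum_(v : k.-tuple 'I_d) (f u * g v)^* *:
  basis (fun=> 1%:pos) (u : word, v : word).
have PsiE (x y : HF) : '[tensor x y : HFF, Psi] =
    (\sum_(u : k.-tuple 'I_d) x u * f u) * (\sum_(v : k.-tuple 'I_d) y v * g v).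
  rewrite dot_sumr mulr_suml; apply: eq_bigr => u _.
  rewrite dot_sumr mulr_sumr; apply: eq_bigr => v _.
  by rewrite dotZr conjCK (dot_basis (tensor x y : HFF)) /= mul1r; ring.
pose om (T : HFF -> HFF) := '[T xixi, Psi].
have om0 A B T : alg_tensor A B T ->
    (forall Y Z, A Y -> B Z -> '[tensor (Y (xi [::])) (Z (xi [::])) : HFF, Psi] = 0) ->
    om T = 0.
  move=> [n [c [Ts [TsP ->]]]] AB; rewrite /om op_sumE dot_suml big1// => i _.
  have [Y [Z [AY BZ [_ TE]]]] := TsP i.
  by rewrite -[LHS]/('[c i *: Ts i xixi, Psi]) dotZl TE AB// mulr0.
have omD : om (Delta (hcomp k X)) = \sum_(u : k.-tuple 'I_d) X (xi [::]) u * (f u * g u).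
  rewrite /om /hcomp Delta_poly op_sumE dot_suml; apply: eq_bigr => u _.
  rewrite -[LHS]/('[X (xi [::]) u *: Delta (Lword u) xixi, Psi]) dotZl.
  have [_ ->] := Dtensor u; rewrite PsiE !Lword_basis cats0; congr (_ * _).
  have E (h : k.-tuple 'I_d -> R[i]) : \sum_(v : k.-tuple 'I_d) xi u v * h v = h u.
    rewrite (bigD1 u)//= eqxx mul1r big1 ?addr0// => v /negPf vu.
    by rewrite val_eqE vu mul0r.
  by rewrite !E.
rewrite -omD; apply: (@eq0_sqmod_small _ _ 1) => e e0.
have [_ clD] := J_hopf Jp.
have e1 : 0 < ((Num.sqrt e)%:C)%C :> R[i] by rewrite ltcR sqrtr_gt0.
have [|T [Y AY [Z AZ <-]]] := clD 1%N (fun=> om) _ _ e1.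
  by move=> _; exact: wstar_vector_functional.
move=> /(_ ord0); rewrite /om -[(Y + Z) xixi]/(Y xixi + Z xixi) dotDl.
rewrite -![ '[_ xixi, _] ]/(om _) (om0 _ _ _ AY) => [|A B JA LB]; last first.
  by rewrite PsiE Af// mul0r.
rewrite (om0 _ _ _ AZ) => [|A B LA JB]; last by rewrite PsiE Ag// mulr0.
rewrite addr0 subr0 normC_lt ?sqrtr_gt0// sqr_sqrtr ?(ltW e0)// mul1r.
exact: ltW.
Qed.

End HopfIdeal.

(** * The semigroup of a Hopf ideal *)

Section Classes.
Context {R : realType} {d : nat}.
Notation word := (word d).
Notation word0 := (word0 d).
Notation HF := (fock R d).
Notation HFF := (fock2 R d).
Notation xi w := (basis (fun _ : word => 1%:pos : {posnum R}) w : HF).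
Variables (J : set (HF -> HF)) (Delta : (HF -> HF) -> (HFF -> HFF)).
Hypothesis J_ideal : op_ideal calL J.
Hypothesis J_closed : wot_closed J.
Hypothesis J_homogeneous : homogeneous J.
Hypothesis Delta_comult : comultiplication Delta.
Hypothesis J_hopf : forall X, J X -> wstar_closure
  [set Y + Z | Y in alg_tensor J calL & Z in alg_tensor calL J] (Delta X).
Implicit Types (w : word) (u v : word0) (X Y : HF -> HF).

Lemma sim_sym u v : sim J u v -> sim J v u.
Proof. by move/(qP J_ideal)/esym/(qP J_ideal). Qed.

Lemma sim_trans u v r : sim J u v -> sim J v r -> sim J u r.
Proof. by move=> /(qP J_ideal) uv /(qP J_ideal) vr; apply/(qP J_ideal); rewrite uv. Qed.

Lemma sim_mulr u v r : sim J u v -> sim J (mulw u r) (mulw v r).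
Proof.
by move=> /(qP J_ideal) uv; apply/(qP J_ideal); rewrite -!(smulE J_ideal) uv.
Qed.

Lemma Lop_vac u w : Lop u (xi [::]) w = (u == Some w)%:R.
Proof.
case: u => [u|]//.
by rewrite -[Lop _ _]/(Lword u (xi [::])) Lword_basis cats0 xiE eq_sym.
Qed.

Lemma tuple_sum_delta k (t : k.-tuple 'I_d) (f : k.-tuple 'I_d -> R[i]) :
  \sum_(u : k.-tuple 'I_d) (u == t)%:R * f u = f t.
Proof.
by rewrite (bigD1 t)//= eqxx mul1r big1 ?addr0// => u /negPf->; rewrite mul0r.
Qed.

Lemma tuple_sum_Lword k (t : k.-tuple 'I_d) :
  \sum_(u : k.-tuple 'I_d) ((u == t)%:R : R[i]) *: Lword u = Lword t :> (HF -> HF).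
Proof.
by rewrite (bigD1 t)//= eqxx scale1r big1 ?addr0// => u /negPf->; rewrite scale0r.
Qed.

Lemma ann_sim k (t t' : k.-tuple 'I_d) :
  sim J (Some (t : word)) (Some (t' : word)) <-> forall f, ann J f -> f t = f t'.
Proof.
split=> [tt' f Af|tt'].
  apply/eqP; rewrite -subr_eq0 -(Af _ tt'); apply/eqP.
  rewrite -[f t](tuple_sum_delta t) -[f t'](tuple_sum_delta t') -sumrB.
  apply: eq_bigr => u _; rewrite -mulrBl; congr (_ * _).
  rewrite -[RHS]/(Lop (Some (t : word)) (xi [::]) u - Lop (Some (t' : word)) (xi [::]) u).
  by rewrite !Lop_vac !(inj_eq Some_inj) !val_eqE !(eq_sym _ u).
have := @ann_separates _ _ J J_ideal J_closed J_homogeneous k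
  (fun a => (a == t)%:R - (a == t')%:R).
rewrite (eq_bigr (fun u : k.-tuple 'I_d =>
    ((u == t)%:R : R[i]) *: Lword u - ((u == t')%:R : R[i]) *: Lword u)); last first.
  by move=> u _; rewrite scalerBl.
rewrite sumrB !tuple_sum_Lword; apply => f /tt' E.
under eq_bigr do rewrite mulrBl.
by rewrite sumrB !tuple_sum_delta E subrr.
Qed.

Lemma ann_null k (t : k.-tuple 'I_d) :
  sim J (Some (t : word)) None <-> forall f, ann J f -> f t = 0.
Proof.
rewrite /sim [Lop None]/= subr0; split=> [tN f Af|tN].
  rewrite -[f t](tuple_sum_delta t) -[RHS](Af _ tN); apply: eq_bigr => u _; congr (_ * _).
  by rewrite Lop_vac (inj_eq Some_inj) val_eqE eq_sym.
rewrite -[Lop _]/(Lword t) -tuple_sum_Lword.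
apply: (ann_separates J_ideal J_closed J_homogeneous) => f /tN.
by rewrite tuple_sum_delta.
Qed.

(** If the lengths differ, L_w is a homogeneous component of L_w - L_w'. *)
Lemma sim_graded w w' : sim J (Some w) (Some w') ->
  size w = size w' \/ sim J (Some w) None.
Proof.
move=> ww'; have [|ne] := eqVneq (size w) (size w'); first by left.
right; have := hcomp_ideal J_ideal J_closed J_homogeneous (size w) ww'.
rewrite /sim [Lop None]/= subr0.
rewrite (_ : hcomp _ _ = Lop (Some w))//.
rewrite /hcomp -[RHS](tuple_sum_Lword (in_tuple w)); apply: eq_bigr => u _; congr (_ *: _).
rewrite -[LHS]/(Lop (Some w) (xi [::]) u - Lop (Some w') (xi [::]) u).
rewrite !Lop_vac !(inj_eq Some_inj) -[in RHS]val_eqE [in RHS]eq_sym /=.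
rewrite (_ : (w' == u) = false) ?subr0//.
by apply: contraNF ne => /eqP->; rewrite size_tuple.
Qed.

(** The indicator of the class of w belongs to the annihilator of J.  The functions in
the annihilator do not all vanish at w, as w is not null. *)
Lemma class_sum X w : J X -> ~ sim J (Some w) None ->
  \sum_(t : (size w).-tuple 'I_d | `[< sim J (Some (t : word)) (Some w) >])
    X (xi [::]) t = 0.
Proof.
move=> JX wN; set k := size w; pose t0 : k.-tuple 'I_d := in_tuple w.
have [h [Ah h1 h0]] : exists h, [/\ @ann _ _ J k h,
    forall t, (forall f, @ann _ _ J k f -> f t = f t0) -> h t = 1 &
    forall t, ~ (forall f, @ann _ _ J k f -> f t = f t0) -> h t = 0].
  apply: class_indicator; first exact: ann_subspace.
    exact: (ann_mul J_ideal J_closed J_homogeneous Delta_comult J_hopf).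
  apply: contrapT => none; apply: wN; apply/(ann_null t0) => f Af.
  by apply/eqP/negP => f0; apply: none; exists f => //; exact/negP.
rewrite -[RHS](Ah _ JX) big_mkcond; apply: eq_bigr => t _.
case: ifPn => /asboolP tw.
  by rewrite h1 ?mulr1//; apply/(@ann_sim k t t0).
by rewrite h0 ?mulr0// => /(@ann_sim k t t0).
Qed.

End Classes.

(** * The coisometry onto the semigroup space *)

Section Coisometry.
Context {R : realType} {d : nat}.
Notation word := (word d).
Notation word0 := (word0 d).
Notation HF := (fock R d).
Notation HFF := (fock2 R d).
Notation xi w := (basis (fun _ : word => 1%:pos : {posnum R}) w : HF).
Variables (J : set (HF -> HF)) (Delta : (HF -> HF) -> (HFF -> HFF)).
Hypothesis J_ideal : op_ideal calL J.
Hypothesis J_closed : wot_closed J.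
Hypothesis J_homogeneous : homogeneous J.
Hypothesis Delta_comult : comultiplication Delta.
Hypothesis J_hopf : forall X, J X -> wstar_closure
  [set Y + Z | Y in alg_tensor J calL & Z in alg_tensor calL J] (Delta X).
Implicit Types (w : word) (u v : word0) (X Y : HF -> HF).

Lemma q_surj (s : Sgp J) : exists u, q J u = s.
Proof. by have /set_mem[u _ uE] := valP s; exists u; exact: val_inj. Qed.

(** The words of a class, as a list; classes of nonzero elements do not contain the
adjoined zero. *)
Definition members (s : Sgp J) : seq word := pmap id (fset_set (cls s)).

Lemma finite_cls w : ~ sim J (Some w) None -> finite_set (cls (q J (Some w))).
Proof.
move=> wN; apply: sub_finite_set (finite_seq [seq Some a | a <- words (size w)]) => u /(qP J_ideal) uw /=.
case: u uw => [a uw|uw]; last by case: wN; exact: (sim_sym J_ideal uw).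
rewrite mem_map ?mem_words//.
have [->//|uN] := sim_graded J_ideal J_closed J_homogeneous uw.
by case: wN; exact: (sim_trans J_ideal (sim_sym J_ideal uw) uN).
Qed.

Lemma Sgp0_rep (s : Sgp0 J) : exists2 w, val s = q J (Some w) & ~ sim J (Some w) None.
Proof.
have [[w|] ws] := q_surj (val s); last by have := valP s; rewrite -ws eqxx.
exists w => // /(qP J_ideal) E; have := valP s; by rewrite -ws E eqxx.
Qed.

Lemma mem_members (s : Sgp0 J) w : (w \in members (val s)) = (q J (Some w) == val s).
Proof.
have [w0 sE w0N] := Sgp0_rep s.
rewrite mem_pmap map_id in_fset_set; last by rewrite sE; exact: finite_cls.
by apply/idP/eqP => [/set_mem//|h]; apply/mem_set.
Qed.

Lemma members_uniq (s : Sgp J) : uniq (members s).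
Proof. by apply: (@pmap_uniq _ _ id Some) => [[]//|]; exact: fset_uniq. Qed.

Lemma weightE (s : Sgp0 J) : (weight s)%:num = ((size (members (val s)))%:R)^-1 :> R
  /\ (0 < size (members (val s)))%N.
Proof.
have [w0 sE w0N] := Sgp0_rep s.
have sz : size (members (val s)) = #|` fset_set (cls (val s))|%fset.
  rewrite size_pmap; apply/eqP; rewrite -all_count; apply/allP => -[//|].
  rewrite in_fset_set; last by rewrite sE; exact: finite_cls.
  by move=> /set_mem E; have := valP s; rewrite -[val s]E eqxx.
have pos : (0 < size (members (val s)))%N.
  have : w0 \in members (val s) by rewrite mem_members sE eqxx.
  by case: (members _).
by split=> //; rewrite /weight /= -sz prednK.
Qed.

(** The projection of xi w on the invariant functions, for any w in the class s: the
average of the class, as the weight is the inverse of its cardinality. *)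
Definition avg (s : Sgp0 J) : HF :=
  ((weight s)%:num%:C)%C *: \sum_(w <- members (val s)) xi w.

Lemma dot_avg (f : HF) (s : Sgp0 J) :
  '[f, avg s] = ((weight s)%:num%:C)%C * \sum_(w <- members (val s)) f w.
Proof.
rewrite dotZr conj_real_complex dot_sumr; congr (_ * _).
by apply: eq_bigr => w _; rewrite coefE.
Qed.

Lemma avgE (s : Sgp0 J) w : avg s w =
  ((weight s)%:num%:C)%C * (q J (Some w) == val s)%:R.
Proof.
rewrite ell2Z ell2_sum -mem_members; congr (_ * _).
have [ws|ws] := boolP (w \in _).
  rewrite (bigD1_seq w) ?members_uniq// xiE eqxx big1 => [|v /negPf vw]; first exact: addr0.
  by rewrite xiE eq_sym vw.
rewrite big1_seq// => v /andP[_ vs]; rewrite xiE (_ : w == v = false)//.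
by apply: contraNF ws => /eqP->.
Qed.

Notation HS := (HS J).
Notation xs s := (basis (@weight R d J) s : HS).

(** This isometry property of the averages is what the weights of the semigroup space
are made for. *)
Lemma avg_orthogonal (s t : Sgp0 J) : '[avg s, avg t] = '[xs s, xs t].
Proof.
rewrite dot_avg dot_basis; congr (_ * _).
under eq_bigr do rewrite avgE.
rewrite -mulr_sumr basisE eq_sym; have [->|st] := eqVneq t s.
  rewrite (eq_big_seq (fun=> 1)) => [|w]; last by rewrite mem_members => ->.
  have [-> pos] := weightE s.
  rewrite big_const_seq count_predT iter_addr_0 -(rmorph_nat (@real_complex R)) -real_complexM.
  by rewrite mulVf// pnatr_eq0 -lt0n.
rewrite big1_seq ?mulr0// => w /andP[_]; rewrite mem_members => /eqP->.
by rewrite (inj_eq val_inj) (negPf st).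
Qed.

Lemma coisometry_exists : exists W : HF -> HS,
  bdd W /\ forall f s, '[W f, xs s] = '[f, avg s].
Proof.
have [//|s g us|W [lW Wc WE]] := @adjoint_family _ _ (@weight R d J) _ avg 1.
  rewrite mul1r -sqn_finsum// !sqn_lincomb.
  under eq_bigr do under eq_bigr do rewrite avg_orthogonal.
  exact: lexx.
by exists W; split=> //; split=> //; exists 1.
Qed.

Definition qmap : HF -> HS := sval (cid coisometry_exists).
Definition qmap_adj : HS -> HF := adj qmap.
Notation W := qmap.
Notation V := qmap_adj.

Lemma qmap_bdd : bdd W. Proof. by rewrite /qmap; case: cid => /= ? []. Qed.
Lemma qmap_dot f s : '[W f, xs s] = '[f, avg s].
Proof. by rewrite /qmap; case: cid => /= ? []. Qed.
Lemma qmap_adj_bdd : bdd V. Proof. exact: adj_bdd qmap_bdd. Qed.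
Lemma qmap_adjE f h : '[W f, h] = '[f, V h]. Proof. exact: adjE qmap_bdd. Qed.
Lemma qmap_adjEr f h : '[V h, f] = '[h, W f]. Proof. by rewrite dotC -qmap_adjE -dotC. Qed.

Lemma qmap_adj_basis s : V (xs s) = avg s.
Proof. by apply: dot_inj => f; rewrite qmap_adjEr dotC qmap_dot -dotC. Qed.

Lemma qmapK h : W (V h) = h.
Proof.
suff : W \o V = id by move/(congr1 (@^~ h)).
apply: bdd_eq_basis => [||s]; [exact: bdd_comp qmap_bdd qmap_adj_bdd|exact: bdd_id|].
by apply: ell2_ext_dot => t; rewrite /= qmap_adj_basis qmap_dot avg_orthogonal.
Qed.

Lemma x_val (s : Sgp0 J) : x_ (val s) = xs s.
Proof. by rewrite /x_ valK. Qed.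

Lemma x_zero : x_ (q J None) = 0 :> HS.
Proof. by rewrite /x_ insubF// eqxx. Qed.

Lemma qmap_xi w : W (xi w) = x_ (q J (Some w)).
Proof.
apply: ell2_ext_dot => s; rewrite qmap_dot dot_avg.
have -> : \sum_(v <- members (val s)) xi w v = (q J (Some w) == val s)%:R.
  rewrite -mem_members; under eq_bigr do rewrite xiE eq_sym.
  have [ws|ws] := boolP (w \in _).
    rewrite (bigD1_seq w) ?members_uniq// eqxx big1 => [|v /negPf vw]; first exact: addr0.
    by rewrite eq_sym vw.
  rewrite big1_seq// => v /andP[_ vs]; rewrite (_ : w == v = false)//.
  by apply: contraNF ws => /eqP->.
have [qw|qw] := eqVneq (q J (Some w)) (q J None).
  by rewrite qw x_zero dot0l eq_sym (negPf (valP s)) mulr0.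
pose t : Sgp0 J := Sub (q J (Some w)) qw.
by rewrite -[q J (Some w)]/(val t) x_val dot_basis basisE (inj_eq val_inj) eq_sym.
Qed.

Lemma qmap_Lop u w : W (Lop u (xi w)) = x_ (q J (mulw u (Some w))).
Proof.
case: u => [u|]; last by rewrite x_zero (lin0 qmap_bdd.1).
by rewrite -[Lop _ _]/(Lword u (xi w)) Lword_basis qmap_xi.
Qed.

Notation invariant f := (@invariant_off R d (sim J) (short 0) f).

Lemma ext_qmap_adj h u : ext (V h) u = '[h, x_ (q J u)].
Proof. by case: u => [w|]; rewrite ?x_zero ?dot0r//= -coefE qmap_adjEr qmap_xi. Qed.

Lemma qmap_adj_invariant h : invariant (V h).
Proof. by move=> u v /(qP J_ideal) uv _ _; rewrite !ext_qmap_adj uv. Qed.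

(** The projection [V \o W] averages over classes, so it fixes the functions that are
constant on classes and vanish on the null class. *)
Lemma invariantE f : invariant f <-> V (W f) = f.
Proof.
split=> [If|<-]; last exact: qmap_adj_invariant.
have out u : outside (short 0) u by case: u.
apply: ell2_ext => w; rewrite -[LHS]/(ext (V (W f)) (Some w)) ext_qmap_adj.
have [qw|qw] := eqVneq (q J (Some w)) (q J None).
  rewrite qw x_zero dot0r; have /(qP J_ideal) wN := qw.
  by rewrite -[RHS]/(ext f (Some w)) (If _ _ wN (out _) (out _)).
pose t : Sgp0 J := Sub (q J (Some w)) qw.
rewrite -[q J (Some w)]/(val t) x_val qmap_dot dot_avg.
rewrite (eq_big_seq (fun=> f w)) => [|v]; last first.
  rewrite mem_members => /eqP/(qP J_ideal) vw.
  exact: (If _ _ vw (out _) (out _)).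
have [-> pos] := weightE t.
rewrite big_const_seq count_predT iter_addr_0 -[f w *+ _]mulr_natl -(rmorph_nat (@real_complex R)).
by rewrite mulrA -real_complexM mulVf ?mul1r// pnatr_eq0 -lt0n.
Qed.

(** The coefficient of the left-hand side at a class is a multiple of the sum in
[class_sum]. *)
Lemma qmap_ideal X : J X -> W (X (xi [::])) = 0.
Proof.
move=> JX; apply: ell2_ext_dot => s; rewrite qmap_dot dot0l dot_avg.
have [w0 sE w0N] := Sgp0_rep s.
have := class_sum J_ideal J_closed J_homogeneous Delta_comult J_hopf JX w0N.
set k := size w0; set P := fun t : k.-tuple 'I_d => _.
rewrite -big_filter -(big_map (@tval _ _) xpredT (fun w => X (xi [::]) w)) => E.
rewrite [X in _ * X](_ : _ = 0) ?mulr0// -[RHS]E; apply: perm_big.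
apply: uniq_perm; first exact: members_uniq.
  by rewrite map_inj_uniq ?filter_uniq ?index_enum_uniq//; exact: val_inj.
move=> w; rewrite mem_members sE; apply/eqP/mapP.
  move/(qP J_ideal) => ww0.
  have wk : size w == k.
    have [->//|wN] := sim_graded J_ideal J_closed J_homogeneous ww0.
    by case: w0N; exact: (sim_trans J_ideal (sim_sym J_ideal ww0) wN).
  exists (Tuple wk) => //; rewrite mem_filter mem_index_enum andbT.
  exact/asboolP.
move=> [t + ->]; rewrite mem_filter => /andP[/asboolP ? _].
exact/(qP J_ideal).
Qed.

End Coisometry.

(** * The compressed algebra *)

Section Compression.
Context {R : realType} {d : nat}.
Notation word := (word d).
Notation word0 := (word0 d).
Notation HF := (fock R d).
Notation HFF := (fock2 R d).
Notation xi w := (basis (fun _ : word => 1%:pos : {posnum R}) w : HF).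
Variables (J : set (HF -> HF)) (Delta : (HF -> HF) -> (HFF -> HFF)).
Hypothesis J_ideal : op_ideal calL J.
Hypothesis J_closed : wot_closed J.
Hypothesis J_homogeneous : homogeneous J.
Hypothesis Delta_comult : comultiplication Delta.
Hypothesis J_hopf : forall X, J X -> wstar_closure
  [set Y + Z | Y in alg_tensor J calL & Z in alg_tensor calL J] (Delta X).
Implicit Types (w : word) (u v : word0) (X Y : HF -> HF).

Notation HS := (HS J).
Notation xs s := (basis (@weight R d J) s : HS).
Notation W := (qmap J_ideal J_closed J_homogeneous).
Notation V := (qmap_adj J_ideal J_closed J_homogeneous).
Notation invariant f := (@invariant_off R d (sim J) (short 0) f).
Let bW : bdd W := qmap_bdd J_ideal J_closed J_homogeneous.
Let bV : bdd V := qmap_adj_bdd J_ideal J_closed J_homogeneous.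
Let VW := invariantE J_ideal J_closed J_homogeneous.
Let WVid := qmapK J_ideal J_closed J_homogeneous.
Let WVadj := qmap_adjE J_ideal J_closed J_homogeneous.
Let VWadj := qmap_adjEr J_ideal J_closed J_homogeneous.

Definition compress X : HS -> HS := W \o X \o V.

(** The kernel of W is invariant under X. *)
Definition coinvariant X := forall f, W (X (V (W f))) = W (X f).

Lemma compressE X h : compress X h = W (X (V h)). Proof. by []. Qed.

Lemma compress_bdd X : bdd X -> bdd (compress X).
Proof. by move=> bX; exact: bdd_comp (bdd_comp bW bX) bV. Qed.

Lemma compress_comp X Y : coinvariant X -> compress (X \o Y) = compress X \o compress Y.
Proof. by move=> cX; apply/funext => h; rewrite /compress /= cX. Qed.

Lemma compress_lin c X Y : compress (c *: X + Y) = c *: compress X + compress Y.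
Proof.
apply/funext => h; rewrite compressE -[(c *: X + Y) _]/(c *: X (V h) + Y (V h)).
by rewrite (bW.1 c).
Qed.

Lemma compress0 : compress 0 = 0.
Proof. by apply/funext => h; rewrite compressE (lin0 bW.1). Qed.

(** Words in a class keep a common class after multiplication by w, so averaging first
does not change the class of the product. *)
Lemma coinvariant_Lword w : coinvariant (Lword w).
Proof.
suff H : W \o Lword w \o (V \o W) = W \o Lword w by move=> f; exact: (congr1 (@^~ f) H).
apply: bdd_eq_basis => [||v].
- exact: bdd_comp (bdd_comp bW (Lword_bdd w)) (bdd_comp bV bW).
- exact: bdd_comp bW (Lword_bdd w).
have WL a : W (Lword w (xi a)) = x_ (q J (mulw (Some w) (Some a))).
  exact: (qmap_Lop J_ideal J_closed J_homogeneous (Some w)).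
rewrite /= WL qmap_xi.
have [qv|qv] := eqVneq (q J (Some v)) (q J None).
  rewrite qv x_zero (lin0 bV.1) (lin0 (Lword_bdd w).1) (lin0 bW.1).
  by rewrite -(smulE J_ideal) qv (smulE J_ideal) x_zero.
pose s : Sgp0 J := Sub (q J (Some v)) qv.
rewrite -[q J (Some v)]/(val s) x_val qmap_adj_basis (linZ (Lword_bdd w).1) (linZ bW.1).
rewrite (lin_sum (Lword_bdd w).1) (lin_sum bW.1).
rewrite (eq_big_seq (fun=> x_ (q J (mulw (Some w) (Some v))))) => [|u]; last first.
  rewrite (mem_members J_ideal J_closed J_homogeneous) => /eqP us.
  by rewrite WL -!(smulE J_ideal) us.
have [-> pos] := weightE J_ideal J_closed J_homogeneous s.
rewrite big_const_seq count_predT iter_addr_0 -scaler_nat scalerA.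
rewrite -(rmorph_nat (@real_complex R)) -real_complexM mulVf ?scale1r//.
by rewrite pnatr_eq0 -lt0n.
Qed.

Lemma calL_coinvariant X : calL X -> bdd X /\ coinvariant X.
Proof.
move=> /(_ [set Z | bdd Z /\ coinvariant Z]) h; apply: h => [|T clT|_ [u _ <-]]; last first.
- by split; [exact: Lword_bdd|exact: coinvariant_Lword].
- have [/bddP bT _] := (wot_closureP _ _).1 clT; split=> // f.
  apply: dot_inj => g; rewrite !WVadj; apply: (wot_limit2 clT) => Y [_ cY].
  by rewrite -!WVadj cY.
split=> [Y [/bddP]//||c Y Z [bY cY] [bZ cZ]|Y Z [bY cY] [bZ cZ]].
- by split; [exact: bdd0|move=> f].
- split; [exact: bdd_lin|move=> f].
  by have lW := bW.1; rewrite (lW c) cY cZ -lW.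
- by split; [exact: bdd_comp|move=> f /=; rewrite -(cY (Z _)) cZ cY].
Qed.

Lemma compress_Lop u s : compress (Lop u) (x_ s) = x_ (smul (q J u) s).
Proof.
have [v <-] := q_surj s; rewrite (smulE J_ideal).
have cu : coinvariant (Lop u) by have [] := calL_coinvariant (calL_Lop u).
case: v => [v|].
  by rewrite -(qmap_xi J_ideal J_closed J_homogeneous) compressE cu qmap_Lop.
rewrite x_zero (lin0 (compress_bdd _).1); last by have [] := calL_coinvariant (calL_Lop u).
by case: u {cu} => [u|]; rewrite x_zero.
Qed.

(** The operators whose compression lies in a given WOT-closed algebra containing the
generators form themselves a WOT-closed algebra, and it contains the shifts. *)
Lemma compress_calLS X : calL X -> calLS J (compress X).
Proof.
move=> LX A subA clA gensA.
have [Abdd A0 AD AM] := subA.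
suff : bdd X /\ coinvariant X /\ A (compress X) by case=> _ [].
move: LX => /(_ [set Z | bdd Z /\ coinvariant Z /\ A (compress Z)]); apply.
- split=> [Y [/bddP]//||c Y Z [bY [cY AY]] [bZ [cZ AZ]]|Y Z [bY [cY AY]] [bZ [cZ AZ]]].
  + by split; [exact: bdd0|split=> [f|] //=; rewrite compress0].
  + split; [exact: bdd_lin|split=> [f|]]; last by rewrite compress_lin; exact: AD.
    by have lW := bW.1; rewrite (lW c) cY cZ -lW.
  + split; [exact: bdd_comp|split=> [f|]]; last by rewrite compress_comp//; exact: AM.
    by rewrite /= -(cY (Z _)) cZ cY.
- move=> T clT; have [/bddP bT _] := (wot_closureP _ _).1 clT; split=> //; split=> [f|].
    apply: dot_inj => g; rewrite !WVadj; apply: (wot_limit2 clT) => Y [_ [cY _]].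
    by rewrite -!WVadj cY.
  apply: (wot_transfer (Th := compress) _ _ clA clT); last exact: compress_bdd.
    by move=> x y; exists [:: (V x, V y)] => Y _; rewrite big_seq1 compressE WVadj.
  by move=> Y [bY [_ AY]].
- move=> _ [u _ <-]; split; [exact: Lword_bdd|split; first exact: coinvariant_Lword].
  apply: gensA; exists (q J (Some u)); split; last exact: (compress_Lop (Some u)).
  exact/bddP/compress_bdd/Lword_bdd.
Qed.

Lemma Rdel_invariant i f : invariant f -> invariant (Rdel i f).
Proof. exact: (invariant_off_Rdel0 (sim_mulr J_ideal)). Qed.

Lemma VW_Rdel i h : V (W (Rdel i (V h))) = Rdel i (V h).
Proof. by apply/VW/Rdel_invariant; exact: qmap_adj_invariant. Qed.

Lemma compress_Rsh i x y : '[compress (Rsh i) x, y] = '[x, W (Rdel i (V y))].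
Proof. by rewrite compressE WVadj Rsh_adj VWadj. Qed.

(** The adjoint of T, carried to the Fock space as V T* W, commutes with the adjoints of
the right shifts on invariant vectors, and [commutant_lifting] applies to it. *)
Lemma compress_lift (T : HS -> HS) : bdd T ->
  (forall i, T \o compress (Rsh i) = compress (Rsh i) \o T) ->
  exists2 X, calL X & T = compress X.
Proof.
move=> bT commT.
have bT' := adj_bdd bT.
(* The adjoint of the commutation relation. *)
have comm' i h : W (Rdel i (V (adj T h))) = adj T (W (Rdel i (V h))).
  apply: dot_inj => x; rewrite dotC [RHS]dotC; congr (_^*).
  rewrite -compress_Rsh -(adjE _ _ bT) -(adjE _ _ bT) -compress_Rsh.
  by rewrite -[T (compress _ x)]/((T \o compress (Rsh i)) x) commT.
have [||X [bX cX XE]] := @commutant_lifting R d (sim J) (sim_sym J_ideal)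
    (sim_trans J_ideal) (sim_mulr J_ideal)
    (sim_graded J_ideal J_closed J_homogeneous) (V \o adj T \o W).
- exact: bdd_comp (bdd_comp bV bT') bW.
- by move=> f i If; rewrite /= -VW_Rdel comm' ((VW f).1 If).
exists X; first exact: rcomm_calL.
apply/funext => x; apply: dot_inj => y.
rewrite compressE WVadj (adjE _ _ bX) XE; last exact: qmap_adj_invariant.
by rewrite /= WVid VWadj WVid (adjE _ _ bT).
Qed.

(** The compressions form a WOT-closed set: commuting with a compressed right shift is a
WOT-closed condition, and by [compress_lift] it characterizes compressions. *)
Lemma calLS_compress T : calLS J T <-> exists2 X, calL X & T = compress X.
Proof.
split=> [|[X LX ->]]; last exact: compress_calLS.
have [Lbdd L0 LD LM] := (@calL_subalgebra R d).
move=> /(_ [set T | exists2 X, calL X & T = compress X]); apply.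
- split=> [_ [X LX ->]||c _ _ [X LX ->] [Y LY ->]|_ _ [X LX ->] [Y LY ->]].
  + by apply/bddP/compress_bdd; have [] := calL_coinvariant LX.
  + by exists 0 => //; rewrite compress0.
  + by exists (c *: X + Y); [exact: LD|rewrite compress_lin].
  + exists (X \o Y); first exact: LM.
    by rewrite compress_comp//; have [] := calL_coinvariant LX.
- move=> S clS; have [/bddP bS _] := (wot_closureP _ _).1 clS.
  apply: compress_lift => // i; apply/funext => x; apply: dot_inj => y.
  rewrite /= compress_Rsh; apply: (wot_limit2 clS) => _ [X LX ->].
  have [_ coX] := calL_coinvariant LX; have [_ cX] := calL_bdd_rcomm LX.
  by rewrite !compressE coX cX [RHS]WVadj VW_Rdel WVadj Rsh_adj.
- move=> S [s [/bddP bS SE]]; have [u us] := q_surj s.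
  exists (Lop u); first exact: calL_Lop.
  apply: bdd_eq_basis => // [|t].
    by apply: compress_bdd; have [] := calL_coinvariant (calL_Lop u).
  by rewrite -(x_val t) SE compress_Lop us.
Qed.

End Compression.

Theorem theorem3p6 (R : realType) (d : nat)
    (Delta : (fock R d -> fock R d) -> (fock2 R d -> fock2 R d))
    (J : set (fock R d -> fock R d)) :
  (0 < d)%N ->
  comultiplication Delta ->
  hopf_ideal Delta J ->
  homogeneous J ->
  unitarily_equivalent (calLJ J) (calLS J).
Proof.
move=> _ Dcom [Jid Jcl Jhopf] Jhom.
pose W := qmap Jid Jcl Jhom; pose V := qmap_adj Jid Jcl Jhom.
have bW : bdd W := qmap_bdd Jid Jcl Jhom.
have bV : bdd V := qmap_adj_bdd Jid Jcl Jhom.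
have WVid h : W (V h) = h := qmapK Jid Jcl Jhom h.
have VWadj f h : '[V h, f] = '[h, W f] := qmap_adjEr Jid Jcl Jhom f h.
have WVadj f h : '[W f, h] = '[f, V h] := qmap_adjE Jid Jcl Jhom f h.
have VW f := invariantE Jid Jcl Jhom f.
set G := [set X (basis _ [::]) | X in J].
have V_perp h : V h \in perp_pred (H := fock R d) G.
  apply/asboolP => _ [X JX <-].
  have WX : W (X (basis _ [::])) = 0 := qmap_ideal Jid Jcl Jhom Dcom Jhopf JX.
  by rewrite VWadj WX dot0r.
have perp_VW (x : perp (H := fock R d) G) : V (W (perp_val x)) = perp_val x.
  apply/VW => u v uv _ _; have /asboolP xG := perpP x.
  (* The values of x on a class are its products with vectors that differ by
     elements of J xi_0. *)
  have E r : ext (perp_val x) r = '[perp_val x, Lop r (basis _ [::])].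
    case: r => [w|]; last by rewrite -[Lop _ _]/(0 : fock R d) dot0r.
    by rewrite -[Lop _ _]/(Lword w (basis _ [::])) Lword_basis cats0 coefE.
  apply/eqP; rewrite -subr_eq0 !E -dotBr; apply/eqP/xG.
  by exists (Lop u - Lop v).
have UK h : W (perp_val (Perp (V_perp h))) = h by exact: WVid.
exists (fun x : N_ J => W (perp_val x)); split.
- by move=> a x y; rewrite -[LHS]/(W (a *: perp_val x + perp_val y)) bW.1.
- exists (fun h => Perp (V_perp h)) => [x|h]; last exact: UK.
  by apply/val_inj/perp_VW.
- by move=> x y; rewrite WVadj perp_VW.
move=> T; split.
- move=> /(calLS_compress Jid Jcl Jhom)[X LX TE].
  exists (fun x => Perp (V_perp (W (X (perp_val x))))).
    exists X => // x y.
    suff : '[X (perp_val x) - V (W (X (perp_val x))), perp_val y] = 0 by [].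
    by rewrite -(perp_VW y) dotBl -!WVadj WVid subrr.
  by move=> x; rewrite UK TE compressE -/W -/V perp_VW.
move=> [B [X LX BE] TB]; apply/(calLS_compress Jid Jcl Jhom); exists X => //.
apply/funext => h; rewrite -[h in LHS]UK TB compressE -/W -/V.
apply: dot_inj => k; rewrite !WVadj.
have /eqP := BE (Perp (V_perp h)) (Perp (V_perp k)).
by rewrite dotBl subr_eq0 => /eqP.
Qed.
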